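(* Let $K$ be a locally compact commutative hypergroup and let $\alpha\in\widehat K$ be a real-valued hermitian character of $K$. Then $K$ is $\alpha$-amenable if and only if the hypergroup algebra $L^1(K)$ is $\alpha$-left amenable.
   Context: $K$ is a locally compact commutative hypergroup in the sense of Jewett, with convolution of point measures $p(x,y)\in M^1(K)$ (probability measures), $p(x,y)=p(y,x)$, involution $x\mapsto\tilde x$, identity $e$, and Haar measure $m$ (which exists and is unique up to scaling). The translation of a function is $T_xf(y)=\int_K f\,dp(x,y)$. $L^1(K)=L^1(K,m)$ is a commutative Banach $*$-algebra with $f*g(x)=\int_K f(y)\,T_{\tilde y}g(x)\,dm(y)$ and $f^*(x)=\overline{f(\tilde x)}$; its dual is $L^\infty(K)$. $\widehat K$ is the set of hermitian characters: bounded continuous $\alpha:K\to\mathbb C$ with $\alpha(e)=1$, $\int_K\alpha\,dp(x,y)=\alpha(x)\alpha(y)$ and $\alpha(\tilde x)=\overline{\alpha(x)}$ for all $x,y\in K$. The Fourier transform of $f\in L^1(K)$ is $\widehat f(\alpha)=\int_K f(x)\overline{\alpha(x)}\,dm(x)$. $K$ is called $\alpha$-amenable ($\alpha\in\widehat K$) if there is $m_\alpha\in L^\infty(K)^*$ (a bounded linear functional) with $m_\alpha(\alpha)=1$ and $m_\alpha(T_xf)=\alpha(x)m_\alpha(f)$ for all $f\in L^\infty(K)$, $x\in K$. A Banach $L^1(K)$-bimodule $X$ is called an $\alpha$-left $L^1(K)$-module if its left module multiplication is $f\cdot x=\widehat f(\alpha)x$ for all $f\in L^1(K)$, $x\in X$.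 The dual $X^*$ carries the canonical dual bimodule structure $(f\cdot\varphi)(x)=\varphi(x\cdot f)$, $(\varphi\cdot f)(x)=\varphi(f\cdot x)$. A continuous linear map $D:L^1(K)\to X^*$ is a derivation if $D(f*g)=D(f)\cdot g+f\cdot D(g)$ for all $f,g\in L^1(K)$, and is inner if there is $\varphi\in X^*$ with $D(f)=f\cdot\varphi-\varphi\cdot f$ for all $f$. $L^1(K)$ is called $\alpha$-left amenable if for every $\alpha$-left $L^1(K)$-module $X$ every continuous derivation $D:L^1(K)\to X^*$ is inner. *)

(* Defs.v *)
From HB Require Import structures.
From mathcomp Require Import all_boot all_order all_algebra.
From mathcomp Require Import complex.
From mathcomp Require Import all_classical all_reals all_analysis.

Set Implicit Arguments.
Unset Strict Implicit.
Unset Printing Implicit Defensive.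

Import Order.TTheory GRing.Theory Num.Theory numFieldNormedType.Exports.

Local Open Scope classical_set_scope.
Local Open Scope ring_scope.

(* Over R[i], [`|z|] is itself an element of R[i] (with zero imaginary part)
   and [<=], [<] are the partial order in which comparable elements have the
   same imaginary part.  [complex.Re `|z|] is the modulus of z as an element
   of R. *)

Section BorelMeasures.
Variables (R : realType) (K : ptopologicalType).

(* The carrier of K with its Borel sigma-algebra.  The chosen point of K (which
   measurable types require) plays no role. *)
Definition borel := g_sigma_algebraType (@open K).

(* Measures of the library are functions on all subsets, constrained only on
   the measurable ones: two measures are therefore compared on Borel sets. *)
Definition eq_measure (mu nu : set borel -> \bar R) :=
  forall A : set borel, measurable A -> mu A = nu A.

Definition radon (mu : set borel -> \bar R) :=
  [/\ forall C : set K, compact C -> (mu C < +oo)%E,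
      forall A : set borel, measurable A ->
        mu A = ereal_inf [set mu U | U in [set U : set K | open U /\ A `<=` U]]
    & forall U : set K, open U ->
        mu U = ereal_sup [set mu C | C in [set C : set K | compact C /\ C `<=` U]]].

Definition msupp (mu : set borel -> \bar R) : set K :=
  [set z | forall U : set K, open U -> U z -> (0 < mu U)%E].

Definition Cc (f : K -> R) :=
  continuous f /\ compact (closure [set x | f x != 0]).

Definition cintegral (mu : {measure set borel -> \bar R}) (f : K -> R[i]) : R[i] :=
  Complex (\int[mu]_x complex.Re (f x)) (\int[mu]_x complex.Im (f x)).

End BorelMeasures.

(* Hypergroup in the sense of Jewett, given by the convolution of point
   measures.  [conv_cont] is continuity for the cone topology, which on
   probability measures is the topology generated by C_c(K).
   [conv_supp_cont] is continuity of the support for the Michael topology on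
   the nonempty compact sets, with subbase
   {C | C meets U and C is contained in V}, U and V open. *)
Record hypergroup (R : realType) (K : ptopologicalType) := Hypergroup {
  conv : K -> K -> probability (borel K) R;
  hinv : K -> K;
  hid : K;
  hyper_hausdorff : hausdorff_space K;
  hyper_locally_compact : locally_compact [set: K];
  conv_radon : forall x y, radon (conv x y);
  conv_cont : forall f : K -> R, Cc f ->
    continuous (fun xy : K * K => \int[conv xy.1 xy.2]_t f t);
  conv_supp_compact : forall x y, compact (msupp (conv x y));
  conv_supp_cont : forall U V : set K, open U -> open V ->
    open [set xy : K * K | msupp (conv xy.1 xy.2) `&` U !=set0 /\
                           msupp (conv xy.1 xy.2) `<=` V];
  conv_assoc : forall (x y z : K) (f : K -> R), Cc f ->
    \int[conv x y]_t \int[conv t z]_s f s = \int[conv y z]_t \int[conv x t]_s f s;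
  conv_idl : forall x, eq_measure (conv hid x) (dirac (x : borel K));
  conv_idr : forall x, eq_measure (conv x hid) (dirac (x : borel K));
  hinv_cont : continuous hinv;
  hinvK : involutive hinv;
  conv_inv : forall x y,
    eq_measure (conv (hinv y) (hinv x)) (fun A => conv x y (hinv @^-1` A));
  conv_supp_id : forall x y, msupp (conv x y) hid <-> x = hinv y
}.

Section Hypergroup.
Variables (R : realType) (K : ptopologicalType) (H : hypergroup R K).
Implicit Types (f g : K -> R[i]) (x y : K).

Definition commutative_hypergroup :=
  forall x y, eq_measure (conv H x y) (conv H y x).

Definition translate x f : K -> R[i] := fun y => cintegral (conv H x y) f.

Definition hermitian_character (alpha : K -> R[i]) :=
  [/\ continuous (alpha : K -> R[i]^o),
      exists M : R[i], forall x, `|alpha x| <= M,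
      alpha (hid H) = 1,
      forall x y, cintegral (conv H x y) alpha = alpha x * alpha y
    & forall x, alpha (hinv H x) = (alpha x)^*].

Definition haar_measure (m : {measure set (borel K) -> \bar R}) :=
  [/\ radon m, (0 < m setT)%E
    & forall x (f : K -> R), Cc f ->
        \int[m]_y \int[conv H x y]_t f t = \int[m]_y f y].

(* Elements of L^1 and L^oo are represented by functions, without passing to
   classes.  Linear maps out of these spaces are given on all functions but
   constrained only on representatives; linearity and boundedness for the
   seminorm make them well defined on classes, hence the same thing as bounded
   linear maps on the quotient Banach spaces. *)
Definition linear_on (P : (K -> R[i]) -> Prop) (V : lmodType R[i])
    (T : (K -> R[i]) -> V) :=
  forall (a : R[i]) f g, P f -> P g ->
    T (fun x => a * f x + g x) = a *: T f + T g.

Variable m : {measure set (borel K) -> \bar R}.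

Definition L1 f :=
  m.-integrable setT (fun x : borel K => (complex.Re (f x))%:E) /\
  m.-integrable setT (fun x : borel K => (complex.Im (f x))%:E).

Definition norm1 f : R := \int[m]_x complex.Re `|f x|.

Definition convolution f g : K -> R[i] :=
  fun x => cintegral m (fun y => f y * translate (hinv H y) g x).

Definition fourier f (alpha : K -> R[i]) : R[i] :=
  cintegral m (fun x => f x * (alpha x)^*).

(* K need not be sigma-compact: L^oo, as the dual of L^1, consists of the
   locally measurable, locally essentially bounded functions, modulo locally
   null sets. *)
Definition locally_measurable f :=
  forall C : set K, compact C ->
    measurable_fun (C : set (borel K)) (fun x : borel K => complex.Re (f x)) /\
    measurable_fun (C : set (borel K)) (fun x : borel K => complex.Im (f x)).

Definition locally_null (A : set K) :=
  forall C : set K, compact C -> m.-negligible (C `&` A).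

Definition ess_bounds f : set R :=
  [set M | 0 <= M /\ locally_null [set x | M < complex.Re `|f x|]].

Definition Linfty f := locally_measurable f /\ ess_bounds f !=set0.

Definition norm_infty f : R := inf (ess_bounds f).

Definition alpha_amenable (alpha : K -> R[i]) :=
  exists ma : (K -> R[i]) -> R[i],
    [/\ linear_on Linfty (ma : (K -> R[i]) -> R[i]^o),
        exists c : R, forall f, Linfty f -> complex.Re `|ma f| <= c * norm_infty f,
        ma alpha = 1
      & forall f x, Linfty f -> ma (translate x f) = alpha x * ma f].

Record banach_bimodule (X : completeNormedModType R[i]) := BanachBimodule {
  lact : (K -> R[i]) -> X -> X;
  ract : X -> (K -> R[i]) -> X;
  lact_linearl : forall u, linear_on L1 (fun f => lact f u);
  ract_linearr : forall u, linear_on L1 (fun f => ract u f);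
  lact_linearr : forall f, L1 f -> linear (lact f);
  ract_linearl : forall f, L1 f -> linear (fun u => ract u f);
  lact_bounded : exists c : R, forall f u, L1 f ->
    complex.Re `|lact f u| <= c * norm1 f * complex.Re `|u|;
  ract_bounded : exists c : R, forall f u, L1 f ->
    complex.Re `|ract u f| <= c * norm1 f * complex.Re `|u|;
  lactA : forall f g u, L1 f -> L1 g ->
    lact (convolution f g) u = lact f (lact g u);
  ractA : forall f g u, L1 f -> L1 g ->
    ract u (convolution f g) = ract (ract u f) g;
  lact_ract : forall f g u, L1 f -> L1 g ->
    ract (lact f u) g = lact f (ract u g)
}.

Section Derivations.
Variables (X : completeNormedModType R[i]) (B : banach_bimodule X).

Definition alpha_left_module (alpha : K -> R[i]) :=
  forall f u, L1 f -> lact B f u = fourier f alpha *: u.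

(* The dual X^* consists of the continuous maps of type {linear X -> R[i]^o}. *)
Definition dual_lact f (phi : X -> R[i]) : X -> R[i] := fun u => phi (ract B u f).
Definition dual_ract (phi : X -> R[i]) f : X -> R[i] := fun u => phi (lact B f u).

(* A linear map from L^1 to the Banach space X^* is continuous iff it is
   bounded, which is the form used here. *)
Definition derivation (D : (K -> R[i]) -> {linear X -> R[i]^o}) :=
  [/\ forall f, L1 f -> continuous (D f),
      forall u, linear_on L1 (fun f => D f u),
      exists c : R, forall f u, L1 f ->
        complex.Re `|D f u| <= c * norm1 f * complex.Re `|u|
    & forall f g u, L1 f -> L1 g ->
        D (convolution f g) u = dual_ract (D f) g u + dual_lact f (D g) u].

Definition inner (D : (K -> R[i]) -> {linear X -> R[i]^o}) :=
  exists2 phi : {linear X -> R[i]^o}, continuous phi &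
    forall f u, L1 f -> D f u = dual_lact f phi u - dual_ract phi f u.

End Derivations.

Definition alpha_left_amenable (alpha : K -> R[i]) :=
  forall (X : completeNormedModType R[i]) (B : banach_bimodule X),
    alpha_left_module B alpha ->
    forall D : (K -> R[i]) -> {linear X -> R[i]^o},
      derivation B D -> inner B D.

End Hypergroup.

(* Main.v *)
(* Let k be a function of C_c(K) with integral 1 against alpha.  If M is an
   alpha-mean and D a derivation into X^*, then u |-> - M(x |-> D(T_x k)(u))
   implements D: apply the derivation identity to f * T_x k and use
   \int T_x k alpha = alpha(x).

   Conversely, let X be the space of bounded continuous functions vanishing at
   e, with f . u = f^(alpha) u and u . f = f * u - (f * u)(e) alpha.  Then
   D f (u) = (f * u)(e) is a derivation.  If phi implements it, put
   M(h) = h(e) - phi(h - h(e) alpha) for h bounded continuous; then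
   M(alpha) = 1, M(f * h) = f^(alpha) M(h), and k * T_y h = (T_y k) * h gives
   M(T_y h) = alpha(y) M(h).  Composing M with the averages
   h |-> (x |-> \int h T_{x~} k) yields the mean on L^oo.

   As K need not be sigma-compact, nor the Borel sets of K x K generated by
   rectangles, Fubini's theorem is not available: integrals are exchanged on
   C_c(K) only, and the estimate |\int u - \int v| <= 2 \int E for
   |u - v| <= E, with v integrable and E lower semicontinuous but u arbitrary,
   carries the identities over to L^1. *)

From Pilot Require Import Defs.
From HB Require Import structures.
From mathcomp Require Import all_boot all_order all_algebra.
From mathcomp Require Import complex.
From mathcomp Require Import all_classical all_reals all_analysis.
From mathcomp Require Import measurable_realfun lra ring.
Import Pilot.Defs.
Set Implicit Arguments.
Unset Strict Implicit.
Unset Printing Implicit Defensive.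
Import Order.TTheory GRing.Theory Num.Theory numFieldNormedType.Exports.
Local Open Scope classical_set_scope.
Local Open Scope ring_scope.

(** * Locally compact Hausdorff spaces *)

(** X models the quotient of the bounded continuous functions by the line of alpha: h |-> h - h(e)
    alpha projects onto it, and since f * alpha = f^(alpha) alpha, the right action is the one
    induced by u |-> f * u. On all bounded continuous functions the same derivation is implemented
    by evaluation at e, but that functional does not kill alpha and so does not live on the
    quotient. An implementing phi is a second solution, and the difference of the two is an
    eigenfunctional with value 1 at alpha.

    Both directions need \int g T_x f = \int f T_{x~} g, which is not an axiom. It follows from
    invariance with a symmetric kernel k concentrated at e: the double integral of f(z) k(z~ * x *
    y) g(y) is close to \int k times either side. Closeness rests on supports: c in x * z forces z
    in x~ * c, so f(y) is near f(s~) once s * y meets a small neighbourhood of e.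

    Expressions such as D(T_x v)(u), or \int r T_x v with r essentially bounded, have the form L(T_x
    v) with L a functional on C_c(K) bounded on each compact support. Fubini for two such
    functionals is the common tool. *)

Section LocallyCompact.
Variables (R : realType) (K : ptopologicalType).
Hypothesis hausK : hausdorff_space K.
Hypothesis lcK : locally_compact [set: K].
Implicit Types (f g v : K -> R) (A B C U V : set K).

Lemma Cc_intro f B : continuous f -> compact B -> (forall x, f x != 0 -> B x) ->
  Cc f.
Proof.
move=> cf cB fB; split => //.
have clB : closed B by exact: compact_closed.
apply: (subclosed_compact _ cB); first exact: closed_closure.
by move/closure_id : clB => ->; apply: closureS => x /= /fB.
Qed.

Lemma Cc_supp f : Cc f -> exists2 B, compact B & forall x, f x != 0 -> B x.
Proof.
by move=> [_ cf]; eexists; [exact: cf|move=> x fx; exact: subset_closure].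
Qed.

Lemma relcompact_nbhd (x : K) : exists V, [/\ open V, V x & exists2 C, compact C & V `<=` C].
Proof.
have [U] := @lcK x I; rewrite withinET => xU [cU _].
exists (U^°); split; [exact: open_interior| exact: xU |].
by exists U => //; exact: interior_subset.
Qed.

Lemma finite_cover A (N : K -> set K) : compact A -> (forall x, A x -> open (N x) /\ N x x) ->
  exists2 s : seq K, (forall z, z \in s -> A z) & forall x, A x -> exists2 z, z \in s & N z x.
Proof.
rewrite compact_cover => /(_ K A N) h hN.
have [||D DA AD] := h.
- by move=> i /hN[].
- by move=> x Ax; exists x => //; case: (hN x Ax).
exists (finmap.enum_fset D).
  by move=> z zD; have := DA z zD; rewrite inE.
by move=> x /AD[z zD Nz]; exists z.
Qed.

Lemma relcompact_nbhd_set C : compact C ->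
  exists V, [/\ open V, C `<=` V & exists2 C', compact C' & V `<=` C'].
Proof.
move=> cC; have /choice[V hV] := relcompact_nbhd.
have [|s _ Cs] := @finite_cover C V cC.
  by move=> x _; case: (hV x).
have /choice[W hW] : forall x, exists C', compact C' /\ V x `<=` C'.
  by move=> x; case: (hV x) => _ _ [C' ? ?]; exists C'.
exists (\bigcup_(i in [set` s]) V i); split.
- by apply: bigcup_open => i _; case: (hV i).
- by move=> x /Cs[z zs Vz]; exists z.
- exists (\big[setU/set0]_(i <- s) W i).
    by apply: bigsetU_compact => i _; case: (hW i).
  by rewrite -bigcup_seq; apply: subset_bigcup => i _; case: (hW i).
Qed.

(** Complete regularity gives a function that is 0 at x and 1 off the intersection of U and V; one
    minus it is the bump, and V confines its support to a compact set. *)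
Lemma bump_pt (x : K) U : open U -> U x ->
  exists f, [/\ Cc f, (forall y, 0 <= f y <= 1), f x = 1 & forall y, f y != 0 -> U y].
Proof.
move=> oU Ux; have [V [oV Vx [C cC VC]]] := relcompact_nbhd x.
have cr := @locally_compact_completely_regular K R lcK hausK.
have cl : closed (~` (U `&` V)) by rewrite closedC; exact: openI.
have nx : ~ (~` (U `&` V)) x by move=> h; apply: h.
have [f [cf f01 f0 f1]] := (@uniform_separatorP K R _ _).1 (cr x _ cl nx).
have hf y : 0 <= f y <= 1 by have := f01 (f y) (imageT f y); rewrite /= in_itv.
have s y : 1 - f y != 0 -> (U `&` V) y.
  move=> h; apply: contrapT => nUV; move: h.
  by rewrite (f1 (f y)) ?subrr ?eqxx//; exists y.
exists (fun y => 1 - f y); split.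
- apply: (@Cc_intro _ C) => //.
    by move=> y; apply: cvgB; [exact: cvg_cst|exact: cf].
  by move=> y /s[_ /VC].
- by move=> y; have := hf y; lra.
- by rewrite (f0 (f x)) ?subr0//; exists x.
- by move=> y /s[].
Qed.

Lemma Cc_continuous f : Cc f -> continuous f. Proof. by case. Qed.

Lemma Cc_lin (a : R) f g : Cc f -> Cc g -> Cc (fun x => a * f x + g x).
Proof.
move=> cf cg; have [B cB fB] := Cc_supp cf; have [C cC gC] := Cc_supp cg.
apply: (@Cc_intro _ (B `|` C)); last 2 first.
- exact: compactU.
- move=> x h; have [f0|/fB] := eqVneq (f x) 0; last by left.
  by right; apply: gC; move: h; rewrite f0 mulr0 add0r.
move=> x; apply: cvgD; last exact: (Cc_continuous cg).
by apply: cvgM; [exact: cvg_cst|exact: (Cc_continuous cf)].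
Qed.

Lemma Cc0 : Cc (fun _ : K => 0 : R).
Proof.
by apply: (@Cc_intro _ set0); [exact: cst_continuous|exact: compact0|move=> x; rewrite eqxx].
Qed.

Lemma Cc_comp (F : R -> R) f : continuous F -> F 0 = 0 -> Cc f -> Cc (F \o f).
Proof.
move=> cF F0 cf; have [B cB fB] := Cc_supp cf.
apply: (Cc_intro _ cB).
  by move=> x; apply: continuous_comp; [exact: (Cc_continuous cf)|exact: cF].
by move=> x h; apply: fB; apply: contraNneq h => /= ->; rewrite F0.
Qed.

Lemma Cc_mulr f g : Cc f -> continuous g -> Cc (fun x => f x * g x).
Proof.
move=> cf cg; have [B cB fB] := Cc_supp cf.
apply: (Cc_intro _ cB); last by move=> x; rewrite mulf_eq0 negb_or => /andP[/fB].
by move=> x; apply: cvgM; [exact: (Cc_continuous cf)|exact: cg].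
Qed.

Lemma Cc_mull f g : continuous f -> Cc g -> Cc (fun x => f x * g x).
Proof. by move=> cf cg; under eq_fun do rewrite mulrC; exact: Cc_mulr. Qed.

Lemma Cc_sum (I : Type) (s : seq I) (F : I -> K -> R) :
  (forall i, Cc (F i)) -> Cc (fun x => \sum_(i <- s) F i x).
Proof.
move=> h; elim: s => [|i s ih].
  by rewrite (_ : (fun _ => _) = fun=> 0); [exact: Cc0|apply/funext => x; rewrite big_nil].
rewrite (_ : (fun _ => _) = fun x => 1 * F i x + \sum_(i <- s) F i x).
  exact: Cc_lin.
by apply/funext => x; rewrite big_cons mul1r.
Qed.

Lemma Cc_scale (a : R) f : Cc f -> Cc (fun x => a * f x).
Proof. by move=> cf; apply: Cc_mull => //; exact: cst_continuous. Qed.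

Lemma Cc_add f g : Cc f -> Cc g -> Cc (fun x => f x + g x).
Proof.
by move=> cf cg; have := Cc_lin 1 cf cg; under eq_fun do rewrite mul1r.
Qed.

Lemma Cc_sub f g : Cc f -> Cc g -> Cc (fun x => f x - g x).
Proof.
move=> cf cg; have := Cc_lin (-1) cg cf.
by under eq_fun do rewrite mulN1r addrC.
Qed.

Lemma Cc_norm f : Cc f -> Cc (fun x => `|f x|).
Proof.
move=> cf; apply: (@Cc_comp (fun x => `|x|)) => //; last exact: normr0.
exact: norm_continuous.
Qed.

Lemma continuous_maxr (T : topologicalType) (f g : T -> R) :
  continuous f -> continuous g -> continuous (fun x => Num.max (f x) (g x)).
Proof. by move=> cf cg x; apply: continuous_max; [exact: cf|exact: cg]. Qed.

Lemma Cc_max f g : Cc f -> Cc g -> Cc (fun x => Num.max (f x) (g x)).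
Proof.
move=> cf cg; have [B cB fB] := Cc_supp cf; have [C cC gC] := Cc_supp cg.
apply: (@Cc_intro _ (B `|` C)); last 2 first.
- exact: compactU.
- move=> x h; have [f0|/fB] := eqVneq (f x) 0; last by left.
  right; apply: gC; apply: contraNneq h => g0; by rewrite f0 g0 maxxx.
by apply: continuous_maxr; exact: Cc_continuous.
Qed.

Lemma Cc_bounded f : Cc f -> exists2 M, 0 <= M & forall x, `|f x| <= M.
Proof.
move=> cf; have [B cB fB] := Cc_supp cf.
have : compact (f @` B).
  by apply: continuous_compact => //; apply: continuous_subspaceT; exact: (Cc_continuous cf).
move=> /compact_bounded[M [_ hM]].
exists (`|M| + 1) => [|x]; first by rewrite addr_ge0.
have [->|/fB fx] := eqVneq (f x) 0; first by rewrite normr0 addr_ge0.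
apply: (hM (`|M| + 1)); last by exists x.
by rewrite (le_lt_trans (ler_norm _))// ltrDl.
Qed.

(** A partition of unity on A subordinate to the sets [N z], supported in U: bumps at finitely many
    points, divided by their sum. *)
Lemma PU A U (N : K -> set K) : compact A -> open U -> A `<=` U ->
  (forall x, open (N x) /\ N x x) ->
  exists (s : seq K) (rho : K -> K -> R),
  [/\ (forall z, Cc (rho z)), (forall z x, 0 <= rho z x),
    (forall z x, rho z x != 0 -> N z x /\ U x),
    (forall x, A x -> \sum_(z <- s) rho z x = 1) &
    (forall x, \sum_(z <- s) rho z x <= 1)].
Proof.
move=> cA oU AU hN.
have /choice[b hb] : forall x, exists f : K -> R, [/\ Cc f, (forall y, 0 <= f y <= 1),
    (U x -> f x = 1) & forall y, f y != 0 -> (N x `&` U) y].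
  move=> x; have [Ux|nUx] := pselect (U x); last first.
    exists (fun=> 0); split => //; [exact: Cc0|by move=> y; rewrite lexx ler01|by move=> y; rewrite eqxx].
  have [oN Nx] := hN x.
  have [//|f [cf f01 fx fs]] := @bump_pt x (N x `&` U) (openI oN oU).
  by exists f.
have [|D _ AD] := @finite_cover A (fun x => [set y | 1/2 < b x y]) cA.
  move=> z Az; have [cb _ bz _] := hb z; split; last by rewrite /= bz; [lra|exact: AU].
  by apply: (@open_comp _ _ (b z) [set t | 1/2 < t]);
    [move=> ? _; exact: (Cc_continuous cb)|exact: open_gt].
(* The maximum with 1/2 keeps the denominator positive everywhere and changes nothing on A, where
   some bump already exceeds 1/2. *)
pose S x : R := Num.max (\sum_(z <- D) b z x) (1/2).
have S0 x : 1/2 <= S x by rewrite le_max lexx orbT.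
have Sp x : 0 < S x by have := S0 x; lra.
exists D, (fun z x => b z x * (S x)^-1); split.
- move=> z; have [cb _ _ _] := hb z; apply: Cc_mulr => //.
  move=> x; apply: cvgV; first by rewrite gt_eqF.
  apply: (@continuous_maxr _ (fun x => \sum_(z <- D) b z x) (fun=> 1/2)); last exact: cst_continuous.
  by apply: Cc_continuous; apply: Cc_sum => i; case: (hb i).
- move=> z x; have [_ /(_ x)/andP[? _] _ _] := hb z.
  by rewrite mulr_ge0// invr_ge0 ltW.
- move=> z x; rewrite mulf_eq0 negb_or => /andP[/[swap] _].
  by have [_ _ _ /(_ x) h] := hb z => /h[].
- move=> x Ax; rewrite -mulr_suml; suff -> : S x = \sum_(z <- D) b z x.
    rewrite divff// gt_eqF//.
    have [z /= zD bz] := AD _ Ax.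
    rewrite (big_rem z)//=; rewrite ltr_pwDl//; first by move: bz; rewrite /=; lra.
    by apply: sumr_ge0 => i _; have [_ /(_ x)/andP[? _] _ _] := hb i.
  rewrite /S; apply/max_idPl; have [z /= zD bz] := AD _ Ax.
  rewrite (big_rem z)//=; apply: (le_trans (ltW bz)); rewrite lerDl.
  by apply: sumr_ge0 => i _; have [_ /(_ x)/andP[? _] _ _] := hb i.
- by move=> x; rewrite -mulr_suml ler_pdivrMr// mul1r le_max lexx.
Qed.

Lemma bump_set A U : compact A -> open U -> A `<=` U ->
  exists f, [/\ Cc f, (forall y, 0 <= f y <= 1), (forall x, A x -> f x = 1) &
    forall y, f y != 0 -> U y].
Proof.
move=> cA oU AU; have [//|s [rho [h1 h2 h3 h4 h5]]] := @PU A U (fun=> setT) cA oU AU.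
  by move=> x; split => //; exact: openT.
exists (fun x => \sum_(z <- s) rho z x); split => //.
- exact: Cc_sum.
- by move=> y; rewrite h5 andbT sumr_ge0.
- move=> y; apply: contra_neqP => nUy; rewrite big1// => z _.
  by apply/eqP; apply: contra_notT nUy => /h3[].
Qed.

Lemma cutoff A : compact A -> exists f : K -> R, [/\ Cc f, (forall y, 0 <= f y <= 1) & (forall x, A x -> f x = 1)].
Proof.
by move=> cA; have [//|f [? ? ? ?]] := @bump_set A setT cA openT; exists f.
Qed.

(** Compactness of B makes the continuity at [x0] uniform in y; off B both values vanish. *)
Lemma tube (T : topologicalType) (u : T -> K -> R) B :
  continuous (fun p : T * K => u p.1 p.2) -> compact B ->
  (forall x y, u x y != 0 -> B y) ->
  forall (x0 : T) (e : R), 0 < e -> \forall x \near x0, forall y, `|u x y - u x0 y| <= e.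
Proof.
move=> cu cB uB x0 e e0.
have : \forall x \near x0, forall y, B y -> `|u x y - u x0 y| <= e.
  move/compact_near_coveringP : cB => /(_ T (nbhs x0) (fun x y => `|u x y - u x0 y| <= e)).
  apply => y By.
  have h : (fun p : K * T => u p.2 p.1 - u x0 p.1) @ (y, x0) --> 0.
    rewrite -(subrr (u x0 y)); apply: cvgB.
      apply: (@cvg_comp _ _ _ (fun p : K * T => (p.2, p.1)) (fun p => u p.1 p.2) _ (nbhs (x0, y))); last exact: (cu (x0, y)).
      by apply: cvg_pair; [exact: cvg_snd|exact: cvg_fst].
    apply: (@cvg_comp _ _ _ (fun p : K * T => (x0, p.1)) (fun p => u p.1 p.2) _ (nbhs (x0, y))); last exact: (cu (x0, y)).
    by apply: cvg_pair; [exact: cvg_cst|exact: cvg_fst].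
  move/cvgr0_norm_le : h => /(_ _ e0); exact.
apply: filterS => x h y; have [/h//|nBy] := pselect (B y).
have z t : u t y = 0 by apply/eqP; apply: contra_notT nBy => /uB.
by rewrite !z subrr normr0 ltW.
Qed.
End LocallyCompact.

(** * Functionals on C_c(K) *)

Lemma eq_of_small (R : realType) (a b C : R) :
  (forall e, 0 < e -> `|a - b| <= C * e) -> a = b.
Proof.
move=> h; apply/eqP; rewrite -subr_eq0 -normr_le0; apply/ler_addgt0Pr => e e0.
rewrite add0r; have C0 : 0 < `|C| + 1 by rewrite ltr_wpDl.
apply: (le_trans (h (e / (`|C| + 1)) _)); first by rewrite divr_gt0.
rewrite mulrCA ger_pMr// ler_pdivrMr// mul1r (le_trans (ler_norm _))//.
by rewrite lerDl.
Qed.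

Section CcFunctional.
Variables (R : realType) (K : ptopologicalType).
Hypothesis hausK : hausdorff_space K.
Hypothesis lcK : locally_compact [set: K].
Implicit Types (f g v : K -> R) (A B C U V : set K) (L : (K -> R) -> R).

(** Signed Radon measures as functionals: linear, and continuous on the functions supported in a
    fixed compact set. No positivity is asked, so that the real and imaginary parts of any bounded
    functional on L^1 qualify. *)
Definition Cc_functional L :=
  (forall (a : R) f g, Cc f -> Cc g -> L (fun x => a * f x + g x) = a * L f + L g) /\
  (forall B, compact B -> exists2 c, 0 <= c & forall v (M : R), Cc v ->
    (forall x, v x != 0 -> B x) -> (forall x, `|v x| <= M) -> `|L v| <= c * M).

Lemma ccf0 L : Cc_functional L -> L (fun=> 0) = 0.
Proof.
move=> [h _]; have := h 1 _ _ (Cc0 R hausK) (Cc0 R hausK).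
rewrite (_ : (fun x : K => 1 * 0 + 0) = fun=> 0); last by apply/funext => x; rewrite mulr0 addr0.
by rewrite mul1r => /eqP; rewrite -subr_eq subrr eq_sym => /eqP.
Qed.

Lemma ccf_sum L (I : Type) (s : seq I) (a : I -> R) (F : I -> K -> R) :
  Cc_functional L -> (forall i, Cc (F i)) ->
  L (fun x => \sum_(i <- s) a i * F i x) = \sum_(i <- s) a i * L (F i).
Proof.
move=> hL hF; elim: s => [|i s ih].
  by under eq_fun do rewrite big_nil; rewrite big_nil ccf0.
rewrite big_cons -ih -(hL.1)//; last first.
  by apply: (Cc_sum hausK) => j; apply: (Cc_scale hausK).
by congr L; apply/funext => x; rewrite big_cons.
Qed.

Lemma ccfB L f g : Cc_functional L -> Cc f -> Cc g ->
  L (fun x => f x - g x) = L f - L g.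
Proof.
move=> hL cf cg; rewrite addrC -mulN1r -(hL.1)//; congr L.
by apply/funext => x; rewrite mulN1r addrC.
Qed.

Lemma ccfZ L (a : R) f : Cc_functional L -> Cc f -> L (fun x => a * f x) = a * L f.
Proof.
move=> hL cf; have := hL.1 a _ _ cf (Cc0 R hausK).
by rewrite (ccf0 hL) addr0 => <-; congr L; apply/funext => x; rewrite addr0.
Qed.

Section Swap.
Variables (u : K -> K -> R) (A B : set K).
Hypothesis cu : continuous (fun p : K * K => u p.1 p.2).

Lemma joint_contr x : continuous (u x).
Proof.
move=> y; have h : (x, y') @[y' --> y] --> (x, y) by apply: cvg_pair; [exact: cvg_cst|exact: cvg_id].
exact: (cvg_comp _ _ h (@cu (x, y))).
Qed.

Lemma joint_swap : continuous (fun p : K * K => u p.2 p.1).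
Proof.
move=> [x y]; apply: (@cvg_comp _ _ _ (fun p : K * K => (p.2, p.1)) (fun p => u p.1 p.2) _ (nbhs (y, x))); last exact: (@cu (y, x)).
by apply: cvg_pair; [exact: cvg_snd|exact: cvg_fst].
Qed.
End Swap.

Lemma joint_contl (u : K -> K -> R) : continuous (fun p : K * K => u p.1 p.2) ->
  forall y, continuous (u^~ y).
Proof. by move=> cu y; exact: (@joint_contr (fun y x => u x y) (joint_swap cu)). Qed.

Lemma ccf_param (T : topologicalType) L (u : T -> K -> R) B :
  Cc_functional L -> continuous (fun p : T * K => u p.1 p.2) -> compact B ->
  (forall x y, u x y != 0 -> B y) -> continuous (fun x => L (u x)).
Proof.
move=> hL cu cB uB x0; have [c c0 hc] := hL.2 B cB.
have Cu x : Cc (u x).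
  apply: (Cc_intro hausK _ cB); last exact: uB.
  move=> y; apply: (@cvg_comp _ _ _ (fun y => (x, y)) (fun p => u p.1 p.2) _ (nbhs (x, y))); last exact: (cu (x, y)).
  by apply: cvg_pair; [exact: cvg_cst|exact: cvg_id].
apply/cvgrPdist_le => e e0.
have c1 : 0 < c + 1 by rewrite ltr_wpDl.
have := @tube R K T u B cu cB uB x0 (e / (c + 1)) (divr_gt0 e0 c1).
apply: filterS => x hx; rewrite distrC -(ccfB hL)//.
apply: (le_trans (hc _ (e / (c + 1)) _ _ hx)).
- exact: Cc_sub.
- move=> y h; apply: contrapT => nB.
  have z t : u t y = 0 by apply/eqP; apply: contra_notT nB => /uB.
  by move: h; rewrite !z subrr eqxx.
- by rewrite mulrCA ger_pMr// ler_pdivrMr// mul1r lerDl.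
Qed.

(** Fubini without measures. A partition of unity in x approximates u uniformly by finite sums of
    products u(z,y) rho_z(x), on which the two orders agree by linearity. *)
Lemma ccf_swap L1 L2 (u : K -> K -> R) A B :
  Cc_functional L1 -> Cc_functional L2 ->
  continuous (fun p : K * K => u p.1 p.2) -> compact A -> compact B ->
  (forall x y, u x y != 0 -> A x /\ B y) ->
  [/\ Cc (fun x => L2 (u x)), Cc (fun y => L1 (u^~ y)) &
   L1 (fun x => L2 (u x)) = L2 (fun y => L1 (u^~ y))].
Proof.
move=> h1 h2 cu cA cB uAB.
have uA x y : u x y != 0 -> A x by case/uAB.
have uB x y : u x y != 0 -> B y by case/uAB.
have Cu x : Cc (u x) by apply: (Cc_intro hausK _ cB); [exact: joint_contr|exact: uB].
have Cu' y : Cc (u^~ y) by apply: (Cc_intro hausK _ cA); [exact: joint_contl|move=> x; exact: uA].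
have z1 x : ~ A x -> u x = fun=> 0.
  by move=> nA; apply/funext => y; apply/eqP; apply: contra_notT nA => /uA.
have z2 y : ~ B y -> u^~ y = fun=> 0.
  by move=> nB; apply/funext => x; apply/eqP; apply: contra_notT nB => /uB.
have F2 : Cc (fun x => L2 (u x)).
  apply: (Cc_intro hausK _ cA); first exact: (ccf_param h2 cu cB uB).
  move=> x; apply: contra_neqP => /z1 ->; exact: ccf0.
have F1 : Cc (fun y => L1 (u^~ y)).
  apply: (Cc_intro hausK _ cB).
    apply: (@ccf_param _ L1 (fun y x => u x y) A) => //; [exact: joint_swap|by move=> y x; exact: uA].
  move=> y; apply: contra_neqP => /z2 ->; exact: ccf0.
split => //.
(* The functions [rho z] spill out of A but stay in [A'], so one constant [c1] serves for every
   e. *)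
have [V [oV AV [A' cA' VA']]] := relcompact_nbhd_set lcK cA.
have [c1 c10 hc1] := h1.2 A' cA'; have [c2 c20 hc2] := h2.2 B cB.
apply: (@eq_of_small _ _ _ (2 * (c1 * c2))) => e e0.
pose N x := [set x' | forall y, `|u x' y - u x y| <= e]^°.
have [x|s [rho [r1 r2 r3 r4 r5]]] := @PU R K hausK lcK A V N cA oV AV.
  by split; [exact: open_interior|exact: (tube cu cB uB)].
have Nx z x : N z x -> forall y, `|u x y - u z y| <= e by move=> /interior_subset.
have key x y : `|u x y - \sum_(z <- s) u z y * rho z x| <= e.
  have [Ax|nAx] := pselect (A x).
    rewrite -[u x y]mulr1 -(r4 x Ax) mulr_sumr -sumrB.
    apply: (le_trans (ler_norm_sum _ _ _)).
    apply: (@le_trans _ _ (\sum_(z <- s) e * rho z x)).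
      apply: ler_sum => z _; rewrite -mulrBl normrM (ger0_norm (r2 _ _)).
      have [->|/r3[/Nx h _]] := eqVneq (rho z x) 0; first by rewrite !mulr0.
      by rewrite ler_wpM2r.
    by rewrite -mulr_sumr ger_pMr//.
  (* Off A the row [u x] vanishes, so [u z] is at most e in modulus wherever [rho z x] is
     nonzero. *)
  rewrite (z1 _ nAx) sub0r normrN.
  apply: (le_trans (ler_norm_sum _ _ _)).
  apply: (@le_trans _ _ (\sum_(z <- s) e * rho z x)).
    apply: ler_sum => z _; rewrite normrM (ger0_norm (r2 _ _)).
    have [->|/r3[/Nx h _]] := eqVneq (rho z x) 0; first by rewrite !mulr0.
    by rewrite ler_wpM2r//; have := h y; rewrite (z1 _ nAx) sub0r normrN.
  by rewrite -mulr_sumr ger_pMr//.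
(* The common value of both iterated functionals on the approximating sum. Each side is within c1 c2
   e of it, hence the constant 2 c1 c2. *)
pose S := \sum_(z <- s) L2 (u z) * L1 (rho z).
have e1 : `|L1 (fun x => L2 (u x)) - S| <= c1 * (c2 * e).
  rewrite /S -(ccf_sum s (fun z => L2 (u z)) h1 r1) -(ccfB h1)//; last first.
    by apply: (Cc_sum hausK) => z; exact: (Cc_scale hausK).
  apply: hc1.
  - by apply: (Cc_sub hausK) => //; apply: (Cc_sum hausK) => z; exact: (Cc_scale hausK).
  - move=> x; apply: contra_neqP => nA'.
    rewrite z1; last by move=> /AV /VA'.
    rewrite (ccf0 h2) big1 ?subrr// => z _; apply/eqP; rewrite mulf_eq0.
    by apply/orP; right; apply: contra_notT nA' => /r3[_ /VA'].
  - move=> x; under eq_bigr do rewrite mulrC.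
    rewrite -(ccf_sum s (fun z => rho z x) h2 Cu) -(ccfB h2)//; last first.
      by apply: (Cc_sum hausK) => z; exact: (Cc_scale hausK).
    apply: hc2.
    + by apply: (Cc_sub hausK) => //; apply: (Cc_sum hausK) => z; exact: (Cc_scale hausK).
    + move=> y; apply: contra_neqP => nB.
      have zz t : u t y = 0 by have := z2 _ nB; move/(congr1 (@^~ t)).
      by rewrite zz big1 ?subrr// => z _; rewrite zz mulr0.
    + by move=> y; under eq_bigr do rewrite mulrC; exact: key.
have e2 : `|L2 (fun y => L1 (u^~ y)) - S| <= c2 * (c1 * e).
  rewrite /S; under eq_bigr do rewrite mulrC.
  rewrite -(ccf_sum s (fun z => L1 (rho z)) h2 Cu) -(ccfB h2)//; last first.
    by apply: (Cc_sum hausK) => z; exact: (Cc_scale hausK).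
  apply: hc2.
  - by apply: (Cc_sub hausK) => //; apply: (Cc_sum hausK) => z; exact: (Cc_scale hausK).
  - move=> y; apply: contra_neqP => nB.
    rewrite z2// (ccf0 h1) big1 ?subrr// => z _.
    by have := z2 _ nB; move/(congr1 (@^~ z)) => /= ->; rewrite mulr0.
  - move=> y; under eq_bigr do rewrite mulrC.
    rewrite -(ccf_sum s (fun z => u z y) h1 r1) -(ccfB h1)//; last first.
      by apply: (Cc_sum hausK) => z; exact: (Cc_scale hausK).
    apply: hc1.
    + by apply: (Cc_sub hausK) => //; apply: (Cc_sum hausK) => z; exact: (Cc_scale hausK).
    + move=> x; apply: contra_neqP => nA'.
      have zz : u x y = 0 by rewrite z1// => /AV /VA'.
      rewrite zz big1 ?subrr// => z _; apply/eqP; rewrite mulf_eq0.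
      by apply/orP; right; apply: contra_notT nA' => /r3[_ /VA'].
    + by move=> x; exact: key.
set X := L1 _ in e1 *; set Y := L2 _ in e2 *.
rewrite -[X - Y](subrKA S) (le_trans (ler_normD _ _))// (distrC S).
by have := lerD e1 e2; set w := c1 * (c2 * e); rewrite -/w; have -> : 2 * (c1 * c2) * e = w + c2 * (c1 * e) by rewrite /w; ring.
Qed.

End CcFunctional.

(** * Radon measures and lower semicontinuous majorants *)

Section LowerIntegral.
Local Open Scope ereal_scope.
Context d (T : measurableType d) (R : realType).
Variable mu : {measure set T -> \bar R}.
Implicit Types f g E : T -> \bar R.

(** The integral of a nonnegative function is a supremum over the simple functions below it, so
    monotonicity holds without measurability. *)
Lemma le_lower_integral f g : (forall x, 0 <= f x) -> (forall x, f x <= g x) ->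
  \int[mu]_x f x <= \int[mu]_x g x.
Proof.
move=> f0 fg; have g0 x : 0 <= g x by exact: le_trans (f0 x) (fg x).
rewrite !ge0_integralTE//; apply: ereal_sup_le => _ [h hf <-].
by exists h => // x; exact: le_trans (hf x) (fg x).
Qed.

(** Since g need not be measurable, additivity is applied to E and the positive part of f - E, which
    is measurable and lies below g. *)
Lemma lower_integral_leD f g E : (forall x, 0 <= f x) -> (forall x, 0 <= g x) ->
  (forall x, 0 <= E x) -> measurable_fun [set: T] f -> measurable_fun [set: T] E ->
  (forall x, f x <= g x + E x) -> \int[mu]_x f x <= \int[mu]_x g x + \int[mu]_x E x.
Proof.
move=> f0 g0 E0 mf mE fgE.
pose h x := Order.max (f x - E x) 0.
have h0 x : 0 <= h x by rewrite /h le_max lexx orbT.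
have mh : measurable_fun [set: T] h.
  by apply: measurable_maxe => //; exact: emeasurable_funB.
apply: (@le_trans _ _ (\int[mu]_x (h x + E x))).
  apply: le_lower_integral => // x.
  have := E0 x; case hE : (E x) => [b| |]// _; last first.
    by rewrite addey ?leey// -ltNye (lt_le_trans _ (h0 x)).
  have := f0 x; rewrite /h hE; case: (f x) => [a| |]// _.
    by rewrite -EFinB -EFin_max -EFinD lee_fin -lerBlDr le_max lexx.

rewrite ge0_integralD//; apply: leeD2r; apply: le_lower_integral => // x.
rewrite /h ge_max g0 andbT.
have := E0 x; have := f0 x; have := fgE x; have := g0 x.
case: (f x) (E x) (g x) => [a| |] [b| |] [c| |]//=.
- by move=> _; rewrite -EFinD !lee_fin -lerBlDr.
- by move=> *; rewrite leey.
- by move=> *; rewrite leNye.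
- by move=> *; rewrite leNye.
Qed.

(** The integral of an arbitrary u is the difference of the lower integrals of its positive and
    negative parts. Each part moves by at most \int E, hence the doubled bound. *)
Lemma integral_close (u v : T -> R) E : measurable_fun [set: T] E -> (forall x, 0 <= E x) ->
  mu.-integrable setT (EFin \o v) -> (forall x, (`|u x - v x|)%:E <= E x) ->
  (`| \int[mu]_x u x - \int[mu]_x v x |%R)%:E <= \int[mu]_x E x + \int[mu]_x E x.
Proof.
move=> mE E0 iv uv.
have IE0 : 0 <= \int[mu]_x E x by exact: integral_ge0.
case IE : (\int[mu]_x E x) IE0 => [e| |]// e0; last by rewrite addye// leey.
have mv := measurable_int _ iv.
pose pos (f : T -> R) x : \bar R := (Num.max (f x) 0)%R%:E.
pose neg (f : T -> R) x : \bar R := (Num.max (- f x) 0)%R%:E.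
have p0 (f : T -> R) x : 0 <= pos f x by rewrite lee_fin le_max lexx orbT.
have n0 (f : T -> R) x : 0 <= neg f x by rewrite lee_fin le_max lexx orbT.
have dec (f : T -> R) : \int[mu]_x (f x)%:E = \int[mu]_x pos f x - \int[mu]_x neg f x.
  rewrite integralE; congr (_ - _); apply: eq_integral => x _;
    by rewrite ?unlock /pos /neg EFin_max.
have mpv : measurable_fun [set: T] (pos v).
  by rewrite /pos; under eq_fun do rewrite EFin_max; apply: measurable_maxe.
have mnv : measurable_fun [set: T] (neg v).
  rewrite /neg; under eq_fun do rewrite EFin_max EFinN; apply: measurable_maxe => //.
  exact: measurableT_comp.
have mx (a b : R) (z : \bar R) : (`|a - b|)%:E <= z ->
   (Num.max a 0)%R%:E <= (Num.max b 0)%R%:E + z /\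
   (Num.max b 0)%R%:E <= (Num.max a 0)%R%:E + z.
  case: z => [z| |]//; last by rewrite !addey// !leey.
  rewrite -!EFinD !lee_fin ler_norml => /andP[h1 h2].
  by rewrite /Num.max; case: ifP; case: ifP; lra.
have H1 x : pos u x <= pos v x + E x /\ pos v x <= pos u x + E x by apply: mx; exact: uv.
have H2 x : neg u x <= neg v x + E x /\ neg v x <= neg u x + E x.
  by apply: mx; rewrite -opprD normrN; exact: uv.
(* Here the sum on the right is measurable and additivity applies directly. In [B1] and [B2] the
   parts of u stand on the right, and [lower_integral_leD] takes over. *)
have A1 : \int[mu]_x pos u x <= \int[mu]_x pos v x + e%:E.
  rewrite -IE -ge0_integralD//; apply: le_lower_integral => // x; exact: (H1 x).1.
have A2 : \int[mu]_x neg u x <= \int[mu]_x neg v x + e%:E.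
  rewrite -IE -ge0_integralD//; apply: le_lower_integral => // x; exact: (H2 x).1.
have B1 : \int[mu]_x pos v x <= \int[mu]_x pos u x + e%:E.
  rewrite -IE; apply: lower_integral_leD => // x; exact: (H1 x).2.
have B2 : \int[mu]_x neg v x <= \int[mu]_x neg u x + e%:E.
  rewrite -IE; apply: lower_integral_leD => // x; exact: (H2 x).2.
have fv : \int[mu]_x pos v x < +oo /\ \int[mu]_x neg v x < +oo.
  have [_ h] := integrableP _ _ _ iv.
  split; apply: le_lt_trans h; apply: le_lower_integral => // x /=;
    rewrite lee_fin ge_max normr_ge0 andbT ?ler_norm//.
  by rewrite -normrN ler_norm.
have fin (f : T -> \bar R) : (forall x, 0 <= f x) -> \int[mu]_x f x < +oo ->
    exists r, \int[mu]_x f x = r%:E.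
  move=> h foo; exists (fine (\int[mu]_x f x)); rewrite fineK// ge0_fin_numE//.
  exact: integral_ge0.
have [b vb] := fin _ (p0 v) fv.1; have [r vr] := fin _ (n0 v) fv.2.
rewrite vb in A1 B1; rewrite vr in A2 B2.
have [a ua] := fin _ (p0 u) (le_lt_trans A1 (ltry _)).
have [c uc] := fin _ (n0 u) (le_lt_trans A2 (ltry _)).
rewrite ua in A1 B1; rewrite uc in A2 B2.
rewrite /Rintegral (dec u) (dec v) vb vr ua uc /= -EFinD lee_fin ler_norml.
move: A1 A2 B1 B2; rewrite -!EFinD !lee_fin.
by move=> *; apply/andP; split; lra.
Qed.
End LowerIntegral.

Section Aux.
Variable R : realType.
Local Open Scope ereal_scope.

Lemma ereal_between (a b : \bar R) : 0 <= a -> a < b -> exists2 r : R, a < r%:E & r%:E < b.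
Proof.
case: a => [a| |]//; case: b => [b| |]// _ ab.
  exists ((a + b) / 2)%R; rewrite lte_fin; move: ab; rewrite lte_fin; lra.
by exists (a + 1)%R; rewrite ?ltry// lte_fin ltrDl.
Qed.

Lemma le_of_lower_reals (a b : \bar R) : 0 <= b ->
  (forall r : R, (0 <= r)%R -> r%:E < a -> r%:E <= b) -> a <= b.
Proof.
move=> b0 h; rewrite leNgt; apply/negP => /(ereal_between b0)[r br ra].
have r0 : (0 <= r)%R by rewrite -lee_fin (le_trans b0)// ltW.
by have := h r r0 ra; rewrite leNgt br.
Qed.

Lemma scaled_sup_le (S : set (\bar R)) (a : R) (y B : \bar R) : (0 < a)%R -> 0 <= y ->
  (forall t, S t -> 0 <= t) -> S !=set0 ->
  (forall t, S t -> y + a%:E * t <= B) -> y + a%:E * ereal_sup S <= B.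
Proof.
move=> a0 y0 S0 [t0 St0] h.
case: B h => [b h| _|h]; [|by rewrite leey|]; last first.
  have := h _ St0; rewrite leeNy_eq => /eqP e.
  have : 0 <= y + a%:E * t0 by apply: adde_ge0 => //; apply: mule_ge0; [rewrite lee_fin ltW|exact: S0].
  by rewrite e.
case: y y0 h => [y| |]// y0 h; last first.
  have := h _ St0; have := S0 _ St0; case: t0 {St0} => [t| |]//= _.
  by rewrite mulry gtr0_sg// mul1e.
suff : ereal_sup S <= ((b - y) / a)%:E.
  move=> hs; have s0 : 0 <= ereal_sup S by apply: le_trans (S0 _ St0) _; exact: ereal_sup_ubound.
  have sf : ereal_sup S \is a fin_num by rewrite ge0_fin_numE// (le_lt_trans hs)// ltry.
  move: hs; rewrite -(fineK sf); set s := fine _.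
  by rewrite lee_fin ler_pdivlMr// -EFinM -EFinD lee_fin mulrC => h'; lra.
apply: ge_ereal_sup => t St; have := h _ St; have := S0 _ St.
case: t {St} => [t| |]//= _.
  by rewrite -EFinM -EFinD !lee_fin ler_pdivlMr// mulrC; lra.
by rewrite mulry gtr0_sg// mul1e.
Qed.

(** The suprema are approached independently of one another; [tau_smooth] uses this to pick one
    compact subset in each level set at once. *)
Lemma sum_sup_le (J : nat) (S : nat -> set (\bar R)) (a : R) : (0 < a)%R ->
  (forall j t, S j t -> 0 <= t) -> (forall j, S j !=set0) ->
  forall y B : \bar R, 0 <= y ->
  (forall c : nat -> \bar R, (forall j, S j (c j)) -> y + \sum_(j < J) a%:E * c j <= B) ->
  y + \sum_(j < J) a%:E * ereal_sup (S j) <= B.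
Proof.
move=> a0 S0 Sn; elim: J => [|J ih] y B y0 h.
  have /choice[c hc] : forall j, exists t, S j t by move=> j; case: (Sn j) => t; exists t.
  by have := h c hc; rewrite !big_ord0.
rewrite big_ord_recr/= addeA.
apply: scaled_sup_le => //; [|exact: S0|].
  rewrite adde_ge0// sume_ge0// => j _; apply: mule_ge0; first by rewrite lee_fin ltW.
  by case: (Sn j) => t St; apply: le_trans (S0 _ _ St) _; exact: ereal_sup_ubound.
move=> t St; rewrite addeAC; apply: ih.
  by rewrite adde_ge0// mule_ge0// ?(S0 _ _ St)// lee_fin ltW.
move=> c hc; have := h (fun j => if (j < J)%N then c j else if j == J then t else c j).
rewrite big_ord_recr/= ltnn eqxx addeA.
under eq_bigr do rewrite ltn_ord.
rewrite addeAC; apply => j; case: ifP => [//|_].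
by case: eqP => [->|].
Qed.

(** A discrete layer cake: the multiples of a below r number at most r / a. *)
Lemma staircase_le (J : nat) (a r : R) : (0 < a)%R -> (0 <= r)%R ->
  ((\sum_(j < J) a * (nat_of_bool (a * j.+1%:R < r)%R)%:R) <= r)%R.
Proof.
move=> a0 r0; elim: J => [|J ih]; first by rewrite big_ord0.
rewrite big_ord_recr/=; case: ltP => h; last by rewrite mulr0 addr0.
rewrite mulr1; apply: le_trans (ltW h).
rewrite -[X in (_ <= a * X)%R]natr1 mulrDr mulr1 lerD2r.
apply: (@le_trans _ _ (\sum_(j < J) a)%R).
  by apply: ler_sum => j _; case: (_ < r)%R; rewrite ?mulr1// mulr0 ltW.
by rewrite sumr_const card_ord mulr_natr.
Qed.

Lemma staircase_ge (J n : nat) (a r c : R) (s : \bar R) : (0 < a)%R -> (0 <= c)%R -> (c + a <= r)%R ->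
  r%:E < s -> (r < a * J%:R)%R ->
  (c <= \sum_(j < J) a * (nat_of_bool ((a * j.+1%:R)%:E < s)%E)%:R)%R.
Proof.
move=> a0 c0 car rs rJ.
(* The first k levels are at most r, hence strictly below s, and rounding r / a down costs less than
   a. *)
pose k := Num.truncn (r / a).
have ra0 : (0 <= r / a)%R by rewrite divr_ge0//; lra.
have /andP[k1 k2] := truncn_itv ra0.
have kJ : (k <= J)%N.
  rewrite -(ler_nat R) (le_trans k1)// ler_pdivrMr// mulrC; lra.
apply: (@le_trans _ _ (\sum_(j < k) a)%R).
  rewrite sumr_const card_ord -mulr_natr.
  move: k2; rewrite ltr_pdivrMr// -natr1 mulrDl mul1r mulrC; lra.
rewrite -(big_mkord xpredT (fun=> a)) -(big_mkord xpredT (fun j => a * (nat_of_bool ((a * j.+1%:R)%:E < s)%E)%:R)%R).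
rewrite (big_cat_nat _ kJ)//= ler_wpDr//.
  by apply: sumr_ge0 => j _; rewrite mulr_ge0// ltW.
rewrite big_nat_cond [leRHS]big_nat_cond; apply: ler_sum => j; rewrite andbT => /andP[_ jk].
rewrite (_ : (_ < s) = true) ?mulr1//.
apply: le_lt_trans rs; rewrite lee_fin mulrC -ler_pdivlMr//.
by apply: le_trans k1; rewrite ler_nat.
Qed.
End Aux.

(** * Radon measures and directed suprema of continuous functions *)

Section Radon.
Variables (R : realType) (K : ptopologicalType).
Hypothesis hausK : hausdorff_space K.
Implicit Types (f g v : K -> R) (A B C U V : set K).
Local Notation bK := (borel K).

Lemma borel_open U : open U -> measurable (U : set bK).
Proof. exact: sub_sigma_algebra. Qed.

Lemma borel_closed A : closed A -> measurable (A : set bK).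
Proof. by move=> cA; rewrite -[A]setCK; apply: measurableC; apply: borel_open; exact: closed_openC. Qed.

Lemma borel_compact A : compact A -> measurable (A : set bK).
Proof. by move=> cA; apply: borel_closed; exact: compact_closed. Qed.

Lemma borel_lsc (phi : K -> \bar R) : lower_semicontinuous phi ->
  measurable_fun [set: bK] (phi : bK -> \bar R).
Proof.
move=> /lower_semicontinuousP sci; apply: (measurability _ (ErealGenOInfty.measurableE R)).
move=> /= _ [_ [a ->]] <-; apply: measurableI => //; apply: borel_open.
by rewrite preimage_itvoy; exact: sci.
Qed.

Lemma borel_continuous f : continuous f -> measurable_fun [set: bK] (f : bK -> R).
Proof.
move=> cf; apply: (measurability _ (RGenOInfty.measurableE R)).
move=> /= _ [_ [a ->]] <-; apply: measurableI => //; apply: borel_open.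
by apply: (@open_comp _ _ f `]a, +oo[%classic) => // x _; exact: cf.
Qed.

Section OneMeasure.
Variable mu : {measure set bK -> \bar R}.
Hypothesis rmu : radon mu.

Lemma Cc_integrable f : Cc f -> mu.-integrable setT (EFin \o f).
Proof.
move=> cf; have [B cB fB] := Cc_supp cf; have [M M0 hM] := Cc_bounded cf.
have mf := borel_continuous (Cc_continuous cf).
apply: (@le_integrable _ _ _ _ _ measurableT _ (fun x : bK => (M * \1_B x)%:E)).
- exact/measurable_EFinP.
- move=> x _; rewrite /= lee_fin normrM (ger0_norm M0) indicE.
  have [->|/fB Bx] := eqVneq (f x) 0; first by rewrite normr0 mulr_ge0.
  by rewrite mem_set// normr1 mulr1.
- have [h _ _] := rmu.
  under eq_fun do rewrite EFinM.
  apply: integrableZl => //; apply/integrableP; split.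
    by apply/measurable_EFinP; apply: measurable_indic; exact: borel_compact.
  under eq_integral do rewrite gee0_abs ?lee_fin//.
  by rewrite integral_indic ?setIT//; [exact: h|exact: borel_compact].
Qed.

Lemma Rintegral_abs_le f (M : R) B : Cc f -> compact B -> (forall x, f x != 0 -> B x) ->
  (forall x, `|f x| <= M) -> `|\int[mu]_x f x| <= fine (mu B) * M.
Proof.
move=> cf cB fB fM.
have mB : measurable (B : set bK) by exact: borel_compact.
have fin : mu B \is a fin_num by rewrite ge0_fin_numE//; case: rmu => h _ _; exact: h.
apply: (le_trans (le_normr_Rintegral _ (Cc_integrable cf))) => //.
rewrite -lee_fin /Rintegral fineK; last first.
  by apply: integrable_fin_num => //; exact: Cc_integrable (Cc_norm hausK cf).
apply: (@le_trans _ _ (\int[mu]_x (M%:E * (\1_B x)%:E))%E).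
  apply: le_lower_integral => x; first by rewrite lee_fin.
  rewrite -EFinM lee_fin indicE; have [->|/fB Bx] := eqVneq (f x) 0.
    by rewrite normr0 mulr_ge0// (le_trans _ (fM x)).
  by rewrite mem_set// mulr1.
rewrite ge0_integralZl_EFin//.
- by rewrite integral_indic// setIT muleC EFinM fineK.
- by apply/measurable_EFinP; exact: measurable_indic.
- by apply: le_trans (fM point).
Qed.

Lemma Rintegral_functional : Cc_functional (fun f => \int[mu]_x f x).
Proof.
split=> [a f g cf cg|B cB].
  rewrite RintegralD//; [|exact: Cc_integrable (Cc_scale hausK a cf)|exact: Cc_integrable].
  by rewrite RintegralZl//; exact: Cc_integrable.
exists (fine (mu B)); first by rewrite fine_ge0.
by move=> v M cv vB vM; exact: Rintegral_abs_le.
Qed.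

(* The levels of [s] are open and so exhausted by compact sets, on each of which
   a single member of the directed family already exceeds the level. *)
Lemma tau_smooth (F : set (K -> R)) (s : K -> \bar R) (B : \bar R) :
  F !=set0 -> (forall f, F f -> continuous f /\ forall x, 0 <= f x) ->
  (forall f g, F f -> F g -> exists2 h, F h & forall x, f x <= h x /\ g x <= h x) ->
  (forall f x, F f -> ((f x)%:E <= s x)%E) ->
  (forall x (c : R), (c%:E < s x)%E -> exists2 f, F f & c < f x) ->
  (forall f, F f -> (\int[mu]_x (f x)%:E <= B)%E) ->
  (lower_semicontinuous s /\ \int[mu]_x s x <= B)%E.
Proof.
move=> [f0 Ff0] Fc Fd Fs sF FB.
have oS c : open [set x | (c%:E < s x)%E].
  rewrite (_ : [set _ | _] = \bigcup_(f in F) [set x | c < f x]).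
    apply: bigcup_open => f Ff; apply: (@open_comp _ _ f [set t | c < t]); last exact: open_gt.
    by move=> x _; exact: (Fc f Ff).1.
  apply/seteqP; split => x /=; first by move=> /sF[f Ff]; exists f.
  by move=> [f Ff] h; apply: lt_le_trans (Fs f x Ff); rewrite lte_fin.
have lscs : lower_semicontinuous s by apply/lower_semicontinuousP.
split => //.
have s0 x : (0 <= s x)%E by apply: le_trans (Fs f0 x Ff0); rewrite lee_fin (Fc f0 Ff0).2.
have dseq (T : eqType) (l : seq T) (g : T -> K -> R) : (forall z, z \in l -> F (g z)) ->
    exists2 f, F f & forall z, z \in l -> forall x, g z x <= f x.
  elim: l => [|z l ih] h; first by exists f0.
  have [|f Ff hf] := ih; first by move=> z' z'l; apply: h; rewrite inE z'l orbT.
  have [h' Fh' hh'] := Fd _ _ (h z (mem_head _ _)) Ff.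
  exists h' => // z'; rewrite inE => /orP[/eqP -> x|z'l x]; first exact: (hh' x).1.
  exact: le_trans (hf _ z'l x) (hh' x).2.
have dC (C : set K) c : compact C -> (forall x, C x -> (c%:E < s x)%E) ->
    exists2 f, F f & forall x, C x -> c < f x.
  move=> cC Cs.
  have /choice[g hg] : forall x, exists f, F f /\ (C x -> c < f x).
    move=> x; have [Cx|nCx] := pselect (C x); last by exists f0.
    by have [f Ff h] := sF x c (Cs x Cx); exists f.
  have [|l lC Cl] := @finite_cover K C (fun x => [set y | c < g x y]) cC.
    move=> x Cx; split; last exact: (hg x).2.
    apply: (@open_comp _ _ (g x) [set t | c < t]); last exact: open_gt.
    by move=> y _; exact: (Fc _ (hg x).1).1.
  have [z _|f Ff hf] := dseq _ l g; first exact: (hg z).1.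
  by exists f => // x /Cl[z zl h]; apply: lt_le_trans (hf z zl x).
(* Mesh 1 / (N+1) with (N+1)^2 levels: the staircase reaches height N+1 while its steps shrink. *)
pose a (N : nat) : R := N.+1%:R^-1.
have a0 N : 0 < a N by rewrite invr_gt0.
pose U (N j : nat) : set bK := [set x | ((a N * j.+1%:R)%:E < s x)%E].
pose sN (N : nat) (x : bK) : \bar R := (\sum_(j < N.+1 ^ 2) ((a N)%:E * (\1_(U N j) x)%:E))%E.
have mU N j : measurable (U N j) by apply: borel_open; exact: oS.
have sN0 N x : (0 <= sN N x)%E by apply: sume_ge0 => j _; rewrite -EFinM lee_fin mulr_ge0// ltW.
have msum N (W : nat -> set bK) J : (forall j, measurable (W j)) ->
    (\int[mu]_x (\sum_(j < J) ((a N)%:E * (\1_(W j) x)%:E)) = \sum_(j < J) (a N)%:E * mu (W j))%E.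
  move=> mW; rewrite ge0_integral_sum//.
  - apply: eq_bigr => j _; rewrite ge0_integralZl_EFin//; last by rewrite ltW.
      by rewrite integral_indic// setIT.
    by apply/measurable_EFinP; exact: measurable_indic.
  - move=> j; apply: measurable_funeM; apply/measurable_EFinP; exact: measurable_indic.
  - by move=> j x _; rewrite -EFinM lee_fin mulr_ge0// ltW.
have intN N : (\int[mu]_x sN N x <= B)%E.
  rewrite /sN msum// -[leLHS]add0e.
  have -> : (\sum_(j < N.+1 ^ 2) (a N)%:E * mu (U N j) =
     \sum_(j < N.+1 ^ 2) (a N)%:E * ereal_sup [set mu C | C in [set C | compact C /\ C `<=` U N j]])%E.
    by apply: eq_bigr => j _; case: rmu => _ _ /(_ (U N j)) ->//; exact: oS.
  apply: (@sum_sup_le R (N.+1 ^ 2) (fun j => [set mu C | C in [set C | compact C /\ C `<=` U N j]])) => //.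
  - by move=> j t [C _ <-].
  - by move=> j; exists (mu set0); exists set0 => //; split; [exact: compact0|].
  move=> c hc; rewrite add0e.
  have /choice[C hC] : forall j, exists C, (compact C /\ C `<=` U N j) /\ mu C = c j.
    by move=> j; case: (hc j) => C ? ?; exists C.
  have cC j : compact (C j) by case: (hC j) => -[].
  have CU j : C j `<=` U N j by case: (hC j) => -[].
  rewrite (_ : (\sum_(_ < _) _)%E = \sum_(j < N.+1 ^ 2) (a N)%:E * mu (C j))%E; last first.
    by apply: eq_bigr => j _; case: (hC j) => _ ->.
  rewrite -msum; last by move=> j; exact: borel_compact.
  (* One member of F per level; directedness then gives a single f above them all, and the staircase
     built on the compact sets lies below f. *)
  have /choice[g hg] : forall j, exists f, F f /\ forall x, C j x -> a N * j.+1%:R < f x.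
    by move=> j; have [f ? ?] := dC _ _ (cC j) (CU j); exists f.
  have [j _|f Ff hf] := dseq _ (iota 0 (N.+1 ^ 2)) g; first exact: (hg j).1.
  apply: le_trans (FB f Ff); apply: le_lower_integral => x.
    by apply: sume_ge0 => j _; rewrite -EFinM lee_fin mulr_ge0// ltW.
  under eq_bigr do rewrite -EFinM.
  rewrite sumEFin lee_fin; apply: le_trans (@staircase_le R (N.+1 ^ 2) (a N) (f x) (a0 N) _); last first.
    exact: (Fc f Ff).2.
  apply: ler_sum => j _; rewrite indicE; case: (boolP (x \in C j)) => [/set_mem Cx|_]; last first.
    by rewrite mulr0 mulr_ge0// ltW.
  rewrite (_ : (_ < f x) = true)//.
  apply: lt_le_trans ((hg j).2 x Cx) (hf j _ x).
  by rewrite mem_iota add0n ltn_ord.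
(* The grids for successive N are not nested, so [sN] is not monotone in N and Fatou's lemma is used
   instead of monotone convergence. *)
apply: (@le_trans _ _ (\int[mu]_x limn_einf (sN^~ x))%E).
  apply: le_lower_integral => // x.
  rewrite limn_einf_lim; apply: le_of_lower_reals.
    apply: lime_ge; first exact: is_cvg_einfs.
    by apply: nearW => n; apply: le_ereal_inf_tmp => _ [k /= _ <-].
  move=> c c0 cs; apply: lime_ge; first exact: is_cvg_einfs.
  have [r cr rs] : exists2 r, c < r & (r%:E < s x)%E.
    have [|r cr rs] := @ereal_between R c%:E (s x) _ cs; first by rewrite lee_fin.
    by exists r => //; rewrite -lte_fin.
  (* From this index on the mesh is at most r - c and the top level exceeds r, as [staircase_ge]
     requires. *)
  pose M := (Num.truncn ((r - c)^-1) + Num.truncn r).+1.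
  have rc0 : 0 < r - c by rewrite subr_gt0.
  exists M => // n /= Mn; apply: le_ereal_inf_tmp => _ [k /= nk <-].
  have Mk : (M <= k)%N by exact: leq_trans Mn nk.
  rewrite /sN; under eq_bigr do rewrite -EFinM.
  rewrite sumEFin lee_fin; under eq_bigr do rewrite indicE.
  have xU j : (x \in U k j) = (((a k) * j.+1%:R)%:E < s x)%E.
    by apply/idP/idP => [/set_mem//|h]; exact: mem_set.
  under eq_bigr do rewrite xU.
  have k1 : ((r - c)^-1) < k.+1%:R.
    apply: lt_le_trans (truncnS_gt _) _; rewrite ler_nat ltnS; apply: leq_trans Mk.
    by rewrite /M ltnW// ltnS leq_addr.
  have k2 : r < k.+1%:R.
    apply: lt_le_trans (truncnS_gt _) _; rewrite ler_nat ltnS; apply: leq_trans Mk.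
    by rewrite /M ltnW// ltnS leq_addl.
  apply: (@staircase_ge R _ 0 _ r) => //.
    rewrite addrC -lerBrDr /a -[leRHS]invrK lef_pV2 ?posrE ?invr_gt0//; exact: ltW.
  by rewrite natrX /a expr2 mulrA mulVf ?mul1r.
apply: (@le_trans _ _ (limn_einf (fun n => \int[mu]_x sN n x))%E).
  apply: fatou => // n; apply: emeasurable_sum => j; apply: measurable_funeM.
  by apply/measurable_EFinP; exact: measurable_indic.
rewrite limn_einf_lim; apply: lime_le; first exact: is_cvg_einfs.
apply: nearW => n; apply: le_trans (intN n); apply: ereal_inf_lbound.
by exists n => //=.
Qed.
End OneMeasure.
End Radon.

(** * Lower semicontinuous majorants and density of C_c(K) *)

Section LscRadon.
Variables (R : realType) (K : ptopologicalType).
Hypothesis hausK : hausdorff_space K.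
Hypothesis lcK : locally_compact [set: K].
Implicit Types (f g v : K -> R) (A B C U V : set K) (phi psi : K -> \bar R).
Local Notation bK := (borel K).
Local Open Scope ereal_scope.

(** The class of error bounds: Borel, stable under nonnegative combinations and countable sums, and
    the pointwise supremum of its minorants in C_c(K). *)
Definition lsc_ge0 phi := (forall x, 0 <= phi x) /\ lower_semicontinuous phi.

Lemma lsc_ge0_measurable phi : lsc_ge0 phi -> measurable_fun [set: bK] (phi : bK -> \bar R).
Proof. by move=> [_ ?]; exact: borel_lsc. Qed.

Lemma lsc_indic U (c : R) : (0 <= c)%R -> open U -> lsc_ge0 (fun x => (c * \1_U x)%:E).
Proof.
move=> c0 oU; split=> [x|]; first by rewrite lee_fin mulr_ge0.
apply/lower_semicontinuousP => a; have [a0|a0] := ltP a 0%R.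
  rewrite (_ : [set _ | _] = setT); first exact: openT.
  by apply/seteqP; split => // x _; rewrite /= lte_fin (lt_le_trans a0)// mulr_ge0.
have [ac|ac] := ltP a c.
  rewrite (_ : [set _ | _] = U)//; apply/seteqP; split => x /=; rewrite lte_fin indicE.
    by case: (boolP (x \in U)) => [/set_mem//|_]; rewrite mulr0 ltNge a0.
  by move=> Ux; rewrite mem_set// mulr1.
rewrite (_ : [set _ | _] = set0); first exact: open0.
apply/seteqP; split => // x /=; rewrite lte_fin indicE ltNge => /negP[].
by case: (x \in U); rewrite ?mulr1 ?mulr0.
Qed.

Lemma lsc_continuous f : continuous f -> (forall x, (0 <= f x)%R) -> lsc_ge0 (fun x => (f x)%:E).
Proof.
move=> cf f0; split => [x|]; first by rewrite lee_fin.
apply/lower_semicontinuousP => a; apply: (@open_comp _ _ f [set t | (a < t)%R]); last exact: open_gt.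
by move=> x _; exact: cf.
Qed.

Lemma lsc_norm f : continuous f -> lsc_ge0 (fun x => (`|f x|)%:E).
Proof.
move=> cf; apply: lsc_continuous => // x; apply: continuous_comp; first exact: cf.
exact: norm_continuous.
Qed.

Lemma lsc_add phi psi : lsc_ge0 phi -> lsc_ge0 psi -> lsc_ge0 (fun x => phi x + psi x).
Proof.
move=> [p0 /lower_semicontinuousP pl] [q0 /lower_semicontinuousP ql].
split=> [x|]; first by rewrite adde_ge0.
move=> x a ax; suff [c [d [cx dx acd]]] : exists c d : R, [/\ c%:E < phi x, d%:E < psi x & (a <= c + d)%R].
  exists [set y | c%:E < phi y /\ d%:E < psi y].
    by apply: filterI; apply: open_nbhs_nbhs; split => //; [exact: pl|exact: ql].
  move=> y [cy dy]; apply: (@le_lt_trans _ _ (c%:E + d%:E)); first by rewrite -EFinD lee_fin.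
  exact: lteD.
have := p0 x; have := q0 x; case: (phi x) (psi x) ax => [p| |] [q| |]//.
- rewrite -EFinD !lte_fin => apq _ _; exists (p - (p + q - a) / 2)%R, (q - (p + q - a) / 2)%R.
  by split; rewrite ?lte_fin; lra.
- move=> _ _ _; exists (p - 1)%R, (a - p + 1)%R; split; rewrite ?ltry ?lte_fin//; lra.
- move=> _ _ _; exists (a - q + 1)%R, (q - 1)%R; split; rewrite ?ltry ?lte_fin//; lra.
- by move=> _ _ _; exists a, 0%R; split; rewrite ?ltry// addr0.
Qed.

Lemma lsc_scale (k : R) phi : (0 <= k)%R -> lsc_ge0 phi -> lsc_ge0 (fun x => k%:E * phi x).
Proof.
move=> k0 [p0 /lower_semicontinuousP pl]; split => [x|]; first by rewrite mule_ge0.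
have [->|kn0] := eqVneq k 0%R.
  move=> x a; rewrite mul0e => a0; exists setT; first exact: filterT.
  by move=> y _; rewrite mul0e.
have kp : (0 < k)%R by rewrite lt_def kn0.
move=> x a ax; exists [set y | (a / k)%:E < phi y].
  apply: open_nbhs_nbhs; split; first exact: pl.
  by move: ax => /=; rewrite muleC -lte_pdivrMr.
by move=> y /=; rewrite [in X in _ -> X]muleC -lte_pdivrMr.
Qed.

Lemma lsc_sum (I : Type) (s : seq I) (F : I -> K -> \bar R) :
  (forall i, lsc_ge0 (F i)) -> lsc_ge0 (fun x => \sum_(i <- s) F i x).
Proof.
move=> h; elim: s => [|i s ih].
  rewrite (_ : (fun _ => _) = fun x : K => (0 * \1_(setT : set K) x)%R%:E).
    by apply: lsc_indic => //; exact: openT.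
  by apply/funext => x; rewrite big_nil mul0r.
rewrite (_ : (fun _ => _) = fun x => F i x + \sum_(i <- s) F i x); first exact: lsc_add.
by apply/funext => x; rewrite big_cons.
Qed.

Lemma lsc_nneseries (F : nat -> K -> \bar R) :
  (forall i, lsc_ge0 (F i)) -> lsc_ge0 (fun x => \sum_(i <oo) F i x).
Proof.
move=> h; split=> [x|x a ax]; first by apply: nneseries_ge0 => n _ _; exact: (h n).1.
have [N aN] : exists N, a%:E < \sum_(0 <= i < N) F i x.
  apply: contrapT => nN; move: ax; rewrite ltNge => /negP; apply.
  apply: lime_le; first by apply: is_cvg_nneseries => n _ _; exact: (h n).1.
  by apply: nearW => N; rewrite leNgt; apply/negP => aN; apply: nN; exists N.
have [_ /(_ x a aN)[V xV hV]] := lsc_sum (index_iota 0 N) h.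
exists V => // y /hV; move/lt_le_trans; apply.
by apply: nneseries_lim_ge => n _ _; exact: (h n).1.
Qed.

(** The minorant is r times a bump at x inside the open set where phi exceeds r, for some r strictly
    between c and phi(x). *)
Lemma lsc_test phi x (c : R) : lsc_ge0 phi -> c%:E < phi x ->
  exists f, [/\ Cc f, (forall x, (0 <= f x)%R), (forall x, (f x)%:E <= phi x) & (c < f x)%R].
Proof.
move=> [p0 /lower_semicontinuousP pl] cx; have [c0|c0] := ltP c 0%R.
  by exists (fun=> 0%R); split => //; exact: Cc0.
have [|r cr rx] := @ereal_between R c%:E (phi x) _ cx; first by rewrite lee_fin.
have [f [cf f01 fx fs]] := @bump_pt R K hausK lcK x _ (pl r) rx.
have r0 : (0 <= r)%R by move: cr; rewrite lte_fin; lra.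
exists (fun x => r * f x)%R; split.
- exact: Cc_scale.
- by move=> y; have /andP[? _] := f01 y; rewrite mulr_ge0.
- move=> y; have [->|/fs/= h] := eqVneq (f y) 0%R; first by rewrite mulr0.
  by apply: le_trans (ltW h); rewrite lee_fin ler_piMr//; case/andP: (f01 y).
- by rewrite fx mulr1 -lte_fin.
Qed.

Section Density.
Variable mu : {measure set bK -> \bar R}.

Lemma integral_lscD phi psi : lsc_ge0 phi -> lsc_ge0 psi ->
  \int[mu]_x (phi x + psi x) = \int[mu]_x phi x + \int[mu]_x psi x.
Proof.
move=> lp lq; apply: ge0_integralD => //;
  by [move=> x _; exact: lp.1|move=> x _; exact: lq.1|exact: lsc_ge0_measurable].
Qed.

Lemma integral_lscZ (k : R) phi : (0 <= k)%R -> lsc_ge0 phi ->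
  \int[mu]_x (k%:E * phi x) = k%:E * \int[mu]_x phi x.
Proof.
move=> k0 lp; apply: ge0_integralZl_EFin => //;
  by [move=> x _; exact: lp.1|exact: lsc_ge0_measurable].
Qed.

Hypothesis rmu : radon mu.

(** The minorants in C_c(K) are directed under maximum, so [tau_smooth] applies. *)
Lemma lsc_integral_le phi (B : \bar R) : lsc_ge0 phi ->
  (forall f, Cc f -> (forall x, (0 <= f x)%R) -> (forall x, (f x)%:E <= phi x) ->
    \int[mu]_x (f x)%:E <= B) -> \int[mu]_x phi x <= B.
Proof.
move=> lp h.
apply: (proj2 (@tau_smooth R K hausK mu rmu
  [set f | [/\ Cc f, (forall x, 0 <= f x)%R & (forall x, (f x)%:E <= phi x)]] phi B _ _ _ _ _ _)).
- exists (fun=> 0%R); split => //; [exact: Cc0|exact: lp.1].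
- by move=> f [cf f0 _]; split => //; exact: Cc_continuous.
- move=> f g [cf f0 fp] [cg g0 gp]; exists (fun x => Num.max (f x) (g x)).
    split; [exact: Cc_max|by move=> x; rewrite le_max f0|].
    by move=> x; rewrite EFin_max ge_max fp gp.
  by move=> x; rewrite !le_max !lexx orbT.
- by move=> f x [].
- by move=> x c /(lsc_test lp)[f [? ? ? ?]]; exists f.
- by move=> f [? ? ?]; exact: h.
Qed.

Lemma radon_outer (A : set bK) (e : R) : measurable A -> mu A < +oo -> (0 < e)%R ->
  exists U : set K, [/\ open U, A `<=` U & mu U <= mu A + e%:E].
Proof.
move=> mA Afin e0; have [_ /(_ A mA) hA _] := rmu.
have fA : ereal_inf [set mu U | U in [set U : set K | open U /\ A `<=` U]] \is a fin_num.
  by rewrite -hA ge0_fin_numE.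
have [_ [U [oU AU] <-] h] := lb_ereal_inf_adherent e0 fA.
by exists U; split => //; rewrite hA ltW.
Qed.

Lemma radon_inner U (e : R) : open U -> mu U < +oo -> (0 < e)%R ->
  exists C : set K, [/\ compact C, C `<=` U & mu ((U : set bK) `\` C) <= e%:E].
Proof.
move=> oU Ufin e0; have [_ _ /(_ U oU) hU] := rmu.
have fU : ereal_sup [set mu C | C in [set C : set K | compact C /\ C `<=` U]] \is a fin_num.
  by rewrite -hU ge0_fin_numE.
have [_ [C [cC CU] <-] h] := ub_ereal_sup_adherent e0 fU.
exists C; split => //; rewrite measureD//; [|exact: borel_open|exact: (borel_compact hausK)].
move: h; rewrite -hU setIidr//.
have fC : mu C \is a fin_num.
  by rewrite ge0_fin_numE// (le_lt_trans _ Ufin)// le_measure// inE;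
    [exact: (borel_compact hausK)|exact: borel_open].
rewrite -hU in fU.
have gen (u c : \bar R) : u \is a fin_num -> c \is a fin_num ->
    u - e%:E < c -> u - c <= e%:E.
  by move: u c => [u| |] [c| |]// _ _; rewrite -!EFinB lte_fin lee_fin; lra.
exact: gen.
Qed.

(** L^1-density with an error bound valid at every point. Unlike the error itself, the majorant can
    be translated and convolved with control of its integral. *)
Definition Cc_approximable (f : K -> R) := forall e : R, (0 < e)%R ->
  exists v phi, [/\ Cc v, lsc_ge0 phi, (forall x, (`|f x - v x|)%:E <= phi x) &
    \int[mu]_x phi x <= e%:E].

(** Take U open around A, C compact in U, W open around U \ A, with U \ C and W small. A bump equal
    to 1 on C and supported in U agrees with the indicator of A off the open set (U \ C) [|] W. *)
Lemma approx_indic (A : set bK) : measurable A -> mu A < +oo -> Cc_approximable (\1_A).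
Proof.
move=> mA Afin e e0; have e2 : (0 < e / 2)%R by rewrite divr_gt0.
have e4 : (0 < e / 4)%R by rewrite divr_gt0.
have [U [oU AU hU]] := radon_outer mA Afin e4.
have Ufin : mu U < +oo by apply: le_lt_trans hU _; rewrite lte_add_pinfty ?ltry.
have [C [cC CU hC]] := radon_inner oU Ufin e2.
have mU : measurable (U : set bK) by exact: borel_open.
have mUA : mu (U `\` A) <= (e / 4)%:E.
  have fA : mu A \is a fin_num by rewrite ge0_fin_numE.
  have fU : mu U \is a fin_num by rewrite ge0_fin_numE.
  rewrite measureD// setIidr//.
  have gen (u c : \bar R) : u \is a fin_num -> c \is a fin_num ->
      u <= c + (e / 4)%:E -> u - c <= (e / 4)%:E.
    by move: u c => [u| |] [c| |]// _ _; rewrite -!EFinD !lee_fin; lra.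
  exact: gen.
have [W [oW UAW hW]] : exists W : set K, [/\ open W, U `\` A `<=` W & mu W <= (e / 2)%:E].
  have [||W [oW UW hW]] := @radon_outer (U `\` A) _ _ _ e4.
  - exact: measurableD.
  - by apply: le_lt_trans mUA _; rewrite ltry.
  - exists W; split => //; apply: le_trans hW _.
    apply: (@le_trans _ _ ((e/4)%:E + (e/4)%:E)); first exact: leeD2r.
    by rewrite -EFinD lee_fin; lra.
have [v [cv v01 v1 vs]] := @bump_set R K hausK lcK C U cC oU CU.
have oV : open ((U `\` C) `|` W).
  apply: openU => //; apply: openI => //; apply: closed_openC; exact: compact_closed.
exists v, (fun x => (1 * \1_((U `\` C) `|` W) x)%:E); split => //.
- exact: lsc_indic.
- move=> x; rewrite lee_fin mul1r !indicE.
  have /andP[v0x v1x] := v01 x.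
  have [/set_mem xV|xV] := boolP (x \in (U `\` C) `|` W).
    by rewrite ler_norml; case: (x \in A); rewrite /=; apply/andP; split; lra.
  have {}xV : ~ ((U `\` C) `|` W) x by move=> h; rewrite mem_set in xV.
  have [/set_mem Ax|Ax] := boolP (x \in A).
    rewrite v1 ?subrr ?normr0//; apply: contrapT => nC; apply: xV; left; split => //.
    exact: AU.
  rewrite sub0r normrN; have [->|/vs Ux] := eqVneq (v x) 0%R; first by rewrite normr0.
  exfalso; apply: xV; right; apply: UAW; split => // /mem_set; exact/negP.
- under eq_integral do rewrite mul1r.
  have mV : measurable ((U `\` C) `|` W : set bK) by exact: borel_open.
  rewrite integral_indic// setIT.
  apply: (@le_trans _ _ (mu (U `\` C) + mu W)).
    apply: measureU2 => //; last exact: borel_open.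
    by apply: measurableD => //; exact: (borel_compact hausK).
  apply: (le_trans (leeD hC hW)); rewrite -EFinD lee_fin; lra.
Qed.

Lemma approx_lin (a : R) f g : Cc_approximable f -> Cc_approximable g ->
  Cc_approximable (fun x => a * f x + g x)%R.
Proof.
move=> hf hg e e0; have a1 : (0 < `|a| + 1)%R by rewrite ltr_wpDl.
have e1 : (0 < e / 2 / (`|a| + 1))%R by rewrite !divr_gt0.
have e2 : (0 < e / 2)%R by rewrite !divr_gt0.
have [v [phi [cv lphi hv Iphi]]] := hf _ e1; have [w [psi [cw lpsi hw Ipsi]]] := hg _ e2.
exists (fun x => a * v x + w x)%R, (fun x => `|a|%:E * phi x + psi x); split.
- exact: Cc_lin.
- by apply: lsc_add => //; exact: lsc_scale.
- move=> x; rewrite (_ : (_ - _)%R = a * (f x - v x) + (g x - w x))%R; last by ring.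
  apply: (@le_trans _ _ ((`|a| * `|f x - v x|)%:E + (`|g x - w x|)%:E)).
    by rewrite -EFinD lee_fin -normrM ler_normD.
  by rewrite EFinM leeD// lee_wpmul2l.
- rewrite ge0_integralD//.
  + rewrite ge0_integralZl_EFin//; [|by move=> x _; exact: lphi.1|exact: lsc_ge0_measurable].
    apply: (@le_trans _ _ (`|a|%:E * (e / 2 / (`|a| + 1))%:E + (e / 2)%:E)).
      by rewrite leeD// lee_wpmul2l.
    rewrite -EFinM -EFinD lee_fin [leRHS](_ : _ = e / 2 + e / 2)%R; last by lra.
    by rewrite lerD2r mulrCA ger_pMr// ler_pdivrMr// mul1r lerDl.
  + by move=> x _; rewrite mule_ge0//; exact: lphi.1.
  + by apply: measurable_funeM; exact: lsc_ge0_measurable.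
  + by move=> x _; exact: lpsi.1.
  + exact: lsc_ge0_measurable.
Qed.

Lemma approx0 : Cc_approximable (fun=> 0%R).
Proof.
move=> e e0; exists (fun=> 0%R), (fun x => (0 * \1_(setT : set K) x)%:E); split.
- exact: Cc0.
- by apply: lsc_indic => //; exact: openT.
- by move=> x; rewrite subrr normr0 mul0r.
- by rewrite integral0_eq ?lee_fin ?ltW// => x _; rewrite mul0r.
Qed.

Import HBNNSimple.

Lemma approx_nnsfun (h : {nnsfun bK >-> R}) : \int[mu]_x (h x)%:E < +oo -> Cc_approximable h.
Proof.
move=> hfin.
have -> : (h : K -> R) = (fun x => \sum_(r <- finmap.enum_fset (fset_set (range h))) r * \1_(h @^-1` [set r]) x)%R.
  by apply/funext => x; rewrite {1}(fimfunE h x) fsbig_finite.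
have : forall r, r \in (finmap.enum_fset (fset_set (range h))) -> (0 <= r)%R.
  by move=> r; rewrite in_fset_set// inE => -[x _ <-].
elim: (finmap.enum_fset (fset_set (range h))) => [|r s ih] hs.
  have -> : (fun x : K => \sum_(r <- [::]) r * \1_(h @^-1` [set r]) x)%R = fun=> 0%R.
    by apply/funext => x; rewrite big_nil.
  exact: approx0.
have -> : (fun x : K => \sum_(r <- r :: s) r * \1_(h @^-1` [set r]) x)%R =
   (fun x => r * \1_(h @^-1` [set r]) x + \sum_(r <- s) r * \1_(h @^-1` [set r]) x)%R.
  by apply/funext => x; rewrite big_cons.
have {}ih := ih (fun r' r's => hs r' (@mem_behead _ (r :: s) r' r's)).
(* The level set of the value 0 may have infinite measure, but its term is zero. *)
have [->|rn0] := eqVneq r 0%R.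
  by under eq_fun do rewrite mul0r add0r.
have r0 : (0 < r)%R by rewrite lt_def rn0 hs// mem_head.
apply: approx_lin => //; apply: approx_indic => //.
rewrite -(setIT (h @^-1` [set r])) -integral_indic//.
have : \int[mu]_x (r%:E * (\1_(h @^-1` [set r]) x)%:E) < +oo.
  apply: le_lt_trans hfin; apply: le_lower_integral => x.
    by rewrite mule_ge0// lee_fin ltW.
  rewrite -EFinM lee_fin indicE; case: (boolP (x \in _)) => [/set_mem <-|_].
    by rewrite mulr1.
  by rewrite mulr0.
rewrite ge0_integralZl_EFin//; [|by apply/measurable_EFinP; exact: measurable_indic|exact: ltW].
by move=> hlt; rewrite ltey; apply: contraTneq hlt => ->; rewrite mulry gtr0_sg// mul1e.
Qed.

(** [|v| + phi] dominates f, and \int |v| exceeds \int f by at most \int phi: two errors of e /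
    2. *)
Lemma approx_majorant f (e : R) : measurable_fun setT (f : bK -> R) -> (forall x, (0 <= f x)%R) ->
  Cc_approximable f -> (0 < e)%R -> exists psi, [/\ lsc_ge0 psi, (forall x, (f x)%:E <= psi x) &
    \int[mu]_x psi x <= \int[mu]_x (f x)%:E + e%:E].
Proof.
move=> mf f0 af e0; have e2 : (0 < e / 2)%R by rewrite divr_gt0.
have [v [phi [cv lphi hv Iphi]]] := af _ e2.
have mphi := lsc_ge0_measurable lphi.
have mv : measurable_fun [set: bK] (fun x : bK => (`|v x|)%:E).
  by apply: lsc_ge0_measurable; apply: lsc_norm; exact: Cc_continuous.
exists (fun x => (`|v x|)%:E + phi x); split.
- by apply: lsc_add => //; apply: lsc_norm; exact: Cc_continuous.
- move=> x; apply: (@le_trans _ _ ((`|v x|)%:E + (`|f x - v x|)%:E)); last exact: leeD2l.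
  rewrite -EFinD lee_fin addrC; apply: (le_trans (ler_norm _)).
  by rewrite -[X in (`|X| <= _)%R](subrK (v x)) ler_normD.
- have p0 x : 0 <= phi x by exact: lphi.1.
  rewrite ge0_integralD//.
  apply: (@le_trans _ _ (\int[mu]_x ((f x)%:E + phi x) + \int[mu]_x phi x)).
    apply: leeD2r; apply: le_lower_integral => // x.
    apply: (@le_trans _ _ ((f x)%:E + (`|f x - v x|)%:E)); last exact: leeD2l.
    rewrite -EFinD lee_fin -[X in (_ <= X + _)%R](ger0_norm (f0 x)) -[X in (`|X| <= _)%R](subKr (f x)).
    exact: ler_normB.
  rewrite ge0_integralD//; [|by move=> x _; rewrite lee_fin|exact/measurable_EFinP].
  rewrite -addeA leeD2l//; apply: (le_trans (leeD Iphi Iphi)).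
  by rewrite -EFinD lee_fin; lra.
Qed.

(** The Vitali-Caratheodory argument: f is the sum of the increments of its simple approximations,
    each increment gets a majorant with error e / 2^(n+1), and the majorants are added up. *)
Lemma lsc_majorant f (e : R) : measurable_fun setT (f : bK -> R) -> (forall x, (0 <= f x)%R) ->
  \int[mu]_x (f x)%:E < +oo -> (0 < e)%R -> exists psi, [/\ lsc_ge0 psi,
    (forall x, (f x)%:E <= psi x) & \int[mu]_x psi x <= \int[mu]_x (f x)%:E + e%:E].
Proof.
move=> mf f0 ffin e0.
have mF : measurable_fun [set: bK] (EFin \o f) by exact/measurable_EFinP.
pose h := nnsfun_approx measurableT mF.
have hcvg x : (h n x)%:E @[n --> \oo] --> (f x)%:E.
  by apply: cvg_nnsfun_approx => // y _; rewrite lee_fin.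
have hnd x n m : (n <= m)%N -> (h n x <= h m x)%R.
  by move=> nm; have /lefP := @nd_nnsfun_approx _ _ _ _ measurableT _ mF n m nm; exact.
have hf n x : (h n x <= f x)%R.
  rewrite -lee_fin -(cvg_lim _ (hcvg x))//; apply: lime_ge; first by apply/cvg_ex; exists (f x)%:E.
  by exists n => // m /= nm; rewrite lee_fin; exact: hnd.
have hfin n : \int[mu]_x (h n x)%:E < +oo.
  by apply: le_lt_trans ffin; apply: le_lower_integral => x; rewrite lee_fin//; exact: hf.
have mh n : measurable_fun [set: bK] (h n : bK -> R) by [].
pose d n x : R := (if n is m.+1 then h m.+1 x - h m x else h 0%N x)%R.
have d0 n x : (0 <= d n x)%R.
  by case: n => [|n] /=; rewrite ?fun_ge0// subr_ge0 hnd.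
have md n : measurable_fun [set: bK] (d n : bK -> R).
  by case: n => [|n] /=; [exact: mh|exact: measurable_funB].
have ad n : Cc_approximable (d n).
  case: n => [|n]; first exact: approx_nnsfun.
  have := approx_lin (-1) (approx_nnsfun (hfin n)) (approx_nnsfun (hfin n.+1)).
  by under eq_fun do rewrite mulN1r addrC.
have sumd n x : \sum_(0 <= i < n.+1) (d i x)%:E = (h n x)%:E.
  elim: n => [|n ih]; first by rewrite big_nat1.
  by rewrite big_nat_recr//= ih -EFinD addrC subrK.
have serd x : \sum_(i <oo) (d i x)%:E = (f x)%:E.
  apply: cvg_lim => //; rewrite -(cvg_shiftS _).
  by under eq_fun do rewrite sumd; exact: hcvg.
have /choice[psi hpsi] : forall n, exists psi, [/\ lsc_ge0 psi, (forall x, (d n x)%:E <= psi x) &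
    \int[mu]_x psi x <= \int[mu]_x (d n x)%:E + (e / (2 ^ n.+1)%:R)%:E].
  move=> n; apply: approx_majorant => //.
  by rewrite divr_gt0// ltr0n expn_gt0.
have lpsi n : lsc_ge0 (psi n) by case: (hpsi n).
exists (fun x => \sum_(n <oo) psi n x); split.
- exact: lsc_nneseries.
- move=> x; rewrite -serd; apply: lee_nneseries => n _; first by rewrite lee_fin.
  by case: (hpsi n).
- rewrite integral_nneseries//; last 2 first.
  + by move=> n; exact: lsc_ge0_measurable.
  + by move=> n x _; exact: (lpsi n).1.
  under [in leRHS]eq_integral do rewrite -serd.
  rewrite integral_nneseries//; last 2 first.
  + by move=> n; apply/measurable_EFinP.
  + by move=> n x _; rewrite lee_fin.
  apply: le_trans (epsilon_trick _ _ (ltW e0)); last first.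
    by move=> n; apply: integral_ge0 => x _; rewrite lee_fin.
  apply: lee_nneseries => n _; last by case: (hpsi n).
  by move=> _; apply: integral_ge0 => x _; exact: (lpsi n).1.
Qed.

(** Only a simple h below f with nearly the same integral is approximated; the remainder f - h is
    absorbed whole into the majorant. *)
Lemma approx_nonneg f : measurable_fun setT (f : bK -> R) -> (forall x, (0 <= f x)%R) ->
  \int[mu]_x (f x)%:E < +oo -> Cc_approximable f.
Proof.
move=> mf f0 ffin e e0; have e4 : (0 < e / 4)%R by rewrite divr_gt0.
have e2 : (0 < e / 2)%R by rewrite divr_gt0.
have If : ereal_sup [set sintegral mu h | h in
   [set h : {nnsfun bK >-> R} | forall x, (h x)%:E <= (f x)%:E]] = \int[mu]_x (f x)%:E.
  by rewrite [RHS]ge0_integralTE// => x; rewrite lee_fin.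
have fin : ereal_sup [set sintegral mu h | h in
   [set h : {nnsfun bK >-> R} | forall x, (h x)%:E <= (f x)%:E]] \is a fin_num.
  by rewrite If ge0_fin_numE//; apply: integral_ge0 => x _; rewrite lee_fin.
have [_ [h hf <-] Ih] := ub_ereal_sup_adherent e4 fin.
rewrite If -integralT_nnsfun in Ih.
have hfR x : (h x <= f x)%R by rewrite -lee_fin.
have hfin : \int[mu]_x (h x)%:E < +oo.
  by apply: le_lt_trans ffin; apply: le_lower_integral => x; rewrite lee_fin//; exact: hf.
have mfh : measurable_fun [set: bK] (fun x : bK => f x - h x)%R by exact: measurable_funB.
have fh0 x : (0 <= f x - h x)%R by rewrite subr_ge0.
have Isum : \int[mu]_x (f x)%:E = \int[mu]_x (f x - h x)%:E + \int[mu]_x (h x)%:E.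
  rewrite -ge0_integralD//.
  - by apply: eq_integral => x _; rewrite -EFinD subrK.
  - by move=> x _; rewrite lee_fin.
  - exact/measurable_EFinP.
  - by move=> x _; rewrite lee_fin.
  - by apply/measurable_EFinP.
have I0 : 0 <= \int[mu]_x (f x - h x)%:E by apply: integral_ge0 => x _; rewrite lee_fin.
have J0 : 0 <= \int[mu]_x (h x)%:E by apply: integral_ge0 => x _; rewrite lee_fin.
have Ifh : \int[mu]_x (f x - h x)%:E <= (e / 4)%:E.
  have gen (a b c : \bar R) : 0 <= a -> 0 <= b -> b < +oo -> c = a + b -> c < +oo -> c - (e / 4)%:E < b -> a <= (e / 4)%:E.
    move: a b c => [a| |] [b| |] [c| |]// _ _ _; rewrite -EFinD => -[->] _.
    by rewrite -EFinB lte_fin lee_fin; lra.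
  exact: gen I0 J0 hfin Isum ffin Ih.
have [psi [lpsi hpsi Ipsi]] := lsc_majorant mfh fh0 (le_lt_trans Ifh (ltry _)) e4.
have [v [phi [cv lphi hv Iphi]]] := approx_nnsfun hfin e2.
exists v, (fun x => psi x + phi x); split => //.
- exact: lsc_add.
- move=> x; apply: (@le_trans _ _ ((f x - h x)%:E + (`|h x - v x|)%:E)); last exact: leeD.
  rewrite -EFinD lee_fin -[X in (_ <= X + _)%R](ger0_norm (fh0 x)).
  by rewrite (_ : f x - v x = (f x - h x) + (h x - v x))%R ?ler_normD//; ring.
- rewrite integral_lscD//; apply: (@le_trans _ _ ((e/4)%:E + (e/4)%:E + (e/2)%:E)).
    by rewrite leeD//; apply: le_trans Ipsi _; rewrite leeD2r.
  by rewrite -!EFinD lee_fin; lra.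
Qed.

Lemma approx_integrable f : mu.-integrable setT (EFin \o f : bK -> \bar R) -> Cc_approximable f.
Proof.
move=> /integrableP[mF Ifin].
have mf : measurable_fun setT (f : bK -> R) by exact/measurable_EFinP.
have hp (g : bK -> R) : measurable_fun setT g -> (forall x, (0 <= g x <= `|f x|)%R) -> Cc_approximable g.
  move=> mg gf; apply: approx_nonneg => //; first by move=> x; case/andP: (gf x).
  apply: le_lt_trans Ifin; apply: le_lower_integral => x; rewrite lee_fin; by case/andP: (gf x).
have h1 := hp (fun x => Num.max (- f x) 0)%R; have h2 := hp (fun x => Num.max (f x) 0)%R.
have -> : f = (fun x => - 1 * Num.max (- f x) 0 + Num.max (f x) 0)%R.
  by apply/funext => x; rewrite /Num.max; case: ifP; case: ifP; lra.
apply: approx_lin; [apply: h1|apply: h2].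
- by apply: measurable_maxr => //; exact: measurableT_comp.
- by move=> x; rewrite le_max lexx orbT ge_max normr_ge0 andbT -normrN ler_norm.
- exact: measurable_maxr.
- by move=> x; rewrite le_max lexx orbT ge_max normr_ge0 andbT ler_norm.
Qed.
End Density.
End LscRadon.

(** * Hypergroups and the adjoint of translation *)

Section Support.
Variables (R : realType) (K : ptopologicalType).
Hypothesis hausK : hausdorff_space K.
Local Notation bK := (borel K).
Variable mu : {measure set bK -> \bar R}.
Hypothesis rmu : radon mu.

Lemma msupp_open : open (~` msupp mu).
Proof.
have nbhs_open (N : set K) : (forall z, N z -> nbhs z N) -> open N by rewrite openE.
apply: nbhs_open => z /existsNP[U /not_implyP[oU /not_implyP[Uz h]]].
rewrite nbhsE; exists U; first by [].
by move=> w Uw; apply/existsNP; exists U; apply/not_implyP; split => //; apply/not_implyP.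
Qed.

(** Each compact subset of the complement is covered by finitely many null open sets, and inner
    regularity finishes. *)
Lemma msupp_null : mu (~` msupp mu) = 0%E.
Proof.
have [_ _ hU0] := rmu; rewrite (hU0 _ msupp_open).
apply/eqP; rewrite eq_le; apply/andP; split; last first.
  by apply: ereal_sup_ubound; exists set0; [split; [exact: compact0|]|rewrite measure0].
apply: ge_ereal_sup => _ [C [cC CS] <-].
have /choice[U hU] : forall z, exists U, C z -> [/\ open U, U z & mu U = 0%E].
  move=> z; have [Cz|] := pselect (C z); last by exists set0.
  have /existsNP[U /not_implyP[oU /not_implyP[Uz h]]] := CS z Cz.
  exists U => _; split => //; apply/eqP; rewrite eq_le measure_ge0 andbT leNgt.
  exact/negP.
have [z /hU[]//|s sC Cs] := @finite_cover K C U cC.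
have mU z : z \in s -> measurable (U z : set bK).
  by move=> /sC /hU[oU _ _]; exact: borel_open.
have Cm : measurable (C : set bK) by exact: borel_compact.
suff [mB B0] : measurable (\big[setU/set0]_(z <- s) U z : set bK) /\ mu (\big[setU/set0]_(z <- s) U z) = 0%E.
  rewrite -B0; apply: le_measure; rewrite ?inE// => x /Cs[z zs Uz].
  by rewrite -bigcup_seq; exists z.
have h z : z \in s -> measurable (U z : set bK) /\ mu (U z) = 0%E.
  by move=> zs; split; [exact: mU|case: (hU z (sC z zs))].
elim: s {Cs mU sC} h => [|z s ih] h; first by rewrite big_nil measure0.
rewrite big_cons; have [z1 z2] := h z (mem_head _ _).
have [|i1 i2] := ih; first by move=> z' z's; apply: h; rewrite inE z's orbT.
split; first exact: measurableU.
have le0 (a : \bar R) : a = 0%E -> (a <= 0)%E by move=> ->.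
apply/eqP; rewrite eq_le measure_ge0 andbT; apply: (le_trans (measureU2 mu z1 i1)).
rewrite -[leRHS]adde0; apply: leeD; apply: le0; [exact: z2|exact: i2].
Qed.

(* Off the support the majorant is set to +oo, at no cost for the integral. *)
Lemma integral_close_msupp (u v : K -> R) (E : K -> \bar R) :
  measurable_fun [set: bK] (E : bK -> \bar R) -> (forall x, 0 <= E x)%E ->
  mu.-integrable setT (EFin \o v : bK -> \bar R) ->
  (forall x, msupp mu x -> (`|u x - v x|)%:E <= E x)%E ->
  ((`| \int[mu]_x u x - \int[mu]_x v x |)%:E <= \int[mu]_x E x + \int[mu]_x E x)%E.
Proof.
move=> mE E0 iv uv.
have mS : measurable (~` msupp mu : set bK) by apply: borel_open; exact: msupp_open.
pose I (x : bK) : \bar R := (+oo * (\1_(~` msupp mu) x)%:E)%E.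
have I0 x : (0 <= I x)%E by rewrite mule_ge0// lee_fin.
have mi : measurable_fun [set: bK] (fun x : bK => (\1_(~` msupp mu) x)%:E : \bar R).
  by apply/measurable_EFinP; exact: measurable_indic.
have mI : measurable_fun [set: bK] I by exact: emeasurable_funM.
have -> : (\int[mu]_x E x = \int[mu]_x (E x + I x))%E.
  rewrite ge0_integralD// [X in (_ + X)%E](_ : _ = 0%E) ?adde0//.
  by rewrite ge0_integralZl// integral_indic// setIT msupp_null mule0.
apply: integral_close => //.
- exact: emeasurable_funD.
- by move=> x; rewrite adde_ge0.
- move=> x; have [Sx|nSx] := pselect (msupp mu x).
    by apply: le_trans (uv x Sx) _; rewrite leeDl.
  rewrite /I indicE mem_set// mulr1n mule1 addey ?leey//.
  by rewrite -ltNye (lt_le_trans _ (E0 x)).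
Qed.

Lemma eq_Rintegral_msupp (u v : K -> R) : mu.-integrable setT (EFin \o v : bK -> \bar R) ->
  (forall x, msupp mu x -> u x = v x) -> \int[mu]_x u x = \int[mu]_x v x.
Proof.
move=> iv uv; have := @integral_close_msupp u v (fun=> 0%E) (measurable_cst _) (fun=> lexx _) iv.
rewrite integral0 adde0 lee_fin normr_le0 subr_eq0 => h; apply/eqP/h.
by move=> x /uv ->; rewrite subrr normr0.
Qed.

Lemma Rintegral_msupp_gt0 (f : K -> R) z : Cc f -> (forall x, 0 <= f x) -> msupp mu z -> 0 < f z ->
  0 < \int[mu]_x f x.
Proof.
move=> cf f0 Sz fz.
have oU : open [set x | f z / 2 < f x].
  by apply: (@open_comp _ _ f [set t | f z / 2 < t]); [move=> ? _; exact: (Cc_continuous cf)|exact: open_gt].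
have mU : measurable ([set x | f z / 2 < f x] : set bK) by exact: borel_open.
have Up := Sz _ oU; rewrite /= in Up.
have fz2 : 0 < f z / 2 by rewrite divr_gt0.
rewrite -lte_fin /Rintegral fineK; last by apply: integrable_fin_num => //; exact: Cc_integrable.
apply: (@lt_le_trans _ _ (\int[mu]_x ((f z / 2)%:E * (\1_[set x | f z / 2 < f x] x)%:E))%E).
  rewrite ge0_integralZl_EFin//; [|by apply/measurable_EFinP; exact: measurable_indic|exact: ltW].
  by rewrite mule_gt0// integral_indic// setIT; apply: Up; lra.
apply: le_lower_integral => x; first by rewrite mule_ge0// lee_fin ltW.
rewrite -EFinM lee_fin indicE; case: (boolP (x \in _)) => [/set_mem /= h|_].
  by rewrite mulr1 ltW.
by rewrite mulr0.
Qed.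
End Support.

Section Hypergroup.
Variables (R : realType) (K : ptopologicalType) (H : hypergroup R K).
Local Notation bK := (borel K).
Local Notation P x y f := (\int[conv H x y]_t f t).
Local Notation S x y := (msupp (conv H x y)).
Local Notation "x ~" := (hinv H x) (at level 8, format "x ~").
Implicit Types (f g h : K -> R) (x y z : K).

Let hausK := hyper_hausdorff H.
Let lcK := hyper_locally_compact H.

Definition bounded_cont f := continuous f /\ exists M, forall x, `|f x| <= M.

Lemma Cc_bounded_cont f : Cc f -> bounded_cont f.
Proof. by move=> cf; split; [exact: Cc_continuous|have [M _ hM] := Cc_bounded cf; exists M]. Qed.

Lemma bounded_cont_integrable x y f : bounded_cont f ->
  (conv H x y).-integrable setT (EFin \o f : bK -> \bar R).
Proof.
move=> [cf [M hM]]; apply: measurable_bounded_integrable => //.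
- by apply: (@le_lt_trans _ _ 1%E); [exact: probability_le1|exact: ltry].
- exact: borel_continuous.
- by exists M; split; [exact: num_real|move=> r Mr t _; exact: le_trans (hM t) (ltW Mr)].
Qed.

Lemma conv_functional x y : Cc_functional (fun f => P x y f).
Proof. exact: Rintegral_functional hausK _ (conv_radon H x y). Qed.

Lemma conv_nonempty x y : S x y !=set0.
Proof.
apply: contrapT => /set0P/negP; rewrite negbK => /eqP S0.
have := msupp_null hausK (conv_radon H x y).
rewrite S0 setC0 => h; have := probability_setT (conv H x y).
by move=> h'; have := etrans (esym h) h' => /eqP; rewrite eqe eq_sym oner_eq0.
Qed.

Lemma eq_conv x y f g : bounded_cont g -> (forall t, S x y t -> f t = g t) -> P x y f = P x y g.
Proof.
move=> bg; apply: (eq_Rintegral_msupp hausK) => //; first exact: conv_radon.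
exact: bounded_cont_integrable.
Qed.

Lemma conv_supp_inv x y z : S x y z -> S y~ x~ z~.
Proof.
move=> h U oU Uz; rewrite (conv_inv H x y (borel_open oU)); apply: h => //.
by apply: (@open_comp _ _ (hinv H) U) => // t _; exact: hinv_cont.
Qed.

Lemma conv_supp_nbhd x y V : open V -> S x y `<=` V -> \forall p \near (x, y), S p.1 p.2 `<=` V.
Proof.
move=> oV SV; have oW := @conv_supp_cont _ _ H setT V openT oV.
have : nbhs (x, y) [set xy : K * K | S xy.1 xy.2 `&` setT !=set0 /\ S xy.1 xy.2 `<=` V].
  by apply: open_nbhs_nbhs; split => //; rewrite /= setIT; split => //; exact: conv_nonempty.
by apply: filterS => p [].
Qed.

(** A bump at w vanishing on the support of x * y stays below 1/2 on nearby supports and above 1/2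
    near w. *)
Lemma conv_supp_closed x y w : ~ S x y w -> \forall p \near (x, y) & w' \near w, ~ S p.1 p.2 w'.
Proof.
move=> nS; have oS : open (~` S x y) by exact: msupp_open.
have [f [cf f01 fw fs]] := @bump_pt R K hausK lcK w _ oS nS.
have cf' := Cc_continuous cf.
have o1 : open [set t | f t < 1/2].
  by apply: (@open_comp _ _ f [set t | t < 1/2]); [move=> ? _; exact: cf'|exact: open_lt].
have o2 : open [set t | 1/2 < f t].
  by apply: (@open_comp _ _ f [set t | 1/2 < t]); [move=> ? _; exact: cf'|exact: open_gt].
have h1 : \forall p \near (x, y), S p.1 p.2 `<=` [set t | f t < 1/2].
  apply: conv_supp_nbhd => // t St /=; have [->|/fs//] := eqVneq (f t) 0; lra.
have h2 : \forall w' \near w, 1/2 < f w'.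
  by apply: open_nbhs_nbhs; split => //=; rewrite fw; lra.
near=> p w' => Spw.
have a1 : f w' < 1/2 by apply: (near h1 p).
have : 1/2 < f w' by near: w'.
lra.
Unshelve. all: by end_near. Qed.

(** Supports near a given pair lie in one compact set; compactness of A x B makes the choice
    uniform. *)
Lemma conv_supp_compact_union A B : compact A -> compact B ->
  exists2 C, compact C & forall x y, A x -> B y -> S x y `<=` C.
Proof.
move=> cA cB.
(* The filter of sufficiently large compact sets, so that the near-covering form of compactness
   applies to A x B. *)
pose F : set_system (set K) := [set Q | exists2 C0, compact C0 & forall C, compact C -> C0 `<=` C -> Q C].
have FF : Filter F.
  split.
  - by exists set0 => //; exact: compact0.
  - move=> Q1 Q2 [C1 c1 h1] [C2 c2 h2]; exists (C1 `|` C2); first exact: compactU.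
    move=> C cC sub; split; [apply: h1 => // t ?|apply: h2 => // t ?]; apply: sub; [by left|by right].
  - by move=> Q1 Q2 sub [C0 c0 h]; exists C0 => // C cC sC; apply/sub/h.
have /compact_near_coveringP := compact_setX cA cB.
move=> /(_ _ F (fun C (p : K * K) => S p.1 p.2 `<=` C) FF)[].
  move=> [x y] [/= Ax By].
  have [V [oV SV [C cC VC]]] := relcompact_nbhd_set lcK (@conv_supp_compact _ _ H x y).
  exists ([set p | S p.1 p.2 `<=` V], [set D | C `<=` D]) => /=.
    split; first exact: conv_supp_nbhd.
    by exists C.
  by move=> [[x' y'] D] [/= h1 h2]; exact: subset_trans h1 (subset_trans VC h2).
move=> C0 cC0 h; exists C0 => // x y Ax By; exact: (h C0 cC0 (@subset_refl _ C0) (x, y)).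
Qed.

Lemma conv_supp_id_inv x : S x~ x (hid H).
Proof. by apply/conv_supp_id. Qed.

Lemma conv_cont_param f x : Cc f -> continuous (fun y => P x y f).
Proof.
move=> cf y; have h : (x, y') @[y' --> y] --> (x, y) by apply: cvg_pair; [exact: cvg_cst|exact: cvg_id].
exact: (cvg_comp _ _ h (@conv_cont _ _ H f cf (x, y))).
Qed.

Lemma conv_cont_param_l f y : Cc f -> continuous (fun x => P x y f).
Proof.
move=> cf x; have h : (x', y) @[x' --> x] --> (x, y) by apply: cvg_pair; [exact: cvg_id|exact: cvg_cst].
exact: (cvg_comp _ _ h (@conv_cont _ _ H f cf (x, y))).
Qed.

Lemma conv_ge0 x y f : (forall t, 0 <= f t) -> 0 <= P x y f.
Proof. by move=> f0; apply: Rintegral_ge0 => t _. Qed.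

Lemma conv_cst x y (M : R) : P x y (fun=> M) = M.
Proof.
rewrite Rintegral_cst//; transitivity (M * fine 1%E); last by rewrite /= mulr1.
by congr (M * fine _); exact: probability_setT.
Qed.

Lemma conv_bound x y f M : bounded_cont f -> (forall t, `|f t| <= M) -> `|P x y f| <= M.
Proof.
move=> bf fM; apply: (le_trans (le_normr_Rintegral _ (bounded_cont_integrable x y bf))) => //.
have iM : (conv H x y).-integrable setT (EFin \o (fun=> M) : bK -> \bar R).
  by apply: bounded_cont_integrable; split; [exact: cst_continuous|exists `|M|].
apply: (@le_trans _ _ (P x y (fun=> M))).
  apply: le_Rintegral => //; exact: integrable_norm (bounded_cont_integrable x y bf).
by rewrite conv_cst.
Qed.

Lemma conv_slice_bounded_cont x f : Cc f -> bounded_cont (fun y => P x y f).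
Proof.
move=> cf; split; first exact: conv_cont_param.
have [M _ hM] := Cc_bounded cf; exists M => y; apply: conv_bound => //.
exact: Cc_bounded_cont.
Qed.

Lemma conv_slice_bounded_cont_l y f : Cc f -> bounded_cont (fun x => P x y f).
Proof.
move=> cf; split; first exact: conv_cont_param_l.
have [M _ hM] := Cc_bounded cf; exists M => x; apply: conv_bound => //.
exact: Cc_bounded_cont.
Qed.

(* Since [e] lies in [c~ * c], which is contained in [(c~ * x) * z], some [t] in
   [c~ * x] is the inverse of [z]. *)
Lemma conv_supp_swap x z c : S x z c -> S x~ c z.
Proof.
move=> Sc; apply: contrapT => nS.
have ne t : S c~ x t -> ~ S t z (hid H).
  move=> St /conv_supp_id tz; apply: nS.
  by have := conv_supp_inv St; rewrite tz !hinvK.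
have : \forall w \near hid H, forall t, S c~ x t -> ~ S t z w.
  have /compact_near_coveringP := @conv_supp_compact _ _ H c~ x.
  apply; move=> t St; have := conv_supp_closed (ne t St).
  move=> [[Q W] /= [[[Q1 Q2] [/= q1 q2] Q12] hW] hQW].
  exists (Q1, W) => //= -[t' w] [/= Qt Ww]; apply: (hQW ((t', z), w)); split => //=.
  by apply: Q12; split => //=; exact: nbhs_singleton.
rewrite /prop_near1 nbhsE => -[W [oW We] hW].
have [f [cf f01 fe fs]] := @bump_pt R K hausK lcK (hid H) W oW We.
have f0 t : 0 <= f t by case/andP: (f01 t).
have z0 t : S c~ x t -> P t z f = 0.
  move=> St; rewrite (@eq_conv _ _ f (fun=> 0)).
  - by rewrite conv_cst.
  - by split; [exact: cst_continuous|exists 0 => _; rewrite normr0].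
  - by move=> w Sw; apply/eqP; apply: contraPT Sw => /fs/hW; exact.
have : P c~ x (fun t => P t z f) = 0.
  rewrite (@eq_conv _ _ _ (fun=> 0)) //.
  - by rewrite conv_cst.
  - by split; [exact: cst_continuous|exists 0 => _; rewrite normr0].
rewrite (conv_assoc H c~ x z cf) => pz.
have bg := conv_slice_bounded_cont c~ cf.
have gc : 0 < P c~ c f.
  apply: (Rintegral_msupp_gt0 hausK (conv_radon H c~ c) cf f0 (conv_supp_id_inv c)).
  by rewrite fe.
(* The positivity lemma asks for a function of C_c(K). That slices of C_c(K) functions are compactly
   supported is deduced later from the present lemma, hence the cutoff at c. *)
have [k [ck k01 kc]] := @cutoff R K hausK lcK [set c] (@compact_set1 K c).
have : 0 < P x z (fun t => k t * P c~ t f).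
  apply: (Rintegral_msupp_gt0 hausK (conv_radon H x z) _ _ Sc).
  - by apply: (Cc_mulr hausK) => //; exact: bg.1.
  - by move=> t; rewrite mulr_ge0//; [case/andP: (k01 t)|exact: conv_ge0].
  - by rewrite kc// mul1r.
suff : P x z (fun t => k t * P c~ t f) <= P x z (fun t => P c~ t f) by lra.
apply: le_Rintegral => //.
- by apply: bounded_cont_integrable; apply: Cc_bounded_cont; apply: (Cc_mulr hausK) => //; exact: bg.1.
- exact: bounded_cont_integrable.
- by move=> t _; have /andP[k0 k1] := k01 t; rewrite ler_piMl//; exact: conv_ge0.
Qed.

End Hypergroup.

Section Hypergroup.
Variables (R : realType) (K : ptopologicalType) (H : hypergroup R K).
Local Notation bK := (borel K).
Local Notation P x y f := (\int[conv H x y]_t f t).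
Local Notation S x y := (msupp (conv H x y)).
Local Notation "x ~" := (hinv H x) (at level 8, format "x ~").
Implicit Types (f g h : K -> R) (x y z : K).

Let hausK := hyper_hausdorff H.
Let lcK := hyper_locally_compact H.

Lemma bounded_cont_mulr f g : bounded_cont f -> bounded_cont g -> bounded_cont (fun x => f x * g x).
Proof.
move=> [cf [M hM]] [cg [N hN]]; split.
  by move=> x; apply: cvgM; [exact: cf|exact: cg].
by exists (M * N) => x; rewrite normrM ler_pM.
Qed.

Lemma bounded_cont_add f g : bounded_cont f -> bounded_cont g -> bounded_cont (fun x => f x + g x).
Proof.
move=> [cf [M hM]] [cg [N hN]]; split.
  by move=> x; apply: cvgD; [exact: cf|exact: cg].
by exists (M + N) => x; rewrite (le_trans (ler_normD _ _))// lerD.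
Qed.

Lemma bounded_cont_sub f g : bounded_cont f -> bounded_cont g -> bounded_cont (fun x => f x - g x).
Proof.
move=> [cf [M hM]] [cg [N hN]]; split.
  by move=> x; apply: cvgB; [exact: cf|exact: cg].
by exists (M + N) => x; rewrite (le_trans (ler_normB _ _))// lerD.
Qed.

Lemma bounded_cont_cst (a : R) : bounded_cont (fun _ : K => a).
Proof. by split; [exact: cst_continuous|exists `|a|]. Qed.

Lemma bounded_cont_inv f : bounded_cont f -> bounded_cont (fun x => f x~).
Proof.
move=> [cf [M hM]]; split; last by exists M.
by move=> x; apply: continuous_comp; [exact: hinv_cont|exact: cf].
Qed.

Lemma bounded_cont_local f C : bounded_cont f -> compact C ->
  exists2 g, Cc g & forall x, C x -> g x = f x.
Proof.
move=> [cf _] cC; have [k [ck _ k1]] := cutoff R hausK lcK cC.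
exists (fun x => k x * f x); first exact: (Cc_mulr hausK).
by move=> x /k1 ->; rewrite mul1r.
Qed.

Lemma conv_lin x y (a : R) f g : bounded_cont f -> bounded_cont g ->
  P x y (fun t => a * f t + g t) = a * P x y f + P x y g.
Proof.
move=> bf bg; rewrite RintegralD ?RintegralZl//; try exact: bounded_cont_integrable.
by apply: bounded_cont_integrable; apply: bounded_cont_mulr => //; exact: bounded_cont_cst.
Qed.

Lemma conv_scale x y (a : R) f : bounded_cont f -> P x y (fun t => a * f t) = a * P x y f.
Proof. by move=> bf; rewrite RintegralZl//; exact: bounded_cont_integrable. Qed.

Lemma conv_sub x y f g : bounded_cont f -> bounded_cont g ->
  P x y (fun t => f t - g t) = P x y f - P x y g.
Proof. by move=> bf bg; rewrite RintegralB//; exact: bounded_cont_integrable. Qed.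

(** Near (x, y) all supports lie in one compact set, on which f may be replaced by a function of
    C_c(K). *)
Lemma conv_continuous f : bounded_cont f -> continuous (fun p : K * K => P p.1 p.2 f).
Proof.
move=> bf [x y].
have [V [oV SV [C cC VC]]] := relcompact_nbhd_set lcK (@conv_supp_compact _ _ H x y).
have [g cg gf] := bounded_cont_local bf cC.
have e : \forall p \near (x, y), P p.1 p.2 g = P p.1 p.2 f.
  apply: filterS (conv_supp_nbhd oV SV) => -[x' y'] /= SV'.
  by apply: eq_conv => // t /SV' /VC /gf.
have exy : P x y g = P x y f := nbhs_singleton e.
have h := @conv_cont _ _ H g cg (x, y).
rewrite /continuous_at /= -exy; apply: cvg_trans h.
by apply: near_eq_cvg; apply: filterS e => p ->.
Qed.

Lemma conv_slice_bc x f : bounded_cont f -> bounded_cont (fun y => P x y f).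
Proof.
move=> bf; split; first exact: (@joint_contr _ _ (fun x y => P x y f) (conv_continuous bf)).
by case: (bf) => _ [M hM]; exists M => y; exact: conv_bound.
Qed.

Lemma conv_slice_bc_l y f : bounded_cont f -> bounded_cont (fun x => P x y f).
Proof.
move=> bf; split; first exact: (@joint_contl _ _ (fun x y => P x y f) (conv_continuous bf)).
by case: (bf) => _ [M hM]; exists M => x; exact: conv_bound.
Qed.

(** Both iterated integrals see f only on a compact set, where it agrees with a function of
    C_c(K). *)
Lemma conv_assoc_bc x y z f : bounded_cont f ->
  P x y (fun t => P t z f) = P y z (fun t => P x t f).
Proof.
move=> bf; have cS a b : compact (S a b) by exact: (@conv_supp_compact _ _ H a b).
have [C1 cC1 h1] := conv_supp_compact_union H (cS x y) (@compact_set1 K z).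
have [C2 cC2 h2] := conv_supp_compact_union H (@compact_set1 K x) (cS y z).
have [g cg gf] := bounded_cont_local bf (compactU cC1 cC2).
rewrite (@eq_conv _ _ H x y _ (fun t => P t z g)); last 2 first.
- exact/conv_slice_bc_l/Cc_bounded_cont.
- move=> t St; apply: eq_conv; first exact: Cc_bounded_cont.
  by move=> s Ss; rewrite gf//; left; exact: (h1 t z St erefl).
rewrite [RHS](@eq_conv _ _ H y z _ (fun t => P x t g)); last 2 first.
- exact/conv_slice_bc/Cc_bounded_cont.
- move=> t St; apply: eq_conv; first exact: Cc_bounded_cont.
  by move=> s Ss; rewrite gf//; right; exact: (h2 x t erefl St).
exact: conv_assoc.
Qed.

Lemma conv_idr_supp x t : S x (hid H) t -> t = x.
Proof.
move=> St; apply: contrapT => tx.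
have oU : open (~` [set x]).
  by apply: closed_openC; apply: compact_closed => //; exact: (@compact_set1 K x).
have /= := St _ oU tx; rewrite (conv_idr H x (borel_open oU)) diracE memNset ?ltxx//.
by move=> /(_ erefl).
Qed.

Lemma hinv_measurable : measurable_fun [set: bK] (hinv H : bK -> bK).
Proof.
apply: (@measurability _ _ bK bK setT (hinv H) (@open K)) => // _ [U oU <-].
by rewrite setTI; apply: borel_open; apply: (@open_comp _ _ (hinv H) U) => // t _; exact: hinv_cont.
Qed.

Lemma conv_inv_eval x y f : bounded_cont f -> P y~ x~ f = P x y (fun t => f t~).
Proof.
move=> bf; rewrite /Rintegral; congr fine.
pose mi := @isMeasurableFun.Build _ _ _ _ _ hinv_measurable.
pose pi : {mfun bK >-> bK} := HB.pack (hinv H : bK -> bK) mi.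
rewrite (eq_measure_integral (pushforward (conv H x y) pi)); last first.
  by move=> A mA _; exact: conv_inv.
rewrite (integral_pushforward hinv_measurable)//.
- by apply/measurable_EFinP; apply: borel_continuous; case: bf.
- exact: bounded_cont_integrable (bounded_cont_inv bf).
Qed.

Lemma conv_neq0 x y f : P x y f != 0 -> exists2 t, S x y t & f t != 0.
Proof.
move=> h; apply: contrapT => nex; move: h; rewrite (@eq_conv _ _ H x y f (fun=> 0)).
- by rewrite conv_cst eqxx.
- exact: bounded_cont_cst.
- by move=> t St; apply: contrapT => ft; apply: nex; exists t => //; exact/eqP.
Qed.

Lemma hinv_compact A : compact A -> compact [set x~ | x in A].
Proof. by move=> cA; apply: continuous_compact => //; apply: continuous_subspaceT; exact: hinv_cont. Qed.

(** If x * y meets B at t, then y lies in x~ * t by [conv_supp_swap]; so C covers the products of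
    inverses from A with B. *)
Lemma conv_slice_supp A B : compact A -> compact B -> exists2 C, compact C &
  forall x y f, A x -> (forall t, f t != 0 -> B t) -> P x y f != 0 -> C y.
Proof.
move=> cA cB; have [C cC hC] := conv_supp_compact_union H (hinv_compact cA) cB.
exists C => // x y f Ax fB /conv_neq0[t St /fB Bt].
by apply: (hC x~ t) => //; [exists x|exact: conv_supp_swap].
Qed.

Lemma conv_slice_Cc x f : Cc f -> Cc (fun y => P x y f).
Proof.
move=> cf; have [B cB fB] := Cc_supp cf.
have [C cC hC] := conv_slice_supp (@compact_set1 K x) cB.
apply: (Cc_intro hausK _ cC); first exact: conv_cont_param.
by move=> y; exact: hC.
Qed.

Lemma Cc_inv f : Cc f -> Cc (fun x => f x~).
Proof.
move=> cf; have [B cB fB] := Cc_supp cf.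
apply: (Cc_intro hausK _ (hinv_compact cB)).
  by move=> x; apply: continuous_comp; [exact: hinv_cont|exact: (Cc_continuous cf)].
by move=> x /fB; exists x~ => //; rewrite hinvK.
Qed.

Lemma conv_supp_swapr r v y : S r v y -> S y v~ r.
Proof. by move=> /conv_supp_inv /conv_supp_swap /conv_supp_inv; rewrite !hinvK. Qed.

(** If v lies in s * y, then y lies in s~ * v, and r * v shrinks to r as v tends to e, uniformly for
    r in the compact set A carrying f. *)
Lemma conv_unif_cont f (e : R) : Cc f -> 0 < e ->
  \forall v \near hid H, forall s y, S s y v -> `|f y - f s~| <= e.
Proof.
move=> cf e0; have [A cA fA] := Cc_supp cf; have e2 : 0 < e / 2 by rewrite divr_gt0.
have h : \forall v \near hid H, forall r, A r -> forall y, S r v y -> `|f y - f r| <= e.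
  have /compact_near_coveringP := cA; apply => r0 Ar0.
  have oO : open [set w | `|f w - f r0| < e / 2].
    apply: (@open_comp _ _ (fun w => `|f w - f r0|) [set t | t < e / 2]); last exact: open_lt.
    move=> w _; apply: cvg_norm; apply: cvgB; [exact: (Cc_continuous cf)|exact: cvg_cst].
  have SO : S r0 (hid H) `<=` [set w | `|f w - f r0| < e / 2].
    by move=> w /conv_idr_supp ->; rewrite /= subrr normr0.
  have [[Q W] /= [hQ hW] hQW] := conv_supp_nbhd oO SO.
  exists (Q `&` [set w | `|f w - f r0| < e / 2], W) => /=.
    split => //; apply: filterI => //; apply: open_nbhs_nbhs; split => //.
    by rewrite /= subrr normr0.
  move=> [r v] /= [[Qr rO] Wv] y Sy; have := hQW (r, v) (conj Qr Wv) y Sy; rewrite /= => yO.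
  rewrite -(subrKA (f r0)) (le_trans (ler_normD _ _))// (distrC (f r0)); lra.
(* For the case where s~ is outside A but y is inside: the roles are exchanged, since then s~ lies
   in y * v~. *)
have h' : \forall v \near hid H, forall r, A r -> forall y, S r v~ y -> `|f y - f r| <= e.
  have ce : hid H = (hid H)~.
    apply/(conv_supp_id H) => U oU Ue; rewrite (conv_idr H _ (borel_open oU)).
    by rewrite diracE mem_set.
  by have c := @hinv_cont _ _ H (hid H); rewrite /continuous_at -ce in c; exact: (c _ h).
apply: filterS2 h h' => v h1 h2 s y Sv.
have := conv_supp_swap Sv; set r := s~ => Sy.
have [Ar|nAr] := pselect (A r); first exact: h1.
have fr : f r = 0 by apply/eqP; apply: contra_notT nAr => /fA.
have [Ay|nAy] := pselect (A y); first by rewrite distrC; apply: h2 => //; exact: conv_supp_swapr.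
have fy : f y = 0 by apply/eqP; apply: contra_notT nAy => /fA.
by rewrite fr fy subrr normr0 ltW.
Qed.
End Hypergroup.

Lemma abs_factor (R : realType) (a b c k e : R) : `|b - k * c| <= e ->
  `|a * b - k * (a * c)| <= e * `|a|.
Proof.
by move=> h; rewrite mulrCA -mulrBr normrM mulrC; apply: ler_wpM2r.
Qed.

Lemma abs_tri (R : realType) (j a b p q : R) : `|j - a| <= p -> `|j - b| <= q ->
  `|a - b| <= p + q.
Proof.
move=> h1 h2; rewrite -(subrKA j) (le_trans (ler_normD _ _))// lerD//.
by rewrite distrC.
Qed.

(** * Haar measure: translation by [x~] is adjoint to translation by [x] *)

Section Haar.
Variables (R : realType) (K : ptopologicalType) (H : hypergroup R K).
Local Notation bK := (borel K).
Local Notation P x y f := (\int[conv H x y]_t f t).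
Local Notation S x y := (msupp (conv H x y)).
Local Notation "x ~" := (hinv H x) (at level 8, format "x ~").
Implicit Types (f g h : K -> R) (x y z : K).
Variable m : {measure set bK -> \bar R}.
Hypothesis hm : haar_measure H m.

Let hausK := hyper_hausdorff H.
Let lcK := hyper_locally_compact H.
Let rm : radon m. Proof. by case: hm. Qed.

Lemma haar_integrable f : Cc f -> m.-integrable setT (EFin \o f : bK -> \bar R).
Proof. exact: (Cc_integrable hausK rm). Qed.

Lemma haar_functional : Cc_functional (fun f => \int[m]_x f x).
Proof. exact: Rintegral_functional hausK _ rm. Qed.

Lemma haar_inv x f : Cc f -> \int[m]_y P x y f = \int[m]_y f y.
Proof. by move=> cf; case: hm => _ _; apply. Qed.

Lemma haar_lin (a : R) f g : Cc f -> Cc g ->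
  \int[m]_x (a * f x + g x) = a * \int[m]_x f x + \int[m]_x g x.
Proof. by move=> cf cg; exact: haar_functional.1. Qed.

Lemma haar_sub f g : Cc f -> Cc g ->
  \int[m]_x (f x - g x) = \int[m]_x f x - \int[m]_x g x.
Proof. by move=> cf cg; exact: (ccfB haar_functional). Qed.

Lemma haar_scale (a : R) f : Cc f -> \int[m]_x (a * f x) = a * \int[m]_x f x.
Proof. by move=> cf; exact: (ccfZ hausK a haar_functional). Qed.

Lemma haar_le f g : Cc f -> Cc g -> (forall x, f x <= g x) -> \int[m]_x f x <= \int[m]_x g x.
Proof. by move=> cf cg fg; apply: le_Rintegral => //; exact: haar_integrable. Qed.

Lemma haar_norm f : Cc f -> `|\int[m]_x f x| <= \int[m]_x `|f x|.
Proof. by move=> cf; apply: le_normr_Rintegral => //; exact: haar_integrable. Qed.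

(** A bump f at e on a null neighbourhood has integral 0, and so has its translate by s~. For s in
    the support of m that translate is positive at s, because e lies in s~ * s. *)
Lemma haar_id_supp : msupp m (hid H).
Proof.
have [_ m0 _] := hm.
have [s Ss] : msupp m !=set0.
  apply: contrapT => /set0P/negP; rewrite negbK => /eqP S0.
  have := msupp_null hausK rm; rewrite S0 setC0 => h.
  by move: m0; rewrite lt_neqAle => /andP[/eqP n0 _]; apply: n0; exact: esym h.
move=> U oU Ue; rewrite lt_neqAle measure_ge0 andbT eq_sym; apply/negP => /eqP mU.
have [f [cf f01 fe fU]] := bump_pt R hausK lcK oU Ue.
have f0 t : 0 <= f t by case/andP: (f01 t).
have : 0 < \int[m]_y P s~ y f.
  apply: (Rintegral_msupp_gt0 hausK rm (z := s)) => //.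
  - exact: conv_slice_Cc.
  - by move=> y; exact: conv_ge0.
  - apply: (Rintegral_msupp_gt0 hausK (conv_radon H s~ s) (z := hid H)) => //.
      exact: conv_supp_id_inv.
    by rewrite fe.
rewrite haar_inv// ltNge => /negP; apply.
rewrite -lee_fin /Rintegral fineK; last by apply: integrable_fin_num => //; exact: haar_integrable.
have mUm : measurable (U : set bK) by exact: borel_open.
apply: (@le_trans _ _ (\int[m]_x (\1_U x)%:E)%E).
  apply: le_lower_integral => x; first by rewrite lee_fin.
  rewrite lee_fin indicE; have [->|/fU Ux] := eqVneq (f x) 0; first by [].
  by rewrite mem_set//; case/andP: (f01 x).
by rewrite integral_indic// setIT -[leRHS]mU.
Qed.

Section ApproxUnit.
Variable k : K -> R.
Hypotheses (ck : Cc k) (k0 : forall t, 0 <= k t) (ksym : forall t, k t~ = k t).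

(** For k concentrated near e, the weight [P s y k] concentrates where y is near s~, so [Q w s] is
    nearly [kappa * w s~]; k is left unnormalised. *)
Let Q w s := \int[m]_y (w y * P s y k).

Let kappa := \int[m]_y k y.

(** By invariance the weight has total mass [kappa], and w varies by at most e where it is
    nonzero. *)
Let Q_near w (e : R) s : Cc w -> 0 <= e ->
  (forall s y v, S s y v -> k v != 0 -> `|w y - w s~| <= e) ->
  `|Q w s - kappa * w s~| <= e * kappa.
Proof.
move=> cw e0 hw; have cs := conv_slice_Cc H s ck.
have k0' y : 0 <= P s y k by exact: conv_ge0.
have c1 : Cc (fun y => w y * P s y k) by apply: (Cc_mulr hausK) => //; exact: Cc_continuous.
rewrite /kappa -(haar_inv s ck) mulrC -!haar_scale// -haar_sub//; last exact: (Cc_scale hausK).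
have c2 : Cc (fun y => w y * P s y k - w s~ * P s y k).
  by apply: (Cc_sub hausK) => //; exact: (Cc_scale hausK).
apply: (le_trans (haar_norm c2)); apply: haar_le; [exact: (Cc_norm hausK)|exact: (Cc_scale hausK)|].
move=> y; rewrite -mulrBl normrM (ger0_norm (k0' y)).
have [->|/conv_neq0[v Sv kv]] := eqVneq (P s y k) 0; first by rewrite !mulr0.
by rewrite ler_wpM2r//; exact: hw Sv kv.
Qed.

Let Q_continuous w : Cc w -> continuous (Q w).
Proof.
move=> cw; have [A cA wA] := Cc_supp cw.
apply: (@ccf_param R K hausK K (fun f => \int[m]_x f x) (fun s y => w y * P s y k) A) => //.
- exact: haar_functional.
- move=> p; apply: cvgM; last exact: conv_cont.
  by apply: (@cvg_comp _ _ _ snd w _ (nbhs p.2)); [exact: cvg_snd|exact: Cc_continuous].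
- by move=> s y; rewrite mulf_eq0 negb_or => /andP[/wA].
Qed.

(** [J] gives two expressions for one double integral; replacing [Q f] or [Q g] by its approximate
    value turns it into either side, at a cost proportional to \int |g| or \int |f|. *)
Lemma adjoint_near f g x (e : R) : Cc f -> Cc g -> 0 <= e ->
  (forall s y v, S s y v -> k v != 0 -> `|f y - f s~| <= e) ->
  (forall s y v, S s y v -> k v != 0 -> `|g y - g s~| <= e) ->
  `|kappa * \int[m]_y (g y * P x y f) - kappa * \int[m]_z (f z * P x~ z g)| <=
    e * kappa * (\int[m]_y `|g y| + \int[m]_y `|f y|).
Proof.
move=> cf cg e0 hf hg.
have kap0 : 0 <= kappa by apply: Rintegral_ge0.
have [A cA fA] := Cc_supp cf; have [B cB gB] := Cc_supp cg; have [C cC kC] := Cc_supp ck.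
pose L v := \int[m]_y (g y * P x y v).
have cL v : bounded_cont v -> Cc (fun y => g y * P x y v).
  by move=> bv; apply: (Cc_mulr hausK) => //; exact: (conv_slice_bc H x bv).1.
have hL : Cc_functional L.
  split=> [a v w /Cc_bounded_cont bv /Cc_bounded_cont bw|D cD].
    rewrite /L -haar_lin; [|exact: cL|exact: cL]; congr (Rintegral _ _ _); apply/funext => y.
    by rewrite conv_lin//; ring.
  have [M M0 hM] := Cc_bounded cg.
  have [c c0 hc] := haar_functional.2 B cB.
  exists (c * M) => [|v N cv vD vN]; first exact: mulr_ge0.
  rewrite -mulrA; apply: hc.
  - by apply: cL; exact: Cc_bounded_cont.
  - by move=> y; rewrite mulf_eq0 negb_or => /andP[/gB].
  - by move=> y; rewrite normrM ler_pM//; apply: conv_bound => //; exact: Cc_bounded_cont.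
have cQ : continuous (fun t => Q f t~).
  by move=> t; apply: continuous_comp; [exact: hinv_cont|exact: Q_continuous].
have Qb w s : Cc w -> (forall s y v, S s y v -> k v != 0 -> `|w y - w s~| <= e) ->
   forall M, (forall t, `|w t| <= M) -> `|Q w s| <= e * kappa + kappa * M.
  move=> cw hw M wM; have := Q_near s cw e0 hw.
  move=> h; rewrite -(subrK (kappa * w s~) (Q w s)) (le_trans (ler_normD _ _))// lerD//.
  by rewrite normrM (ger0_norm kap0) ler_wpM2l.
have bQf : bounded_cont (fun t => Q f t~).
  split => //; have [M _ hM] := Cc_bounded cf.
  by exists (e * kappa + kappa * M) => t; exact: Qb.
have bQg : bounded_cont (Q g).
  split; first exact: Q_continuous.
  by have [M _ hM] := Cc_bounded cg; exists (e * kappa + kappa * M) => t; exact: Qb.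
have Psym z t : P z~ t k = P t~ z k.
  rewrite -{1}[t](hinvK H) conv_inv_eval; last exact: Cc_bounded_cont.
  by congr (Rintegral _ _ _); apply/funext => v; rewrite ksym.
(* Associativity evaluates the double integral of f(z) k(z~ * x * y) g(y) in two ways. *)
have J : L (fun t => Q f t~) = \int[m]_z (f z * P z~ x (Q g)).
  have [D cD hD] := @conv_slice_supp _ _ H _ _ (@hinv_compact _ _ H _ cA) cC.
  have [||_ _ e1] := @ccf_swap R K hausK lcK L (fun f => \int[m]_x f x) (fun t z => f z * P t~ z k) D A hL haar_functional _ cD cA.
  - move=> p; apply: cvgM.
      by apply: (@cvg_comp _ _ _ snd f _ (nbhs p.2)); [exact: cvg_snd|exact: Cc_continuous].
    apply: (@cvg_comp _ _ _ (fun p : K * K => (p.1~, p.2)) (fun p => P p.1 p.2 k) _ (nbhs (p.1~, p.2))).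
      apply: cvg_pair; last exact: cvg_snd.
      by apply: (@cvg_comp _ _ _ fst (hinv H) _ (nbhs p.1)); [exact: cvg_fst|exact: hinv_cont].
    exact: (@conv_cont _ _ H k ck (p.1~, p.2)).
  - move=> t z; rewrite mulf_eq0 negb_or -Psym => /andP[/fA Az pk]; split => //.
    by apply: hD pk => //; exists z.
  rewrite [LHS]e1; congr (Rintegral _ _ _); apply/funext => z.
  have -> : (fun t => f z * P t~ z k) = (fun t => f z * P z~ t k).
    by apply/funext => t; rewrite Psym.
  have cz := conv_slice_Cc H z~ ck.
  rewrite (ccfZ hausK _ hL cz); congr (_ * _); rewrite /L.
  (* The cutoff b is 1 on the support of z~ * x; it makes the kernel compactly supported in s
     without changing the integral. *)
  have [b [cb b01 b1]] := cutoff R hausK lcK (@conv_supp_compact _ _ H z~ x).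
  have [E cE bE] := Cc_supp cb.
  have [||cF _ e2] := @ccf_swap R K hausK lcK (fun f => P z~ x f) (fun f => \int[m]_x f x) (fun s y => b s * (g y * P s y k)) E B (conv_functional H z~ x) haar_functional _ cE cB.
  - move=> p; apply: cvgM.
      by apply: (@cvg_comp _ _ _ fst b _ (nbhs p.1)); [exact: cvg_fst|exact: Cc_continuous].
    apply: cvgM; last exact: conv_cont.
    by apply: (@cvg_comp _ _ _ snd g _ (nbhs p.2)); [exact: cvg_snd|exact: Cc_continuous].
  - by move=> s y; rewrite !mulf_eq0 !negb_or => /and3P[/bE ? /gB ? _].
  rewrite (@eq_conv _ _ H z~ x (Q g) (fun s => \int[m]_y (b s * (g y * P s y k)))); last 2 first.
  - exact: Cc_bounded_cont.
  - by move=> s Ss; rewrite haar_scale ?b1 ?mul1r//; apply: (Cc_mulr hausK) => //; exact: conv_cont_param.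
  rewrite e2; congr (Rintegral _ _ _); apply/funext => y.
  rewrite -(conv_assoc H z~ x y ck).
  have bs := conv_slice_bounded_cont_l H y ck.
  rewrite -conv_scale//; apply/esym/eq_conv.
    by apply: bounded_cont_mulr => //; exact: bounded_cont_cst.
  by move=> s /b1 ->; rewrite mul1r.
have e1 : `|L (fun t => Q f t~) - kappa * \int[m]_y (g y * P x y f)| <= e * kappa * \int[m]_y `|g y|.
  have bf := Cc_bounded_cont cf.
  rewrite /L -(haar_scale kappa (cL _ bf)).
  rewrite -haar_sub; [|exact: (cL _ bQf)|by apply: (Cc_scale hausK); exact: (cL _ bf)].
  have cc := Cc_sub hausK (cL _ bQf) (Cc_scale hausK kappa (cL _ bf)).
  apply: (le_trans (haar_norm cc)); rewrite -haar_scale; last exact: (Cc_norm hausK).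
  apply: haar_le; [exact: (Cc_norm hausK)|by apply: (Cc_scale hausK); exact: (Cc_norm hausK)|].
  move=> y; apply: abs_factor.
  have bkf := bounded_cont_mulr (bounded_cont_cst K kappa) bf.
  rewrite -(@conv_scale _ _ H x y kappa f bf) -(@conv_sub _ _ H x y _ _ bQf bkf).
  apply: (@conv_bound _ _ H x y _ (e * kappa) (bounded_cont_sub bQf bkf)).
  by move=> t; have := Q_near t~ cf e0 hf; rewrite hinvK.
have e2 : `|\int[m]_z (f z * P z~ x (Q g)) - kappa * \int[m]_z (f z * P x~ z g)| <= e * kappa * \int[m]_y `|f y|.
  have bg := Cc_bounded_cont cg; have bgi := bounded_cont_inv H bg.
  have c1 : Cc (fun z => f z * P z~ x (Q g)).
    apply: (Cc_mulr hausK cf) => z.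
    exact: (@continuous_comp _ _ _ (hinv H) (fun y => P y x (Q g)) z (@hinv_cont _ _ H z)
      ((conv_slice_bc_l H x bQg).1 _)).
  have c2 : Cc (fun z => f z * P x~ z g).
    exact: (Cc_mulr hausK cf (conv_slice_bc H x~ bg).1).
  have c3 := Cc_scale hausK kappa c2; have cc := Cc_sub hausK c1 c3.
  rewrite -(haar_scale kappa c2) -(haar_sub c1 c3).
  apply: (le_trans (haar_norm cc)); rewrite -haar_scale; last exact: (Cc_norm hausK).
  apply: haar_le; [exact: (Cc_norm hausK)|by apply: (Cc_scale hausK); exact: (Cc_norm hausK)|].
  move=> z; apply: abs_factor.
  (* The involution reverses convolution, and [Q g s] approximates [kappa * g s~]. *)
  have -> : P x~ z g = P z~ x (fun s => g s~).
    have := @conv_inv_eval _ _ H x~ z _ bgi; rewrite hinvK => ->.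
    by congr (Rintegral _ _ _); apply/funext => s; rewrite hinvK.
  have bkg := bounded_cont_mulr (bounded_cont_cst K kappa) bgi.
  rewrite -(@conv_scale _ _ H z~ x kappa _ bgi) -(@conv_sub _ _ H z~ x _ _ bQg bkg).
  apply: (@conv_bound _ _ H z~ x _ (e * kappa) (bounded_cont_sub bQg bkg)).
  by move=> s; exact: Q_near.
rewrite J in e1; rewrite mulrDr; exact: abs_tri e1 e2.
Qed.
End ApproxUnit.

(** [adjoint_near] with a kernel so concentrated that f and g vary by at most e; its mass is
    positive since e lies in the support of m, and cancels. *)
Lemma haar_adjoint f g x : Cc f -> Cc g ->
  \int[m]_y (g y * P x y f) = \int[m]_z (f z * P x~ z g).
Proof.
move=> cf cg; apply: (@eq_of_small _ _ _ (\int[m]_y `|g y| + \int[m]_y `|f y|)) => e e0.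
have h := @filterI _ (nbhs (hid H)) _ _ _ (conv_unif_cont H cf e0) (conv_unif_cont H cg e0).
have hid_inv : (hid H)~ = hid H.
  apply/esym/(conv_supp_id H) => U oU Ue; rewrite (conv_idr H _ (borel_open oU)).
  by rewrite diracE mem_set.
have {}h := h (nbhs_filter _); rewrite nbhsE in h; case: h => V [oV Ve] hV.
have [k [ck k01 ke kV]] := bump_pt R hausK lcK oV Ve.
(* Symmetrised for [adjoint_near]. Where only the second term is nonzero, the estimate is applied to
   the inverted relation: v~ lies in y~ * s~. *)
pose k' t := k t + k t~.
have ck' : Cc k' by apply: (Cc_add hausK) => //; exact: Cc_inv.
have k0 t : 0 <= k t by case/andP: (k01 t).
have k'0 t : 0 <= k' t by rewrite addr_ge0.
have k'sym t : k' t~ = k' t by rewrite /k' hinvK addrC.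
have kap : 0 < \int[m]_y k' y.
  by apply: (Rintegral_msupp_gt0 hausK rm ck' k'0 haar_id_supp); rewrite /k' hid_inv ke; lra.
have key f' : (forall v, V v -> forall s y, S s y v -> `|f' y - f' s~| <= e) ->
    forall s y v, S s y v -> k' v != 0 -> `|f' y - f' s~| <= e.
  move=> h s y v Sv kv.
  have [kv0|/kV Vv] := eqVneq (k v) 0; last exact: (h v Vv).
  have /kV Vv : k v~ != 0 by move: kv; rewrite /k' kv0 add0r.
  have h1 := conv_supp_inv Sv.
  by have := h _ Vv _ _ h1; rewrite hinvK distrC.
have := @adjoint_near k' ck' k'0 k'sym f g x e cf cg (ltW e0)
  (key f (fun v Vv => (hV v Vv).1)) (key g (fun v Vv => (hV v Vv).2)).
rewrite -mulrBr normrM (gtr0_norm kap) [leRHS]mulrAC [leRHS]mulrC ler_pM2l//.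
by rewrite [leRHS]mulrC.
Qed.
End Haar.

(** * Complex-valued integrals and L^1 *)

Notation cabs z := (complex.Re `|z|).
Notation "f ^R" := (fun x => real_complex _ (f x)) (at level 8, format "f ^R").

Section Modulus.
Variable R : realType.
Implicit Types (z w : R[i]).

Lemma normReK (V : normedZmodType R[i]) (u : V) : (cabs u)%:C%C = `|u|.
Proof. by have := normr_ge0 u; rewrite lecE; case: `|u| => a b /= /andP[/eqP -> _]. Qed.

Lemma cabs_ge0 (V : normedZmodType R[i]) (u : V) : 0 <= cabs u.
Proof. by rewrite -ler0c normReK. Qed.

Lemma cabsD (V : normedZmodType R[i]) (u v : V) : cabs (u + v) <= cabs u + cabs v.
Proof. by rewrite -lecR rmorphD /= !normReK ler_normD. Qed.

Lemma cabsZ (V : normedModType R[i]) z (u : V) : cabs (z *: u) = cabs z * cabs u.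
Proof.
have h := normrZ z u; apply: (@complexI R).
rewrite [LHS]normReK h [RHS]rmorphM; congr (_ * _); exact/esym/normReK.
Qed.

Lemma cabsM z w : cabs (z * w) = cabs z * cabs w.
Proof.
have h := normrM z w; apply: (@complexI R).
rewrite [LHS]normReK h [RHS]rmorphM; congr (_ * _); exact/esym/normReK.
Qed.

Lemma cabsN (V : normedZmodType R[i]) (u : V) : cabs (- u) = cabs u.
Proof. by rewrite normrN. Qed.

Lemma cabs0_eq0 (V : normedZmodType R[i]) (u : V) : cabs u = 0 -> u = 0.
Proof. by move=> h; apply/eqP; rewrite -normr_eq0 -normReK h. Qed.

Lemma cabs_real (a : R) : cabs (a%:C)%C = `|a|.
Proof. by rewrite normc_def/= expr0n addr0 sqrtr_sqr. Qed.

Lemma Re_le_cabs z : `|complex.Re z| <= cabs z.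
Proof. by rewrite -lecR normReK normc_ge_Re. Qed.

Lemma Im_le_cabs z : `|complex.Im z| <= cabs z.
Proof.
rewrite normc_def/= -sqrtr_sqr; apply: ler_wsqrtr.
by rewrite lerDr sqr_ge0.
Qed.

Lemma complex_split z : z = (complex.Re z)%:C%C + 'i%C * (complex.Im z)%:C%C.
Proof. exact: complexE. Qed.

Lemma cabs_i : cabs ('i%C : R[i]) = 1.
Proof. by rewrite normc_def/= expr0n/= add0r expr1n sqrtr1. Qed.

Lemma cabs_le_sum z : cabs z <= `|complex.Re z| + `|complex.Im z|.
Proof.
rewrite {1}(complex_split z) (le_trans (cabsD _ _))// cabsM cabs_i mul1r.
by rewrite !cabs_real.
Qed.

Lemma cReD z w : complex.Re (z + w) = complex.Re z + complex.Re w.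
Proof. by case: z w => [a b] [c d]. Qed.
Lemma cImD z w : complex.Im (z + w) = complex.Im z + complex.Im w.
Proof. by case: z w => [a b] [c d]. Qed.
Lemma cReM z w : complex.Re (z * w) = complex.Re z * complex.Re w - complex.Im z * complex.Im w.
Proof. by case: z w => [a b] [c d]. Qed.
Lemma cImM z w : complex.Im (z * w) = complex.Re z * complex.Im w + complex.Im z * complex.Re w.
Proof. by case: z w => [a b] [c d]. Qed.

Lemma cReN z : complex.Re (- z) = - complex.Re z.
Proof. by case: z. Qed.
Lemma cImN z : complex.Im (- z) = - complex.Im z.
Proof. by case: z. Qed.

Lemma eq_complexP z w : complex.Re z = complex.Re w -> complex.Im z = complex.Im w -> z = w.
Proof. by case: z w => [a b] [c d] /= -> ->. Qed.

Lemma cabs_small_eq z w C : (forall e, 0 < e -> cabs (z - w) <= C * e) -> z = w.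
Proof.
move=> h; apply/eqP; rewrite -subr_eq0; apply/eqP/cabs0_eq0.
by apply: (@eq_of_small _ _ _ C) => e /h he; rewrite subr0 ger0_norm ?cabs_ge0.
Qed.
End Modulus.

Section ComplexIntegral.
Variables (R : realType) (K : ptopologicalType).
Local Notation bK := (borel K).
Variable mu : {measure set bK -> \bar R}.
Implicit Types (f g : K -> R[i]).

Lemma integrable_lin (a b : R) (u v : bK -> R) : mu.-integrable setT (EFin \o u) ->
  mu.-integrable setT (EFin \o v) -> mu.-integrable setT (EFin \o (fun x => a * u x + b * v x)).
Proof.
move=> iu iv; rewrite (_ : _ \o _ = (fun x => (a%:E * (u x)%:E + b%:E * (v x)%:E)%E)).
  by apply: integrableD => //; apply: integrableZl.
by apply/funext => x.
Qed.

Lemma Rintegral_lin (a b : R) (u v : bK -> R) : mu.-integrable setT (EFin \o u) ->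
  mu.-integrable setT (EFin \o v) ->
  \int[mu]_x (a * u x + b * v x) = a * \int[mu]_x u x + b * \int[mu]_x v x.
Proof.
move=> iu iv; rewrite RintegralD//; last 2 first.
- by have := integrable_lin a 0 iu iv; under eq_fun do rewrite mul0r addr0.
- by have := integrable_lin 0 b iu iv; under eq_fun do rewrite mul0r add0r.
by rewrite !RintegralZl.
Qed.

Lemma L1_lin (a : R[i]) f g : L1 mu f -> L1 mu g -> L1 mu (fun x => a * f x + g x).
Proof.
move=> [f1 f2] [g1 g2]; split.
  have := integrable_lin 1 1 (integrable_lin (complex.Re a) (- complex.Im a) f1 f2) g1.
  congr (integrable _ _ _); apply/funext => x; rewrite /= cReD cReM; congr (_%:E); ring.
have := integrable_lin 1 1 (integrable_lin (complex.Re a) (complex.Im a) f2 f1) g2.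
congr (integrable _ _ _); apply/funext => x; rewrite /= cImD cImM; congr (_%:E); ring.
Qed.

Lemma cintegral_lin (a : R[i]) f g : L1 mu f -> L1 mu g ->
  cintegral mu (fun x => a * f x + g x) = a * cintegral mu f + cintegral mu g.
Proof.
move=> [f1 f2] [g1 g2]; rewrite /cintegral; apply: eq_complexP => /=.
  have := Rintegral_lin 1 1 (integrable_lin (complex.Re a) (- complex.Im a) f1 f2) g1.
  rewrite (Rintegral_lin _ _ f1 f2) cReD cReM /= !mul1r mulNr => <-.
  by congr (Rintegral _ _ _); apply/funext => x; rewrite cReD cReM; ring.
have := Rintegral_lin 1 1 (integrable_lin (complex.Re a) (complex.Im a) f2 f1) g2.
rewrite (Rintegral_lin _ _ f2 f1) cImD cImM /= !mul1r => <-.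
by congr (Rintegral _ _ _); apply/funext => x; rewrite cImD cImM; ring.
Qed.

Lemma L1_real (u : K -> R) : mu.-integrable setT (EFin \o u : bK -> \bar R) -> L1 mu u^R.
Proof. by move=> iu; split => //=; exact: integrable0. Qed.

Lemma L1_0 : L1 mu (fun=> 0).
Proof. by split; exact: integrable0. Qed.

Lemma cintegral0 : cintegral mu (fun=> 0) = 0.
Proof. by rewrite /cintegral /= /Rintegral integral0. Qed.

Lemma cintegral_scale (a : R[i]) f : L1 mu f -> cintegral mu (fun x => a * f x) = a * cintegral mu f.
Proof.
move=> hf; have := cintegral_lin a hf L1_0; rewrite cintegral0 addr0 => <-.
by congr cintegral; apply/funext => x; rewrite addr0.
Qed.

Lemma cintegral_real (u : K -> R) : cintegral mu u^R = (\int[mu]_x u x)%:C%C.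
Proof. by apply: eq_complexP => //=; rewrite /Rintegral integral0. Qed.

Lemma norm1_fin f : L1 mu f -> (\int[mu]_x (cabs (f x))%:E < +oo)%E.
Proof.
move=> [f1 f2]; have i1 := integrable_norm f1; have i2 := integrable_norm f2.
have [_ h] := integrableP _ _ _ (integrableD measurableT i1 i2).
apply: le_lt_trans h; apply: le_lower_integral => x; first by rewrite lee_fin cabs_ge0.
apply: (@le_trans _ _ (`|complex.Re (f x)| + `|complex.Im (f x)|)%:E); first by rewrite lee_fin cabs_le_sum.
by rewrite /= lee_fin ler_norm.
Qed.

Lemma norm1_ge0 f : 0 <= norm1 mu f.
Proof. by apply: Rintegral_ge0 => x _; exact: cabs_ge0. Qed.

Lemma norm1E f : L1 mu f -> (norm1 mu f)%:E = (\int[mu]_x (cabs (f x))%:E)%E.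
Proof.
move=> hf; rewrite /norm1 /Rintegral fineK// ge0_fin_numE ?norm1_fin//.
by apply: integral_ge0 => x _; rewrite lee_fin cabs_ge0.
Qed.

Lemma norm1_ge (u : K -> R) f : L1 mu f -> mu.-integrable setT (EFin \o u : bK -> \bar R) ->
  (forall x, 0 <= u x <= cabs (f x)) -> \int[mu]_x u x <= norm1 mu f.
Proof.
move=> hf iu uf; rewrite -lee_fin norm1E// /Rintegral fineK; last exact: integrable_fin_num.
by apply: le_lower_integral => x; rewrite lee_fin; case/andP: (uf x).
Qed.

Lemma norm1_le (phi : K -> \bar R) f (e : R) : L1 mu f -> (forall x, (cabs (f x))%:E <= phi x)%E ->
  (\int[mu]_x phi x <= e%:E)%E -> norm1 mu f <= e.
Proof.
move=> hf fphi h; rewrite -lee_fin norm1E//; apply: le_trans h.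
by apply: le_lower_integral => // x; rewrite lee_fin cabs_ge0.
Qed.

(** The factor 2 comes from estimating the real and imaginary parts separately; the same splitting
    enters the later constants 4, 16 and 64. *)
Lemma cintegral_le f : L1 mu f -> cabs (cintegral mu f) <= 2 * norm1 mu f.
Proof.
move=> hf; have [f1 f2] := hf.
rewrite (le_trans (cabs_le_sum _))//= mulr_natl mulr2n; apply: lerD.
  apply: (le_trans (le_normr_Rintegral _ f1)) => //.
  apply: norm1_ge => //; first exact: integrable_norm f1.
  by move=> x; rewrite normr_ge0 Re_le_cabs.
apply: (le_trans (le_normr_Rintegral _ f2)) => //.
apply: norm1_ge => //; first exact: integrable_norm f2.
by move=> x; rewrite normr_ge0 Im_le_cabs.
Qed.
End ComplexIntegral.

Section Density.
Variables (R : realType) (K : ptopologicalType).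
Hypothesis hausK : hausdorff_space K.
Hypothesis lcK : locally_compact [set: K].
Local Notation bK := (borel K).
Variable m : {measure set bK -> \bar R}.
Hypothesis rm : radon m.
Implicit Types (f g : K -> R[i]) (v : K -> R).

Lemma L1_Cc v : Cc v -> L1 m v^R.
Proof. move=> cv; exact: (L1_real (Cc_integrable hausK rm cv)). Qed.

Lemma L1_dense f (e : R) : L1 m f -> 0 < e -> exists v w phi, [/\ Cc v, Cc w, lsc_ge0 phi,
  (forall x, (cabs (f x - ('i%C * (w x)%:C%C + (v x)%:C%C)))%:E <= phi x)%E & (\int[m]_x phi x <= e%:E)%E].
Proof.
move=> [f1 f2] e0; have e2 : 0 < e / 2 by rewrite divr_gt0.
have [v [phi [cv lphi hv Iphi]]] := approx_integrable hausK lcK rm f1 e2.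
have [w [psi [cw lpsi hw Ipsi]]] := approx_integrable hausK lcK rm f2 e2.
exists v, w, (fun x => phi x + psi x)%E; split => //.
- exact: lsc_add.
- move=> x; apply: (@le_trans _ _ ((`|complex.Re (f x) - v x|)%:E + (`|complex.Im (f x) - w x|)%:E)%E); last exact: leeD.
  rewrite -EFinD lee_fin; apply: le_trans (cabs_le_sum _) _.
  have -> : complex.Re (f x - ('i%C * (w x)%:C%C + (v x)%:C%C)) = complex.Re (f x) - v x.
    by rewrite cReD cReN cReD cReM /=; ring.
  have -> // : complex.Im (f x - ('i%C * (w x)%:C%C + (v x)%:C%C)) = complex.Im (f x) - w x.
  by rewrite cImD cImN cImD cImM /=; ring.
- rewrite integral_lscD//; apply: (le_trans (leeD Iphi Ipsi)); rewrite -EFinD lee_fin; lra.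
Qed.

(** A bounded linear functional is determined by its values on real functions of C_c(K): linearity
    reaches complex combinations, and density does the rest. *)
Lemma L1_ext (E : (K -> R[i]) -> R[i]) : linear_on (L1 m) (E : (K -> R[i]) -> R[i]^o) ->
  (exists c : R, forall f, L1 m f -> cabs (E f) <= c * norm1 m f) ->
  (forall v, Cc v -> E v^R = 0) -> forall f, L1 m f -> E f = 0.
Proof.
move=> lE [c hc] E0 f hf; apply: (@cabs_small_eq _ _ _ `|c|) => e e0; rewrite subr0.
have [v [w [phi [cv cw lphi hphi Iphi]]]] := L1_dense hf e0.
have hg := L1_lin 'i%C (L1_Cc cw) (L1_Cc cv).
pose g x := 'i%C * (w x)%:C%C + (v x)%:C%C.
have Eg : E g = 0.
  by rewrite /g (lE _ _ _ (L1_Cc cw) (L1_Cc cv)) !E0// scaler0 addr0.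
have -> : E f = E (fun x => -1 * g x + f x) by rewrite (lE _ _ _ hg hf) Eg scaler0 add0r.
have hd := L1_lin (-1) hg hf.
apply: (le_trans (hc _ hd)); apply: (@le_trans _ _ (`|c| * norm1 m (fun x => -1 * g x + f x))).
  by rewrite ler_wpM2r ?norm1_ge0// ler_norm.
by rewrite ler_wpM2l//; apply: (norm1_le hd _ Iphi) => x; rewrite mulN1r addrC.
Qed.
End Density.

(** * From amenability to left amenability *)

Section Translations.
Variables (R : realType) (K : ptopologicalType) (H : hypergroup R K).
Hypothesis hcomm : commutative_hypergroup H.
Local Notation bK := (borel K).
Local Notation P x y f := (\int[conv H x y]_t f t).
Local Notation "x ~" := (hinv H x) (at level 8, format "x ~").
Implicit Types (f g h v : K -> R) (x y z : K).
Variable m : {measure set bK -> \bar R}.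
Hypothesis hm : haar_measure H m.

Let hausK := hyper_hausdorff H.
Let lcK := hyper_locally_compact H.
Let rm : radon m. Proof. by case: hm. Qed.

Lemma conv_comm x y f : P x y f = P y x f.
Proof.
rewrite /Rintegral; congr fine; apply: eq_measure_integral => A mA _; exact: hcomm.
Qed.

(** Both integrals involve h only on a compact set, because f and its translate are compactly
    supported. *)
Lemma haar_adjoint_bc f h x : Cc f -> bounded_cont h ->
  \int[m]_y (h y * P x y f) = \int[m]_z (f z * P x~ z h).
Proof.
move=> cf bh; have cx := conv_slice_Cc H x cf.
have [A cA fA] := Cc_supp cf; have [B cB xB] := Cc_supp cx.
have [C cC hC] := conv_supp_compact_union H (@compact_set1 K x~) cA.
have [g cg gh] := bounded_cont_local H bh (compactU cB cC).
transitivity (\int[m]_y (g y * P x y f)).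
  congr (Rintegral _ _ _); apply/funext => y.
  have [->|/xB By] := eqVneq (P x y f) 0; first by rewrite !mulr0.
  by rewrite gh//; left.
rewrite (haar_adjoint hm x cf cg); congr (Rintegral _ _ _); apply/funext => z.
have [->|/fA Az] := eqVneq (f z) 0; first by rewrite !mul0r.
congr (_ * _); apply: eq_conv => // t St; rewrite gh//; right.
exact: (hC x~ z erefl Az).
Qed.

Lemma conv_jointR f : bounded_cont f -> continuous (fun p : K * K => P p.1~ p.2 f).
Proof.
move=> bf p; apply: (@cvg_comp _ _ _ (fun p : K * K => (p.1~, p.2)) (fun p => P p.1 p.2 f) _ (nbhs (p.1~, p.2))).
  apply: cvg_pair; last exact: cvg_snd.
  by apply: (@cvg_comp _ _ _ fst (hinv H) _ (nbhs p.1)); [exact: cvg_fst|exact: hinv_cont].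
exact: (@conv_continuous _ _ H _ bf (p.1~, p.2)).
Qed.

Lemma joint_mull f (u : K -> K -> R) : continuous f ->
  continuous (fun p : K * K => u p.1 p.2) -> continuous (fun p : K * K => f p.1 * u p.1 p.2).
Proof.
move=> cf cu p; apply: cvgM; last exact: cu.
by apply: (@cvg_comp _ _ _ fst f _ (nbhs p.1)); [exact: cvg_fst|exact: cf].
Qed.

Lemma joint_mulr f (u : K -> K -> R) : continuous f ->
  continuous (fun p : K * K => u p.1 p.2) -> continuous (fun p : K * K => f p.2 * u p.1 p.2).
Proof.
move=> cf cu p; apply: cvgM; last exact: cu.
by apply: (@cvg_comp _ _ _ snd f _ (nbhs p.2)); [exact: cvg_snd|exact: cf].
Qed.

Section Functional.
Variable L : (K -> R) -> R.
Hypothesis hL : Cc_functional L.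

(** [ccf_swap] asks for compact support in both variables; b supplies it in t, and [conv_slice_supp]
    then supplies it in z. *)
Lemma ccf_conv_swap v x b : Cc v -> Cc b ->
  forall y, [/\ Cc (fun t => b t * L (fun z => P t z v)) &
     P y x (fun t => b t * L (fun z => P t z v)) = L (fun z => P y x (fun t => b t * P t z v))].
Proof.
move=> cv cb y; have [A cA bA] := Cc_supp cb; have [B cB vB] := Cc_supp cv.
have [C cC hC] := @conv_slice_supp _ _ H _ _ cA cB.
have [||cF _ e] := @ccf_swap R K hausK lcK (fun f => P y x f) L (fun t z => b t * P t z v) A C
  (conv_functional H y x) hL _ cA cC.
- exact: (@joint_mull b (fun t z => P t z v) (Cc_continuous cb) (@conv_continuous _ _ H _ (Cc_bounded_cont cv))).
- move=> t z; rewrite mulf_eq0 negb_or => /andP[bt pv]; split; first exact: bA.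
  by apply: hC pv => //; exact: bA.
have e' : (fun t => b t * L (fun z => P t z v)) = (fun t => L (fun z => b t * P t z v)).
  by apply/funext => t; rewrite (ccfZ hausK _ hL)//; exact: conv_slice_Cc.
by split; rewrite e'.
Qed.

Lemma ccf_translate_continuous v : Cc v -> continuous (fun x => L (fun z => P x z v)).
Proof.
move=> cv x0; have [V [oV Vx [C cC VC]]] := relcompact_nbhd lcK x0.
have [b [cb _ b1]] := cutoff R hausK lcK cC.
have [cF _] := ccf_conv_swap x0 cv cb x0.
have e : \forall x \near x0, b x * L (fun z => P x z v) = L (fun z => P x z v).
  have : nbhs x0 V by apply: open_nbhs_nbhs.
  by apply: filterS => x /VC /b1 ->; rewrite mul1r.
have h := Cc_continuous cF (x := x0); rewrite /continuous_at (nbhs_singleton e) in h.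
by apply: cvg_trans h; apply: near_eq_cvg; apply: filterS e => x ->.
Qed.

(** Translating x |-> L(T_x v) amounts to translating v, by associativity under L. It is applied
    both to x |-> D(T_x v)(u) and to the averages of essentially bounded functions. *)
Lemma ccf_translate v x y : Cc v ->
  P y x (fun t => L (fun z => P t z v)) = L (fun z => P x z (fun t => P y t v)).
Proof.
move=> cv; have [b [cb _ b1]] := cutoff R hausK lcK (@conv_supp_compact _ _ H y x).
have [cF e] := ccf_conv_swap x cv cb y.
rewrite (@eq_conv _ _ H y x _ _ (Cc_bounded_cont cF)); last by move=> t /b1 ->; rewrite mul1r.
rewrite e; congr L; apply/funext => z.
rewrite -(conv_assoc H y x z cv); apply: eq_conv; first exact: conv_slice_bounded_cont_l.
by move=> t /b1 ->; rewrite mul1r.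
Qed.

(** f * k is an integral of the translates T_{y~} k weighted by f, and [ccf_swap] moves L inside. *)
Lemma ccf_convolution f k : Cc f -> Cc k ->
  [/\ Cc (fun x => \int[m]_y (f y * P y~ x k)) &
   L (fun x => \int[m]_y (f y * P y~ x k)) = \int[m]_y (f y * L (fun x => P y~ x k))].
Proof.
move=> cf ck; have [A cA fA] := Cc_supp cf; have [B cB kB] := Cc_supp ck.
have [C cC hC] := @conv_slice_supp _ _ H _ _ (@hinv_compact _ _ H _ cA) cB.
have [||_ cF e] := @ccf_swap R K hausK lcK (fun f => \int[m]_x f x) L (fun y x => f y * P y~ x k) A C
  (haar_functional hm) hL _ cA cC.
- exact: (@joint_mull f (fun y x => P y~ x k) (Cc_continuous cf) (conv_jointR (Cc_bounded_cont ck))).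
- move=> y x; rewrite mulf_eq0 negb_or => /andP[/fA Ay pk]; split => //.
  by apply: hC pk => //; exists y.
split; first exact: cF.
rewrite -e; congr (Rintegral _ _ _); apply/funext => y.
by rewrite (ccfZ hausK _ hL)//; exact: conv_slice_Cc.
Qed.
End Functional.

(** f * T_x k = T_x (f * k): associativity reduces this to exchanging x and y~, where commutativity
    enters. *)
Lemma convolution_translate f k x z : Cc f -> Cc k ->
  \int[m]_y (f y * P y~ z (fun t => P x t k)) = P x z (fun s => \int[m]_y (f y * P y~ s k)).
Proof.
move=> cf ck; have [_ ->] := ccf_convolution (conv_functional H x z) cf ck.
congr (Rintegral _ _ _); apply/funext => y; congr (_ * _).
rewrite -(conv_assoc H x y~ z ck) -(conv_assoc H y~ x z ck).
exact: conv_comm.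
Qed.

Lemma convolution_real f k : convolution H m f^R k^R = (fun x => \int[m]_y (f y * P y~ x k))^R.
Proof.
apply/funext => x; rewrite /convolution -cintegral_real; congr cintegral; apply/funext => y.
by rewrite /translate cintegral_real rmorphM.
Qed.

Lemma norm1_translate v x : Cc v -> norm1 m (fun z => P x z v)^R <= \int[m]_z `|v z|.
Proof.
move=> cv; rewrite -(haar_inv hm x (Cc_norm hausK cv)) /norm1.
have cx := conv_slice_Cc H x cv.
have -> : (fun z => cabs (P x z v)%:C%C) = (fun z => `|P x z v|) by apply/funext => z; rewrite cabs_real.
apply: (haar_le hm); [exact: (Cc_norm hausK)|apply: conv_slice_Cc; exact: (Cc_norm hausK)|].
move=> z; apply: le_normr_Rintegral => //; apply: bounded_cont_integrable.
exact: Cc_bounded_cont.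
Qed.

Section L1Functional.
Variable T : (K -> R[i]) -> R[i].
Hypothesis lT : linear_on (L1 m) (T : (K -> R[i]) -> R[i]^o).
Variable c : R.
Hypothesis bT : forall f : K -> R[i], L1 m f -> cabs (T f) <= c * norm1 m f.

(** The L^1-norm of a function bounded by M and supported in B is at most m(B) M, so a bounded
    functional on L^1 restricts to functionals on C_c(K). *)
Lemma L1_functional_real : Cc_functional (fun v => complex.Re (T v^R)) /\
  Cc_functional (fun v => complex.Im (T v^R)).
Proof.
have lin (a : R) f g : Cc f -> Cc g ->
    T (fun x => a * f x + g x)^R = a%:C%C * T f^R + T g^R.
  move=> cf cg; have := lT a%:C%C (L1_Cc hausK rm cf) (L1_Cc hausK rm cg).
  move=> e; rewrite -[RHS]e; congr T; apply/funext => x.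
  by rewrite rmorphD rmorphM.
have bnd B : compact B -> exists2 c' : R, 0 <= c' & forall v (M : R), Cc v ->
    (forall x, v x != 0 -> B x) -> (forall x, `|v x| <= M) -> cabs (T v^R) <= c' * M.
  move=> cB; exists (`|c| * fine (m B)); first by rewrite mulr_ge0// fine_ge0.
  move=> v M cv vB vM; apply: (le_trans (bT (L1_Cc hausK rm cv))).
  apply: (@le_trans _ _ (`|c| * norm1 m v^R)); first by rewrite ler_wpM2r ?norm1_ge0// ler_norm.
  rewrite -mulrA ler_wpM2l//; apply: le_trans (ler_norm _) _.
  have -> : norm1 m v^R = \int[m]_x `|v x|.
    by rewrite /norm1; congr (Rintegral _ _ _); apply/funext => x; rewrite cabs_real.
  apply: (Rintegral_abs_le hausK rm) => //; first exact: (Cc_norm hausK).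
    by move=> x h; apply: vB; rewrite -normr_eq0.
  by move=> x; rewrite normr_id.
split; split.
- by move=> a f g cf cg; rewrite lin// cReD cReM/= mul0r subr0.
- move=> B /bnd[c' c'0 h]; exists c' => // v M cv vB vM.
  by apply: le_trans (Re_le_cabs _) _; exact: h.
- by move=> a f g cf cg; rewrite lin// cImD cImM/= mul0r addr0.
- move=> B /bnd[c' c'0 h]; exists c' => // v M cv vB vM.
  by apply: le_trans (Im_le_cabs _) _; exact: h.
Qed.
End L1Functional.

Lemma ess_bounds_bounded (f : K -> R[i]) (M : R) : 0 <= M -> (forall x, cabs (f x) <= M) ->
  ess_bounds m f M.
Proof.
move=> M0 fM; split => // C cC; rewrite (_ : _ `&` _ = set0); first exact: negligible_set0.
by apply/seteqP; split => // x [_ /=]; rewrite ltNge fM.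
Qed.

Lemma norm_infty_le (f : K -> R[i]) (M : R) : 0 <= M -> (forall x, cabs (f x) <= M) ->
  norm_infty m f <= M.
Proof.
move=> M0 fM; apply: ge_inf; last exact: ess_bounds_bounded.
by exists 0 => N [].
Qed.

Lemma norm_infty_ge0 (f : K -> R[i]) : 0 <= norm_infty m f.
Proof.
rewrite /norm_infty; have [->|/set0P ne] := eqVneq (ess_bounds m f) set0; first by rewrite inf0.
by apply: lb_le_inf => // N [].
Qed.

Definition complex_bounded_cont (f : K -> R[i]) :=
  bounded_cont (fun x => complex.Re (f x)) /\ bounded_cont (fun x => complex.Im (f x)).

Lemma complex_bounded_contP (f : K -> R[i]) : complex_bounded_cont f ->
  exists2 M, 0 <= M & forall x, cabs (f x) <= M.
Proof.
move=> [[_ [M hM]] [_ [N hN]]]; exists (`|M| + `|N|); first by rewrite addr_ge0.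
move=> x; apply: (le_trans (cabs_le_sum _)); apply: lerD.
  exact: le_trans (hM x) (ler_norm _).
exact: le_trans (hN x) (ler_norm _).
Qed.

Lemma Linfty_bounded_cont (f : K -> R[i]) : complex_bounded_cont f -> Linfty m f.
Proof.
move=> hf; have [M M0 fM] := complex_bounded_contP hf; case: hf => [[c1 _] [c2 _]].
split; last by exists M; exact: ess_bounds_bounded.
move=> C cC; split; apply: (@measurable_funS _ _ _ _ setT) => //.
  exact: borel_continuous c1.
exact: borel_continuous c2.
Qed.

(** For a real-valued character the hermitian condition becomes invariance under the involution. *)
Definition real_character (a : K -> R) := [/\ bounded_cont a, a (hid H) = 1,
  forall x y, P x y a = a x * a y & forall x, a x~ = a x].

Lemma real_characterP (alpha : K -> R[i]) : hermitian_character H alpha ->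
  (forall x, alpha x \is Num.real) -> exists2 a, real_character a & alpha = a^R.
Proof.
move=> [calpha [M hM] aid aM ainv] areal.
have E : alpha = (fun x => complex.Re (alpha x))^R.
  by apply/funext => x; apply: eq_complexP => //=; apply: (complexI); exact: RIm_real.
exists (fun x => complex.Re (alpha x)) => //; split.
- split.
    move=> x; apply/cvgrPdist_le => e e0.
    have e0' : 0 < (e%:C%C : R[i]) by rewrite ltcR.
    have /cvgrPdist_le /(_ _ e0') := calpha x.
    apply: filterS => y; rewrite -normReK lecR; apply: le_trans.
    by have := Re_le_cabs (alpha x - alpha y); rewrite cReD cReN.
  exists (complex.Re M) => x; apply: le_trans (Re_le_cabs _) _.
  by have := hM x; rewrite lecE => /andP[].
- by rewrite aid.
- move=> x y; have Im0 z : complex.Im (alpha z) = 0 by rewrite E.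
  have := aM x y; rewrite {1}E cintegral_real => /(congr1 (@complex.Re R)) /= ->.
  by rewrite cReM !Im0 mulr0 subr0.
- by move=> x; rewrite ainv conj_Creal//; exact: areal.
Qed.

Section Character.
Variable a : K -> R.
Hypothesis ha : real_character a.

Lemma character_bounded_cont : complex_bounded_cont a^R.
Proof. by case: ha => ba _ _ _; split => //=; exact: bounded_cont_cst. Qed.

Lemma fourier_real_character (f : K -> R[i]) : fourier m f a^R = cintegral m (fun x => f x * (a x)%:C%C).
Proof.
by rewrite /fourier; congr cintegral; apply/funext => x; rewrite conj_Creal// complex_real.
Qed.

Lemma fourier_real f : fourier m f^R a^R = (\int[m]_x (f x * a x))%:C%C.
Proof.
rewrite fourier_real_character -cintegral_real; congr cintegral; apply/funext => x.
by rewrite rmorphM.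
Qed.

(** The translation passes to a as T_{x~}, which multiplies it by a(x~) = a(x). *)
Lemma integral_translate_character f x : Cc f ->
  \int[m]_y (P x y f * a y) = a x * \int[m]_y (f y * a y).
Proof.
case: ha => ba _ aM ainv cf; under eq_Rintegral do rewrite mulrC.
rewrite (haar_adjoint_bc x cf ba) -(haar_scale hm); last by apply: (Cc_mulr hausK) => //; exact: ba.1.
by congr (Rintegral _ _ _); apply/funext => y; rewrite aM ainv; ring.
Qed.

(** A bump at e inside the open set where a is positive has positive integral against a, since e is
    in the support of m; it is then rescaled. *)
Lemma exists_normalized : exists2 k, Cc k & \int[m]_x (k x * a x) = 1.
Proof.
case: ha => ba a1 _ _.
have oU : open [set x | 0 < a x].
  by apply: (@open_comp _ _ a [set t | 0 < t]); [move=> ? _; exact: ba.1|exact: open_gt].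
have [|k [ck k01 ke kU]] := bump_pt R hausK lcK (x := hid H) oU; first by rewrite /= a1.
have cka : Cc (fun x => k x * a x) by apply: (Cc_mulr hausK) => //; exact: ba.1.
have I0 : 0 < \int[m]_x (k x * a x).
  apply: (Rintegral_msupp_gt0 hausK rm cka _ (haar_id_supp hm)); last by rewrite ke a1 mul1r.
  move=> t; have [->|/kU/ltW at0] := eqVneq (k t) 0; first by rewrite mul0r.
  by rewrite mulr_ge0//; case/andP: (k01 t).
exists (fun x => (\int[m]_x (k x * a x))^-1 * k x); first exact: (Cc_scale hausK).
under eq_Rintegral do rewrite -mulrA.
by rewrite (haar_scale hm _ cka) mulVf// gt_eqF.
Qed.
End Character.
End Translations.

Lemma continuous_linear_cabs (R : realType) (X : normedModType R[i]) (phi : {linear X -> R[i]^o}) :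
  continuous phi <-> exists c : R, forall u, cabs (phi u : R[i]) <= c * cabs u.
Proof.
rewrite -linear_bounded_continuous linear_boundedP; split.
  move=> [M [Mr hM]].
  have [N [MN Nr]] : exists N : R[i], M < N /\ N \is Num.real.
    exists (`|M| + 1); split; last by rewrite realD ?normr_real ?real1.
    by apply: le_lt_trans (real_ler_norm Mr) _; rewrite ltrDl.
  exists (complex.Re N) => u; have := hM N MN u.
  have <- : (complex.Re N)%:C%C = N by apply: eq_complexP => //=; apply/esym/complexI; exact: RIm_real.
  by rewrite -(normReK u) -(normReK (phi u)) -rmorphM lecR.
move=> [c hc]; exists c%:C%C; split; first by rewrite complex_real.
move=> r cr u.
apply: (@le_trans _ _ (c * cabs u)%:C%C); first by rewrite -(normReK (phi u)) lecR.
by rewrite rmorphM /= normReK ler_wpM2r// ltW.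
Qed.

Section Forward.
Variables (R : realType) (K : ptopologicalType) (H : hypergroup R K).
Hypothesis hcomm : commutative_hypergroup H.
Local Notation bK := (borel K).
Local Notation P x y f := (\int[conv H x y]_t f t).
Local Notation "x ~" := (hinv H x) (at level 8, format "x ~").
Implicit Types (x y z : K).
Variable m : {measure set bK -> \bar R}.
Hypothesis hm : haar_measure H m.
Variable a : K -> R.
Hypothesis ha : real_character H a.

Let hausK := hyper_hausdorff H.
Let lcK := hyper_locally_compact H.
Let rm : radon m. Proof. by case: hm. Qed.

Variable ma : (K -> R[i]) -> R[i].
Hypothesis lma : linear_on (Linfty m) (ma : (K -> R[i]) -> R[i]^o).
Variable c0 : R.
Hypothesis bma : forall f, Linfty m f -> cabs (ma f) <= c0 * norm_infty m f.
Hypothesis ma1 : ma a^R = 1.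
Hypothesis mainv : forall f x, Linfty m f -> ma (translate H x f) = (a x)%:C%C * ma f.

Variables (X : completeNormedModType R[i]) (B : banach_bimodule H m X).
Hypothesis hB : alpha_left_module B a^R.
Variable D : (K -> R[i]) -> {linear X -> R[i]^o}.
Hypothesis linD : forall u, linear_on (L1 m) (fun f => D f u).
Variable c : R.
Hypothesis bD : forall f u, L1 m f -> cabs (D f u : R[i]) <= c * norm1 m f * cabs u.
Hypothesis derD : forall f g u, L1 m f -> L1 m g ->
  D (convolution H m f g) u = dual_ract B (D f) g u + dual_lact B f (D g) u.

Let h u (v : K -> R) : K -> R[i] := fun x => D (fun z => P x z v)^R u.
(** Kept as a function of v, not only of the fixed k: its behaviour under translation and
    convolution in v carries the proof. *)
Let Lam u v := ma (h u v).

Let bD' u f : L1 m f -> cabs (D f u : R[i]) <= c * cabs u * norm1 m f.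
Proof. by move=> hf; rewrite mulrAC; exact: bD. Qed.

Let DRe u : Cc_functional (fun v => complex.Re (D v^R u : R[i])).
Proof. exact: (L1_functional_real hm (linD u) (@bD' u)).1. Qed.

Let DIm u : Cc_functional (fun v => complex.Im (D v^R u : R[i])).
Proof. exact: (L1_functional_real hm (linD u) (@bD' u)).2. Qed.

Let h_le u v : Cc v -> forall x, cabs (h u v x) <= `|c| * cabs u * \int[m]_z `|v z|.
Proof.
move=> cv x; have cx := conv_slice_Cc H x cv.
apply: le_trans (bD' _ (L1_Cc hausK rm cx)) _.
apply: (@le_trans _ _ (`|c| * cabs u * norm1 m (fun z => P x z v)^R)).
  by rewrite ler_wpM2r ?norm1_ge0// ler_wpM2r ?cabs_ge0// ler_norm.
rewrite ler_wpM2l ?mulr_ge0 ?cabs_ge0//; exact: norm1_translate.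
Qed.

Let h_bc u v : Cc v -> complex_bounded_cont (h u v).
Proof.
move=> cv; split; split.
- exact: (ccf_translate_continuous (DRe u) cv).
- by exists (`|c| * cabs u * \int[m]_z `|v z|) => x; exact: le_trans (Re_le_cabs _) (h_le u cv x).
- exact: (ccf_translate_continuous (DIm u) cv).
- by exists (`|c| * cabs u * \int[m]_z `|v z|) => x; exact: le_trans (Im_le_cabs _) (h_le u cv x).
Qed.

Let h_Linfty u v : Cc v -> Linfty m (h u v).
Proof. by move=> cv; apply: Linfty_bounded_cont; exact: h_bc. Qed.

Let Lam_le u v : Cc v -> cabs (Lam u v) <= `|c0| * (`|c| * cabs u * \int[m]_z `|v z|).
Proof.
move=> cv; have I0 : 0 <= \int[m]_z `|v z| by apply: Rintegral_ge0.
apply: (le_trans (bma (h_Linfty u cv))).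
apply: (@le_trans _ _ (`|c0| * norm_infty m (h u v))).
  by rewrite ler_wpM2r ?norm_infty_ge0// ler_norm.
rewrite ler_wpM2l//; apply: norm_infty_le; last exact: h_le.
by rewrite !mulr_ge0// cabs_ge0.
Qed.

(** By [ccf_translate], translating v translates [h u v], and the mean turns that into the factor
    a(y). *)
Let Lam_translate u v y : Cc v -> Lam u (fun z => P y z v) = (a y)%:C%C * Lam u v.
Proof.
move=> cv; rewrite /Lam -mainv; last exact: h_Linfty.
congr ma; apply/funext => x; rewrite /translate /h; apply: eq_complexP => /=.
  by rewrite (@ccf_translate _ _ H _ (DRe u) v x y cv).
by rewrite (@ccf_translate _ _ H _ (DIm u) v x y cv).
Qed.

Let Lam_lin u (s : R) f g : Cc f -> Cc g ->
  Lam u (fun x => s * f x + g x) = s%:C%C * Lam u f + Lam u g.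
Proof.
move=> cf cg; rewrite /Lam; have e := lma s%:C%C (h_Linfty u cf) (h_Linfty u cg).
rewrite -[RHS]e; congr ma; apply/funext => x; rewrite /h.
have cfx := conv_slice_Cc H x cf; have cgx := conv_slice_Cc H x cg.
have ex := linD u s%:C%C (L1_Cc hausK rm cfx) (L1_Cc hausK rm cgx).
rewrite -[RHS]ex; congr (D _ u); apply/funext => z.
by rewrite conv_lin ?rmorphD ?rmorphM//; exact: Cc_bounded_cont.
Qed.

Let Lam_bound u C : compact C -> exists2 c' : R, 0 <= c' & forall v (M : R), Cc v ->
    (forall x, v x != 0 -> C x) -> (forall x, `|v x| <= M) -> cabs (Lam u v) <= c' * M.
Proof.
move=> cC; exists (`|c0| * (`|c| * cabs u * fine (m C))).
  by rewrite !mulr_ge0// ?cabs_ge0// fine_ge0.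
move=> v M cv vC vM; apply: (le_trans (Lam_le u cv)); rewrite -!mulrA.
rewrite !ler_wpM2l ?cabs_ge0//; apply: le_trans (ler_norm _) _.
apply: (Rintegral_abs_le hausK rm) => //; first exact: (Cc_norm hausK).
  by move=> x hx; apply: vC; rewrite -normr_eq0.
by move=> x; rewrite normr_id.
Qed.

Let LamRe u : Cc_functional (fun v => complex.Re (Lam u v)).
Proof.
split=> [s f g cf cg|C /Lam_bound - /(_ u)[c' c'0 hc']].
  by rewrite Lam_lin// cReD cReM/= mul0r subr0.
exists c' => // v M cv vC vM; apply: le_trans (Re_le_cabs _) _; exact: hc'.
Qed.

Let LamIm u : Cc_functional (fun v => complex.Im (Lam u v)).
Proof.
split=> [s f g cf cg|C /Lam_bound - /(_ u)[c' c'0 hc']].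
  by rewrite Lam_lin// cImD cImM/= mul0r addr0.
exists c' => // v M cv vC vM; apply: le_trans (Im_le_cabs _) _; exact: hc'.
Qed.

(** f * k averages the translates T_{y~} k, each contributing a(y~) = a(y). *)
Let Lam_convolution u f k : Cc f -> Cc k ->
  Lam u (fun x => \int[m]_y (f y * P y~ x k)) = (\int[m]_y (f y * a y))%:C%C * Lam u k.
Proof.
move=> cf ck; have [ba _ _ ainv] := ha.
have cfa : Cc (fun y => f y * a y) by apply: (Cc_mulr hausK) => //; exact: ba.1.
apply: eq_complexP.
  have [_ ->] := ccf_convolution hm (LamRe u) cf ck.
  rewrite cReM/= mul0r subr0 mulrC -(haar_scale hm _ cfa).
  congr (Rintegral _ _ _); apply/funext => y.
  by rewrite Lam_translate// cReM/= mul0r subr0 ainv; ring.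
have [_ ->] := ccf_convolution hm (LamIm u) cf ck.
rewrite cImM/= mul0r addr0 mulrC -(haar_scale hm _ cfa).
congr (Rintegral _ _ _); apply/funext => y.
by rewrite Lam_translate// cImM/= mul0r addr0 ainv; ring.
Qed.

Let k := sval (cid2 (exists_normalized hm ha)).
Let ck : Cc k. Proof. by rewrite /k; case: cid2. Qed.
Let ka1 : \int[m]_x (k x * a x) = 1. Proof. by rewrite /k; case: cid2. Qed.

Let phi0 (u : X) : R[i]^o := - Lam u k.

Let phi0_linear : linear phi0.
Proof.
move=> s u v; rewrite /phi0 /Lam scalerN -opprD; congr (- _).
have e := lma s (h_Linfty u ck) (h_Linfty v ck).
rewrite -[RHS]e; congr ma; apply/funext => x.
by rewrite /h linearP.
Qed.

Let phi : {linear X -> R[i]^o} := HB.pack phi0 (GRing.isLinear.Build _ _ _ _ phi0 phi0_linear).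

Let phi_continuous : continuous phi.
Proof.
apply/continuous_linear_cabs; exists (`|c0| * (`|c| * \int[m]_z `|k z|)) => u.
have -> : phi u = - Lam u k :> R[i] by [].
by rewrite cabsN (le_trans (Lam_le u ck))// -!mulrA (mulrC (cabs u)).
Qed.

Let inner_Cc f u : Cc f ->
  D f^R u = dual_lact B f^R phi u - dual_ract B phi f^R u.
Proof.
move=> cf; have lf := L1_Cc hausK rm cf.
(* The derivation identity for f * T_x k, solved for D(T_x k)(u . f). The left action of T_x k is
   the scalar a(x), so one term is a multiple of a; applying [ma] to the whole yields the claim. *)
have hE : h (ract B u f^R) k = fun x => - (D f^R u) * (a x)%:C%C + h u (fun s => \int[m]_y (f y * P y~ s k)) x.
  apply/funext => x; have cx := conv_slice_Cc H x ck; have lx := L1_Cc hausK rm cx.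
  have Ec : convolution H m f^R (fun z => P x z k)^R =
      (fun z => P x z (fun s => \int[m]_y (f y * P y~ s k)))^R.
    rewrite convolution_real; apply/funext => z; congr (real_complex _ _).
    exact: (convolution_translate hcomm hm).
  have := derD u lf lx; rewrite Ec /dual_ract /dual_lact (hB _ lx) linearZ /=.
  rewrite fourier_real (integral_translate_character hm ha x ck) ka1 mulr1.
  rewrite -/(h u (fun s => \int[m]_y (f y * P y~ s k)) x) => ->.
  by rewrite /h mulNr [(_ : R[i]^o) * _]mulrC addKr.
have [cfk _] := ccf_convolution hm (LamRe u) cf ck.
rewrite /dual_lact /dual_ract (hB _ lf) linearZ /= /phi0 /Lam hE.
have e := lma (- (D f^R u)) (Linfty_bounded_cont m (character_bounded_cont ha)) (h_Linfty u cfk).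
rewrite [X in - X - _]e ma1.
have := Lam_convolution u cf ck; rewrite /Lam => ->.
rewrite fourier_real; rewrite -[_ *: 1]/(_ * 1) mulr1 opprD opprK.
by rewrite -[_ *: (- _)]/(_ * - _) mulrN opprK subrK.
Qed.

(** Both sides of the required identity are bounded and linear in f, so [L1_ext] reduces it to
    [inner_Cc]. *)
Lemma derivation_inner : inner B D.
Proof.
exists phi => // f u hf; apply/eqP; rewrite -subr_eq0; apply/eqP.
move: f hf; apply: (L1_ext hausK lcK rm).
- move=> s f g hf hg; have lfg := L1_lin s hf hg.
  rewrite /dual_lact /dual_ract (ract_linearr B u s hf hg) (lact_linearl B u s hf hg).
  rewrite (linD u s hf hg) !(linearP phi); move: (D f u : R[i]) (D g u : R[i]) => p q.
  by rewrite -![_ *: _]/(_ * _); ring.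
- have [c1 hc1] := ract_bounded B; have [c2 hc2] := lact_bounded B.
  have [c3 hc3] := (continuous_linear_cabs phi).1 phi_continuous.
  exists (`|c| * cabs u + (`|c3| * (`|c1| * cabs u) + `|c3| * (`|c2| * cabs u))) => f hf.
  have phi_le w : cabs (phi w : R[i]) <= `|c3| * cabs w.
    by apply: le_trans (hc3 w) _; rewrite ler_wpM2r ?cabs_ge0// ler_norm.
  have n0 := norm1_ge0 m f; have u0 := cabs_ge0 u.
  have e1 : cabs (D f u : R[i]) <= `|c| * cabs u * norm1 m f.
    by apply: (le_trans (bD' u hf)); rewrite ler_wpM2r// ler_wpM2r// ler_norm.
  have e2 : cabs (phi (ract B u f) : R[i]) <= `|c3| * (`|c1| * cabs u) * norm1 m f.
    apply: (le_trans (phi_le _)); rewrite -mulrA ler_wpM2l//.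
    apply: (le_trans (hc1 f u hf)); rewrite mulrAC ler_wpM2r// ler_wpM2r// ler_norm //.
  have e3 : cabs (phi (lact B f u) : R[i]) <= `|c3| * (`|c2| * cabs u) * norm1 m f.
    apply: (le_trans (phi_le _)); rewrite -mulrA ler_wpM2l//.
    apply: (le_trans (hc2 f u hf)); rewrite mulrAC ler_wpM2r// ler_wpM2r// ler_norm //.
  have tri (p q r : R[i]) : cabs (p - (q - r)) <= cabs p + (cabs q + cabs r).
    rewrite opprB (addrC r) (le_trans (cabsD _ _))// lerD2l.
    by rewrite (le_trans (cabsD _ _))// cabsN.
  by apply: le_trans (tri _ _ _) _; rewrite !mulrDl; exact: lerD e1 (lerD e2 e3).
- by move=> v cv; rewrite inner_Cc// subrr.
Qed.
End Forward.

Lemma amenable_left_amenable (R : realType) (K : ptopologicalType) (H : hypergroup R K)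
    (m : {measure set (borel K) -> \bar R}) (a : K -> R) :
  commutative_hypergroup H -> haar_measure H m -> real_character H a ->
  alpha_amenable H m a^R -> alpha_left_amenable H m a^R.
Proof.
move=> hcomm hm ha [ma [lma [c0 bma] ma1 mainv]] X B hB D [_ linD [c bD] derD].
exact: (derivation_inner hcomm hm ha lma bma ma1 mainv hB linD bD derD).
Qed.

(** * Convolution on L^1(K) *)

(** A strict lower bound of a product in [0, +oo] factors through finite lower bounds of the two
    factors; infinite factors need their own case. *)
Lemma lt_mule_split (R : realType) (c : R) (a b : \bar R) : (0 <= a)%E -> (0 <= b)%E -> 0 <= c ->
  (c%:E < a * b)%E -> exists s t : R, [/\ 0 <= s, 0 <= t, (s%:E < a)%E, (t%:E < b)%E & c < s * t].
Proof.
move=> a0 b0 c0 cab.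
have bp : (0 < b)%E.
  by rewrite lt_neqAle b0 andbT; apply: contraTneq cab => <-; rewrite mule0 -leNgt lee_fin.
have ap : (0 < a)%E.
  by rewrite lt_neqAle a0 andbT; apply: contraTneq cab => <-; rewrite mul0e -leNgt lee_fin.
have [s [s0 sa csb]] : exists s : R, [/\ 0 < s, (s%:E < a)%E & (c%:E < s%:E * b)%E].
  case: b {b0} bp cab => [b| |]// bp cab; last first.
    have [s s0 sa] := ereal_between (lexx 0%E) ap.
    by exists s; split; [rewrite -lte_fin|exact: sa|rewrite mulry gtr0_sg// ?mul1e ?ltry// -lte_fin].
  rewrite lte_fin in bp.
  have h : ((c / b)%:E < a)%E.
    case: a cab ap {a0} => [a| |]//= cab _; last by rewrite ltry.
    by move: cab; rewrite -?EFinM !lte_fin ltr_pdivrMr.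
  have [|s cs sa] := ereal_between _ h; first by rewrite lee_fin divr_ge0// ltW.
  rewrite lte_fin ltr_pdivrMr// in cs.
  exists s; split => //.
  by have := le_lt_trans c0 cs; rewrite pmulr_lgt0.
have h : ((c / s)%:E < b)%E.
  case: b csb bp {b0 cab} => [b| |]//= csb _; last by rewrite ltry.
  by move: csb; rewrite -?EFinM !lte_fin ltr_pdivrMr// mulrC.
have [|t ct tb] := ereal_between _ h; first by rewrite lee_fin divr_ge0// ltW.
rewrite lte_fin ltr_pdivrMr// mulrC in ct.
exists s, t; split => //; [exact: ltW|].
by have := le_lt_trans c0 ct; rewrite pmulr_rgt0// => /ltW.
Qed.

Section LscGt.
Variables (R : realType) (K : ptopologicalType).
Hypothesis hausK : hausdorff_space K.
Hypothesis lcK : locally_compact [set: K].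
Local Notation bK := (borel K).
Variable mu : {measure set bK -> \bar R}.
Hypothesis rmu : radon mu.

Lemma Rintegral_EFin (f : K -> R) : Cc f -> (\int[mu]_x (f x)%:E)%E = (\int[mu]_x f x)%:E.
Proof.
by move=> cf; rewrite /Rintegral fineK//; apply: integrable_fin_num => //; exact: Cc_integrable.
Qed.

Lemma lsc_integral_gt (phi : K -> \bar R) (c : R) : lsc_ge0 phi -> (c%:E < \int[mu]_x phi x)%E ->
  exists f, [/\ Cc f, (forall x, 0 <= f x), (forall x, (f x)%:E <= phi x)%E & c < \int[mu]_x f x].
Proof.
move=> lp cphi; apply: contrapT => nex; move: cphi; rewrite ltNge => /negP; apply.
apply: (lsc_integral_le hausK lcK rmu lp) => f cf f0 fp.
rewrite Rintegral_EFin// lee_fin leNgt; apply/negP => cf'; apply: nex.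
by exists f.
Qed.

Lemma le_lsc_integral (phi : K -> \bar R) f : Cc f -> (forall x, 0 <= f x) ->
  (forall x, (f x)%:E <= phi x)%E -> ((\int[mu]_x f x)%:E <= \int[mu]_x phi x)%E.
Proof.
by move=> cf f0 fp; rewrite -Rintegral_EFin//; apply: le_lower_integral => // x; rewrite lee_fin.
Qed.
End LscGt.

(** * Translation and convolution of lower semicontinuous majorants *)

Section LscTranslation.
Variables (R : realType) (K : ptopologicalType) (H : hypergroup R K).
Local Notation bK := (borel K).
Local Notation P x y f := (\int[conv H x y]_t f t).
Local Notation "x ~" := (hinv H x) (at level 8, format "x ~").
Implicit Types (x y z : K) (phi psi : K -> \bar R) (f g v w : K -> R).
Variable m : {measure set bK -> \bar R}.
Hypothesis hm : haar_measure H m.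

Let hausK := hyper_hausdorff H.
Let lcK := hyper_locally_compact H.
Let rm : radon m. Proof. by case: hm. Qed.

Definition ltranslate x psi y : \bar R := (\int[conv H x y]_t psi t)%E.

Lemma ltranslate_ge0 x psi y : lsc_ge0 psi -> (0 <= ltranslate x psi y)%E.
Proof. by move=> [p0 _]; exact: integral_ge0. Qed.

Lemma ltranslate_gt x psi y (c : R) : lsc_ge0 psi -> (c%:E < ltranslate x psi y)%E ->
  exists f, [/\ Cc f, (forall t, 0 <= f t), (forall t, (f t)%:E <= psi t)%E & c < P x y f].
Proof. exact: (lsc_integral_gt hausK lcK (conv_radon H x y)). Qed.

Lemma ltranslate_ge x psi y f : Cc f -> (forall t, 0 <= f t) -> (forall t, (f t)%:E <= psi t)%E ->
  ((P x y f)%:E <= ltranslate x psi y)%E.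
Proof. exact: (le_lsc_integral hausK (conv_radon H x y)). Qed.

Lemma conv_le x y f g : Cc f -> Cc g -> (forall t, f t <= g t) -> P x y f <= P x y g.
Proof.
by move=> cf cg fg; apply: le_Rintegral => //; apply: bounded_cont_integrable; exact: Cc_bounded_cont.
Qed.

Definition below psi : set (K -> R) := [set f | [/\ Cc f, (forall t, 0 <= f t) & (forall t, (f t)%:E <= psi t)%E]].

Lemma below_max psi f g : below psi f -> below psi g -> below psi (fun t => Num.max (f t) (g t)).
Proof.
move=> [cf f0 fp] [cg g0 gp]; split; first exact: (Cc_max hausK).
- by move=> t; rewrite le_max f0.
- by move=> t; rewrite EFin_max ge_max fp gp.
Qed.

Lemma below0 psi : lsc_ge0 psi -> below psi (fun=> 0).
Proof. by move=> [p0 _]; split => //; exact: Cc0. Qed.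

(** The translates of the C_c(K) minorants of psi form a directed family with supremum T_x psi, and
    invariance of m bounds each integral by \int psi. *)
Lemma ltranslate_lsc_le x psi : lsc_ge0 psi ->
  lower_semicontinuous (ltranslate x psi) /\ (\int[m]_y ltranslate x psi y <= \int[m]_y psi y)%E.
Proof.
move=> lp; apply: (@tau_smooth R K hausK m rm [set g | exists2 f, below psi f & g = fun y => P x y f]).
- by exists (fun y => P x y (fun=> 0)), (fun=> 0) => //; exact: below0.
- move=> _ [f [cf f0 fp] ->]; split; first exact: conv_cont_param.
  by move=> y; exact: conv_ge0.
- move=> _ _ [f bf ->] [g bg ->].
  exists (fun y => P x y (fun t => Num.max (f t) (g t))).
    by exists (fun t => Num.max (f t) (g t)) => //; exact: below_max.
  have [cfg _ _] := below_max bf bg; case: bf bg => [cf _ _] [cg _ _].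
  by move=> y; split; apply: conv_le => // t; rewrite le_max lexx ?orbT.
- by move=> _ y [f [cf f0 fp] ->]; exact: ltranslate_ge.
- move=> y c /(ltranslate_gt lp)[f [cf f0 fp h]].
  by exists (fun y => P x y f) => //; exists f.
- move=> _ [f [cf f0 fp] ->].
  rewrite (Rintegral_EFin hausK rm (conv_slice_Cc H x cf)) (haar_inv hm x cf).
  exact: (le_lsc_integral hausK rm).
Qed.

Definition lconv phi psi x : \bar R := (\int[m]_y (phi y * ltranslate y~ psi x))%E.

Let lkernel_gt phi psi x y (c : R) : lsc_ge0 phi -> lsc_ge0 psi ->
  (c%:E < phi y * ltranslate y~ psi x)%E ->
  exists f g, [/\ below phi f, below psi g & c < f y * P y~ x g].
Proof.
move=> lphi lpsi h; have [c0|c0] := ltP c 0.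
  by exists (fun=> 0), (fun=> 0); split; [exact: below0|exact: below0|rewrite mul0r].
have [s [t [s0 t0 sp tp cst]]] := lt_mule_split (lphi.1 y) (ltranslate_ge0 y~ x lpsi) c0 h.
have [f [cf f0 fp fs]] := lsc_test hausK lcK lphi sp.
have [g [cg g0 gp gt]] := ltranslate_gt lpsi tp.
exists f, g; split => //; apply: lt_le_trans cst _.
by apply: ler_pM => //; exact: ltW.
Qed.

Let lkernel_ge phi psi x y f g : below phi f -> below psi g ->
  ((f y * P y~ x g)%:E <= phi y * ltranslate y~ psi x)%E.
Proof.
move=> [cf f0 fp] [cg g0 gp]; rewrite EFinM; apply: lee_pmul => //.
- by rewrite lee_fin.
- by rewrite lee_fin conv_ge0.
- exact: ltranslate_ge.
Qed.

Let lkernel_cont f g x : Cc f -> Cc g -> Cc (fun y => f y * P y~ x g).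
Proof.
move=> cf cg; apply: (Cc_mulr hausK cf) => y.
exact: (@continuous_comp _ _ _ (hinv H) (fun y => P y x g) y (@hinv_cont _ _ H y)
  ((conv_slice_bounded_cont_l H x cg).1 _)).
Qed.

Let lkernel_mono f g f' g' x y : Cc g -> Cc g' -> (forall t, 0 <= f t) -> (forall t, 0 <= g t) ->
  (forall t, f t <= f' t) -> (forall t, g t <= g' t) -> f y * P y~ x g <= f' y * P y~ x g'.
Proof.
move=> cg cg' f0 g0 ff gg; apply: ler_pM => //; first exact: conv_ge0.
exact: conv_le.
Qed.

(** [tau_smooth] for the kernels f(y) T_{y~} g(x) with f and g below phi and psi. With B = +oo it
    serves for semicontinuity alone. *)
Lemma lconv_kernel_lsc phi psi x (B : \bar R) : lsc_ge0 phi -> lsc_ge0 psi ->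
  (forall f g, below phi f -> below psi g -> (\int[m]_y (f y * P y~ x g)%:E <= B)%E) ->
  lower_semicontinuous (fun y => phi y * ltranslate y~ psi x)%E /\ (lconv phi psi x <= B)%E.
Proof.
move=> lphi lpsi hB.
apply: (@tau_smooth R K hausK m rm [set k | exists f g, [/\ below phi f, below psi g & k = fun y => f y * P y~ x g]]).
- exists (fun y => 0 * P y~ x (fun=> 0)), (fun=> 0), (fun=> 0).
  by split => //; exact: below0.
- move=> _ [f [g [[cf f0 _] [cg g0 _] ->]]]; split; first exact/Cc_continuous/lkernel_cont.
  by move=> y; rewrite mulr_ge0//; exact: conv_ge0.
- move=> _ _ [f [g [bf bg ->]]] [f' [g' [bf' bg' ->]]].
  have bff := below_max bf bf'; have bgg := below_max bg bg'.
  eexists; first by do 2 eexists; split; [exact: bff|exact: bgg|reflexivity].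
  case: bf bg bf' bg' bgg => [cf f0 _] [cg g0 _] [cf' f'0 _] [cg' g'0 _] [cgg _ _] y.
  split.
    by apply: (@lkernel_mono f g (fun t => Num.max (f t) (f' t)) _ x y) => // t; rewrite le_max lexx ?orbT.
  by apply: (@lkernel_mono f' g' (fun t => Num.max (f t) (f' t)) _ x y) => // t; rewrite le_max lexx ?orbT.
- by move=> _ y [f [g [bf bg ->]]]; exact: lkernel_ge.
- move=> y c /(lkernel_gt lphi lpsi)[f [g [bf bg h]]].
  by exists (fun y => f y * P y~ x g) => //; exists f, g.
- by move=> _ [f [g [bf bg ->]]]; exact: hB.
Qed.

Lemma lconv_kernel_ge0 phi psi x : lsc_ge0 phi -> lsc_ge0 psi ->
  lsc_ge0 (fun y => phi y * ltranslate y~ psi x)%E.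
Proof.
move=> lphi lpsi; split=> [y|]; first by apply: mule_ge0; [exact: lphi.1|exact: ltranslate_ge0].
by have [|] := @lconv_kernel_lsc phi psi x +oo%E lphi lpsi => // *; exact: leey.
Qed.

(* Tonelli's theorem in the only form that survives without sigma-finiteness:
   everything is a directed supremum of continuous compactly supported kernels. *)
Lemma lconv_lsc_le phi psi : lsc_ge0 phi -> lsc_ge0 psi ->
  lower_semicontinuous (lconv phi psi) /\
  (\int[m]_x lconv phi psi x <= (\int[m]_x phi x) * (\int[m]_x psi x))%E.
Proof.
move=> lphi lpsi.
apply: (@tau_smooth R K hausK m rm [set k | exists f g, [/\ below phi f, below psi g & k = fun x => \int[m]_y (f y * P y~ x g)]]).
- eexists; exists (fun=> 0), (fun=> 0); split; [exact: below0|exact: below0|reflexivity].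
- move=> _ [f [g [[cf f0 _] [cg g0 _] ->]]]; split.
    by apply: Cc_continuous; case: (ccf_convolution hm (haar_functional hm) cf cg).
  by move=> x; apply: Rintegral_ge0 => y _; rewrite mulr_ge0//; exact: conv_ge0.
- move=> _ _ [f [g [bf bg ->]]] [f' [g' [bf' bg' ->]]].
  have bff := below_max bf bf'; have bgg := below_max bg bg'.
  eexists; first by do 2 eexists; split; [exact: bff|exact: bgg|reflexivity].
  case: bf bg bf' bg' bgg bff => [cf f0 _] [cg g0 _] [cf' f'0 _] [cg' g'0 _] [cgg _ _] [cff _ _] x.
  split; apply: (haar_le hm); try exact: lkernel_cont.
    by move=> y; apply: (@lkernel_mono f g (fun t => Num.max (f t) (f' t)) _ x y) => // t; rewrite le_max lexx ?orbT.
  by move=> y; apply: (@lkernel_mono f' g' (fun t => Num.max (f t) (f' t)) _ x y) => // t; rewrite le_max lexx ?orbT.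
- move=> _ x [f [g [bf bg ->]]].
  have [cf f0 _] := bf; have [cg g0 _] := bg.
  rewrite -(Rintegral_EFin hausK rm (lkernel_cont x cf cg)).
  apply: le_lower_integral => y; first by rewrite lee_fin mulr_ge0//; exact: conv_ge0.
  exact: lkernel_ge.
(* If no member of the family exceeds c at x, then [lconv_kernel_lsc] with B = c bounds
   [lconv phi psi x] by c. *)
- move=> x c cx; apply: contrapT => nex; move: cx; rewrite ltNge => /negP; apply.
  suff [_] : lower_semicontinuous (fun y => phi y * ltranslate y~ psi x)%E /\ (lconv phi psi x <= c%:E)%E by [].
  apply: lconv_kernel_lsc => // f g bf bg.
  have [cf f0 _] := bf; have [cg g0 _] := bg.
  rewrite (Rintegral_EFin hausK rm (lkernel_cont x cf cg)) lee_fin leNgt; apply/negP => h.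
  by apply: nex; exists (fun x => \int[m]_y (f y * P y~ x g)) => //; exists f, g.
- move=> _ [f [g [[cf f0 fp] [cg g0 gp] ->]]].
  have [cfg e] := ccf_convolution hm (haar_functional hm) cf cg.
  rewrite (Rintegral_EFin hausK rm cfg) e.
  (* Invariance of m makes the inner integral independent of y. *)
  have -> : \int[m]_y (f y * \int[m]_x P y~ x g) = (\int[m]_x f x) * (\int[m]_x g x).
    rewrite mulrC -(haar_scale hm _ cf); congr (Rintegral _ _ _); apply/funext => y.
    by rewrite (haar_inv hm _ cg) mulrC.
  rewrite EFinM; apply: lee_pmul; rewrite ?lee_fin.
  + by apply: Rintegral_ge0.
  + by apply: Rintegral_ge0.
  + exact: (le_lsc_integral hausK rm).
  + exact: (le_lsc_integral hausK rm).
Qed.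
End LscTranslation.

Section ComplexClose.
Variables (R : realType) (K : ptopologicalType).
Local Notation bK := (borel K).
Variable mu : {measure set bK -> \bar R}.
Implicit Types (f g h u v : K -> R[i]) (a : R[i]).

Lemma cintegral_close u v (E : K -> \bar R) : lsc_ge0 E -> L1 mu v ->
  (forall x, (cabs (u x - v x))%:E <= E x)%E ->
  ((cabs (cintegral mu u - cintegral mu v))%:E <= 4%:E * \int[mu]_x E x)%E.
Proof.
move=> lE [v1 v2] uv.
have e1 := @integral_close _ _ _ mu (fun x => complex.Re (u x)) (fun x => complex.Re (v x)) E
  (lsc_ge0_measurable lE) lE.1 v1.
have e2 := @integral_close _ _ _ mu (fun x => complex.Im (u x)) (fun x => complex.Im (v x)) E
  (lsc_ge0_measurable lE) lE.1 v2.
apply: (@le_trans _ _ (`|complex.Re (cintegral mu u - cintegral mu v)| + `|complex.Im (cintegral mu u - cintegral mu v)|)%:E).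
  by rewrite lee_fin cabs_le_sum.
have -> : (4%:E * \int[mu]_x E x = (\int[mu]_x E x + \int[mu]_x E x) + (\int[mu]_x E x + \int[mu]_x E x))%E.
  by rewrite -!mule2n -!mule_natl muleA -EFinM -natrM.
rewrite EFinD cReD cImD cReN cImN; apply: leeD.
  apply: e1 => x; apply: le_trans (uv x); rewrite lee_fin.
  by have := Re_le_cabs (u x - v x); rewrite cReD cReN.
apply: e2 => x; apply: le_trans (uv x); rewrite lee_fin.
by have := Im_le_cabs (u x - v x); rewrite cImD cImN.
Qed.

Lemma integrable_mul_bounded (f g : K -> R) : mu.-integrable setT (EFin \o f : bK -> \bar R) -> bounded_cont g ->
  mu.-integrable setT (EFin \o (fun x => f x * g x) : bK -> \bar R).
Proof.
move=> hf [cg [M hM]].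
apply: (@integrableMl _ bK R mu setT measurableT (EFin \o f) g hf) => //.
  exact: (@borel_continuous R K g cg).
by exists M; split => [|N MN x _]; [exact: num_real|exact: le_trans (hM x) (ltW MN)].
Qed.

Lemma complex_bounded_cont_lin a f g : complex_bounded_cont f -> complex_bounded_cont g ->
  complex_bounded_cont (fun x => a * f x + g x).
Proof.
move=> [f1 f2] [g1 g2]; split.
  under eq_fun do rewrite cReD cReM.
  apply: bounded_cont_add => //; apply: bounded_cont_sub.
    by apply: bounded_cont_mulr => //; exact: bounded_cont_cst.
  by apply: bounded_cont_mulr => //; exact: bounded_cont_cst.
under eq_fun do rewrite cImD cImM.
apply: bounded_cont_add => //; apply: bounded_cont_add.
  by apply: bounded_cont_mulr => //; exact: bounded_cont_cst.
by apply: bounded_cont_mulr => //; exact: bounded_cont_cst.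
Qed.

Lemma L1_mul f h : L1 mu f -> complex_bounded_cont h -> L1 mu (fun x => f x * h x).
Proof.
move=> [f1 f2] [h1 h2]; split.
  have := integrable_lin 1 (-1) (integrable_mul_bounded f1 h1) (integrable_mul_bounded f2 h2).
  by congr (integrable _ _ _); apply/funext => x; rewrite /= cReM; congr (_%:E); ring.
have := integrable_lin 1 1 (integrable_mul_bounded f1 h2) (integrable_mul_bounded f2 h1).
by congr (integrable _ _ _); apply/funext => x; rewrite /= cImM; congr (_%:E); ring.
Qed.

Lemma L1_measurable f : L1 mu f -> measurable_fun [set: bK] (fun x : bK => (cabs (f x))%:E).
Proof.
move=> [/measurable_int f1 /measurable_int f2].
have mf1 : measurable_fun [set: bK] (fun x : bK => complex.Re (f x)) by exact/measurable_EFinP.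
have mf2 : measurable_fun [set: bK] (fun x : bK => complex.Im (f x)) by exact/measurable_EFinP.
apply/measurable_EFinP.
rewrite (_ : (fun _ => _) = (fun x => Num.sqrt (complex.Re (f x) ^+ 2 + complex.Im (f x) ^+ 2))).
  apply: (measurableT_comp (continuous_measurable_fun (@sqrt_continuous R))).
  by apply: measurable_funD; apply: measurable_funX.
by apply/funext => x; rewrite normc_def.
Qed.

Lemma norm1_mul f h (M : R) : L1 mu f -> complex_bounded_cont h -> 0 <= M -> (forall x, cabs (h x) <= M) ->
  norm1 mu (fun x => f x * h x) <= M * norm1 mu f.
Proof.
move=> hf hh M0 hM; apply: (norm1_le (phi := fun x => (M%:E * (cabs (f x))%:E)%E)).
- exact: L1_mul.
- by move=> x; rewrite -EFinM lee_fin cabsM mulrC ler_wpM2r// cabs_ge0.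
rewrite ge0_integralZl_EFin//.
- by rewrite EFinM norm1E.
- by move=> x _; rewrite lee_fin cabs_ge0.
- exact: L1_measurable.
Qed.

Lemma norm1_sub f g : L1 mu f -> L1 mu g -> L1 mu (fun x => f x - g x) ->
  norm1 mu (fun x => f x - g x) <= norm1 mu f + norm1 mu g.
Proof.
move=> hf hg hfg; apply: (norm1_le (phi := fun x => ((cabs (f x))%:E + (cabs (g x))%:E)%E)) => //.
  by move=> x; rewrite -EFinD lee_fin -(cabsN (g x)); exact: cabsD.
rewrite ge0_integralD//.
- by rewrite EFinD !norm1E.
- by move=> x _; rewrite lee_fin cabs_ge0.
- exact: L1_measurable.
- by move=> x _; rewrite lee_fin cabs_ge0.
- exact: L1_measurable.
Qed.
End ComplexClose.

Section Approximation.
Variables (R : realType) (K : ptopologicalType).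
Hypothesis hausK : hausdorff_space K.
Hypothesis lcK : locally_compact [set: K].
Local Notation bK := (borel K).
Variable m : {measure set bK -> \bar R}.
Hypothesis rm : radon m.
Implicit Types (f g : K -> R[i]).

(** An approximant from C_c(K) with error at most 1 gives F as its modulus, up to splitting into
    parts, plus the error majorant. *)
Lemma L1_majorant f : L1 m f -> exists F B, [/\ lsc_ge0 F, 0 <= B,
  (forall x, (cabs (f x))%:E <= F x)%E & (\int[m]_x F x <= B%:E)%E].
Proof.
move=> hf; have [v [w [phi [cv cw lphi hv Iphi]]]] := L1_dense hausK lcK rm hf ltr01.
have lv := lsc_norm (Cc_continuous cv); have lw := lsc_norm (Cc_continuous cw).
have lvw := lsc_add lw lv.
exists (fun x => phi x + ((`|w x|)%:E + (`|v x|)%:E))%E, (1 + (\int[m]_x `|w x| + \int[m]_x `|v x|)); split.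
- exact: lsc_add.
- by rewrite !addr_ge0//; apply: Rintegral_ge0.
- move=> x; rewrite -[f x](subrK ('i%C * (w x)%:C%C + (v x)%:C%C)).
  apply: (@le_trans _ _ ((cabs (f x - ('i%C * (w x)%:C%C + (v x)%:C%C)))%:E + (`|w x| + `|v x|)%:E)%E).
    rewrite -EFinD lee_fin (le_trans (cabsD _ _))// lerD2l (le_trans (cabsD _ _))//.
    by rewrite cabsM cabs_i mul1r !cabs_real.
  by rewrite EFinD; apply: leeD.
rewrite (integral_lscD m lphi lvw) (integral_lscD m lw lv).
rewrite (Rintegral_EFin hausK rm (Cc_norm hausK cw)) (Rintegral_EFin hausK rm (Cc_norm hausK cv)).
by rewrite !EFinD; apply: leeD.
Qed.
End Approximation.

Section ConvolutionPairing.
Variables (R : realType) (K : ptopologicalType) (H : hypergroup R K).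
Local Notation bK := (borel K).
Local Notation "x ~" := (hinv H x) (at level 8, format "x ~").
Implicit Types (x y z : K) (phi psi F G : K -> \bar R) (f g h u : K -> R[i]).
Variable m : {measure set bK -> \bar R}.
Hypothesis hm : haar_measure H m.

Let hausK := hyper_hausdorff H.
Let lcK := hyper_locally_compact H.
Let rm : radon m. Proof. by case: hm. Qed.

Lemma bounded_cont_L1 x y u : complex_bounded_cont u -> L1 (conv H x y) u.
Proof. by move=> [u1 u2]; split; exact: bounded_cont_integrable. Qed.

Lemma translate_close x y g g' psi : lsc_ge0 psi -> complex_bounded_cont g' ->
  (forall t, (cabs (g t - g' t))%:E <= psi t)%E ->
  ((cabs (translate H x g y - translate H x g' y))%:E <= 4%:E * ltranslate H x psi y)%E.
Proof. by move=> lpsi bg' h; apply: cintegral_close => //; exact: bounded_cont_L1. Qed.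

Lemma complex_bounded_cont0 : complex_bounded_cont (fun _ : K => 0 : R[i]).
Proof. by split; exact: bounded_cont_cst. Qed.

Lemma translate_le x y g G : lsc_ge0 G -> (forall t, (cabs (g t))%:E <= G t)%E ->
  ((cabs (translate H x g y))%:E <= 4%:E * ltranslate H x G y)%E.
Proof.
move=> lG h; have := @translate_close x y g (fun=> 0) G lG complex_bounded_cont0.
rewrite /translate cintegral0 subr0; apply => t; by rewrite subr0.
Qed.

Lemma translate_inv_bc x u : complex_bounded_cont u ->
  complex_bounded_cont (fun y => translate H y~ u x).
Proof.
move=> [u1 u2]; split.
  exact: (@bounded_cont_inv _ _ H _ (@conv_slice_bc_l _ _ H x _ u1)).
exact: (@bounded_cont_inv _ _ H _ (@conv_slice_bc_l _ _ H x _ u2)).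
Qed.

(** The product difference is split as (f - f') * g + f' * (g - g'). Translates of g and the outer
    integral may involve non-integrable functions, so each of the two integrations costs a factor
    4. *)
Lemma convolution_close f g f' g' F G phi psi x :
  lsc_ge0 F -> lsc_ge0 G -> lsc_ge0 phi -> lsc_ge0 psi ->
  (forall t, (cabs (f' t))%:E <= F t)%E -> (forall t, (cabs (g t))%:E <= G t)%E ->
  (forall t, (cabs (f t - f' t))%:E <= phi t)%E -> (forall t, (cabs (g t - g' t))%:E <= psi t)%E ->
  L1 m f' -> complex_bounded_cont g' ->
  ((cabs (convolution H m f g x - convolution H m f' g' x))%:E <=
    16%:E * (lconv H m phi G x + lconv H m F psi x))%E.
Proof.
move=> lF lG lphi lpsi f'F gG fphi gpsi hf' bg'.
have l1 := lconv_kernel_ge0 hm x lphi lG; have l2 := lconv_kernel_ge0 hm x lF lpsi.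
have l12 := lsc_add l1 l2; have lE := lsc_scale (ler0n R 4) l12.
have hv : L1 m (fun y => f' y * translate H y~ g' x).
  exact: (L1_mul hf' (translate_inv_bc x bg')).

apply: le_trans (cintegral_close lE hv _) _.
  move=> y; have -> : f y * translate H y~ g x - f' y * translate H y~ g' x =
      (f y - f' y) * translate H y~ g x + f' y * (translate H y~ g x - translate H y~ g' x) by ring.
  apply: (@le_trans _ _ ((cabs (f y - f' y) * cabs (translate H y~ g x))%:E +
      (cabs (f' y) * cabs (translate H y~ g x - translate H y~ g' x))%:E)%E).
    by rewrite -EFinD lee_fin -!cabsM cabsD.
  rewrite ge0_muleDr; [|exact: l1.1|exact: l2.1].
  apply: leeD; rewrite EFinM muleCA; apply: lee_pmul; rewrite ?lee_fin ?cabs_ge0//.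
    exact: translate_le.
  exact: translate_close.
by rewrite (integral_lscZ m (ler0n R 4) l12) muleA -EFinM -natrM (integral_lscD m l1 l2).
Qed.

Lemma translate_lin x y (a : R[i]) u v : complex_bounded_cont u -> complex_bounded_cont v ->
  translate H x (fun t => a * u t + v t) y = a * translate H x u y + translate H x v y.
Proof. by move=> bu bv; apply: cintegral_lin; exact: bounded_cont_L1. Qed.

Lemma convolution_linl (a : R[i]) f g u x : L1 m f -> L1 m g -> complex_bounded_cont u ->
  convolution H m (fun t => a * f t + g t) u x = a * convolution H m f u x + convolution H m g u x.
Proof.
move=> hf hg /(translate_inv_bc x) bu.
rewrite -(cintegral_lin a (L1_mul hf bu) (L1_mul hg bu)).
by congr cintegral; apply/funext => y; rewrite mulrDl mulrA.
Qed.

Lemma convolution_linr (a : R[i]) f u v x : L1 m f -> complex_bounded_cont u -> complex_bounded_cont v ->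
  convolution H m f (fun t => a * u t + v t) x = a * convolution H m f u x + convolution H m f v x.
Proof.
move=> hf bu bv.
rewrite -(cintegral_lin a (L1_mul hf (translate_inv_bc x bu)) (L1_mul hf (translate_inv_bc x bv))).
by congr cintegral; apply/funext => y; rewrite translate_lin// mulrDr mulrCA.
Qed.

Lemma Cc_complex_bounded_cont_real (v : K -> R) : Cc v -> complex_bounded_cont v^R.
Proof. by move=> cv; split; [exact: Cc_bounded_cont|exact: bounded_cont_cst]. Qed.

Lemma Cc_complex_bounded_cont (v w : K -> R) : Cc v -> Cc w ->
  complex_bounded_cont (fun x => 'i%C * (w x)%:C%C + (v x)%:C%C).
Proof. by move=> cv cw; apply: complex_bounded_cont_lin; exact: Cc_complex_bounded_cont_real. Qed.

Section Pairing.
(** Q stands for an expression already known to be bilinear and bounded on L^1. The instance used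
    later is Q f g = (g * (f * u))(x), with h(y) = T_{y~} u(x). *)
Variables (Q : (K -> R[i]) -> (K -> R[i]) -> R[i]) (c : R) (h : K -> R[i]).
Hypothesis Qlinl : forall g, L1 m g -> linear_on (L1 m) ((fun f => Q f g) : (K -> R[i]) -> R[i]^o).
Hypothesis Qlinr : forall f, L1 m f -> linear_on (L1 m) (Q f : (K -> R[i]) -> R[i]^o).
Hypothesis Qle : forall f g, L1 m f -> L1 m g -> cabs (Q f g) <= c * norm1 m f * norm1 m g.
Hypothesis bh : complex_bounded_cont h.
Hypothesis QCc : forall v w : K -> R, Cc v -> Cc w ->
  Q v^R w^R = cintegral m (fun x => convolution H m v^R w^R x * h x).

Let convolution_L1 (v w : K -> R) : Cc v -> Cc w -> L1 m (convolution H m v^R w^R).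
Proof.
move=> cv cw; rewrite convolution_real; apply: (L1_Cc hausK rm).
by case: (ccf_convolution hm (haar_functional hm) cv cw).
Qed.

Let pairing_Cc (v1 w1 v2 w2 : K -> R) : Cc v1 -> Cc w1 -> Cc v2 -> Cc w2 ->
  let f := fun x => 'i%C * (w1 x)%:C%C + (v1 x)%:C%C in
  let g := fun x => 'i%C * (w2 x)%:C%C + (v2 x)%:C%C in
  L1 m (fun x => convolution H m f g x * h x) /\
  Q f g = cintegral m (fun x => convolution H m f g x * h x).
Proof.
move=> cv1 cw1 cv2 cw2 f g.
have lv1 := L1_Cc hausK rm cv1; have lw1 := L1_Cc hausK rm cw1.
have lv2 := L1_Cc hausK rm cv2; have lw2 := L1_Cc hausK rm cw2.
have bg := Cc_complex_bounded_cont cv2 cw2; have lg := L1_lin 'i%C lw2 lv2.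
have hreal (v : K -> R) : Cc v -> L1 m (fun x => convolution H m v^R g x * h x) /\
    Q v^R g = cintegral m (fun x => convolution H m v^R g x * h x).
  move=> cv; have lv := L1_Cc hausK rm cv.
  have e : (fun x => convolution H m v^R g x * h x) =
      fun x => 'i%C * (convolution H m v^R w2^R x * h x) + convolution H m v^R v2^R x * h x.
    apply/funext => x; rewrite (convolution_linr _ x lv) ?mulrDl ?mulrA//.
      exact: Cc_complex_bounded_cont_real.
    exact: Cc_complex_bounded_cont_real.
  have l1 := L1_mul (convolution_L1 cv cw2) bh; have l2 := L1_mul (convolution_L1 cv cv2) bh.
  rewrite e; split; first exact: L1_lin.
  by rewrite (cintegral_lin 'i%C l1 l2) -(QCc cv cw2) -(QCc cv cv2); exact: (Qlinr lv 'i%C lw2 lv2).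
have e : (fun x => convolution H m f g x * h x) =
    fun x => 'i%C * (convolution H m w1^R g x * h x) + convolution H m v1^R g x * h x.
  by apply/funext => x; rewrite (convolution_linl _ x lw1 lv1 bg) mulrDl mulrA.
have [l1 e1] := hreal _ cw1; have [l2 e2] := hreal _ cv1.
rewrite e; split; first exact: L1_lin.
by rewrite cintegral_lin// -e1 -e2; exact: (Qlinl lg 'i%C lw1 lv1).
Qed.

(* [convolution H m f g x] may be the integral of a non-integrable function for
   some x, so the right-hand side is not obviously bilinear in f and g; both
   sides are compared with their values on approximants from C_c(K). *)
Lemma convolution_pairing f g : L1 m f -> L1 m g ->
  Q f g = cintegral m (fun x => convolution H m f g x * h x).
Proof.
move=> hf hg; have [M M0 hM] := complex_bounded_contP bh.
have [F [BF [lF BF0 fF IF]]] := L1_majorant hausK lcK rm hf.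
have [G [BG [lG BG0 gG IG]]] := L1_majorant hausK lcK rm hg.
apply: (@cabs_small_eq _ _ _ (64 * M * (BG + (BF + 1)) + `|c| * (norm1 m g + (norm1 m f + 1)))) => e e0.
(* d <= 1 keeps the bounds on the approximants independent of e: [F + phi] has integral at most BF +
   1, and the norm of [f'] is at most that of f plus 1. The two summands of the constant come from
   the convolution integral and from Q. *)
pose d := Num.min e 1.
have d0 : 0 < d by rewrite lt_min e0 ltr01.
have [de d1] : d <= e /\ d <= 1 by rewrite !ge_min !lexx orbT.
have [v1 [w1 [phi [cv1 cw1 lphi hphi Iphi]]]] := L1_dense hausK lcK rm hf d0.
have [v2 [w2 [psi [cv2 cw2 lpsi hpsi Ipsi]]]] := L1_dense hausK lcK rm hg d0.
set f' := (fun x => 'i%C * (w1 x)%:C%C + (v1 x)%:C%C) in hphi.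
set g' := (fun x => 'i%C * (w2 x)%:C%C + (v2 x)%:C%C) in hpsi.
have lf' : L1 m f' := L1_lin 'i%C (L1_Cc hausK rm cw1) (L1_Cc hausK rm cv1).
have lg' : L1 m g' := L1_lin 'i%C (L1_Cc hausK rm cw2) (L1_Cc hausK rm cv2).
have bg' : complex_bounded_cont g' := Cc_complex_bounded_cont cv2 cw2.
have [l' e'] := pairing_Cc cv1 cw1 cv2 cw2; rewrite -/f' -/g' in l' e'.
have lFp := lsc_add lF lphi.
have IFp : (\int[m]_x (F x + phi x) <= (BF + 1)%:E)%E.
  by rewrite (integral_lscD m lF lphi) EFinD; apply: leeD => //; apply: (le_trans Iphi); rewrite lee_fin.
have f'F x : ((cabs (f' x))%:E <= F x + phi x)%E.
  have -> : f' x = f x - (f x - f' x) by ring.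
  apply: (@le_trans _ _ ((cabs (f x))%:E + (cabs (f x - f' x))%:E)%E).
    by rewrite -EFinD lee_fin (le_trans (cabsD _ _))// cabsN.
  exact: leeD.
have [s1 I1] := lconv_lsc_le hm lphi lG.
have [s2 I2] := lconv_lsc_le hm lFp lpsi.
have lk1 : lsc_ge0 (lconv H m phi G).
  by split => // x; apply: integral_ge0 => y _; exact: (lconv_kernel_ge0 hm x lphi lG).1.
have lk2 : lsc_ge0 (lconv H m (fun x => F x + phi x)%E psi).
  by split => // x; apply: integral_ge0 => y _; exact: (lconv_kernel_ge0 hm x lFp lpsi).1.
have lk := lsc_add lk1 lk2.
have lE : lsc_ge0 (fun x => (M * 16)%:E * (lconv H m phi G x + lconv H m (fun x => F x + phi x)%E psi x))%E.
  by apply: lsc_scale => //; rewrite mulr_ge0.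
have close : cabs (cintegral m (fun x => convolution H m f g x * h x) - Q f' g') <=
    64 * M * (d * BG + (BF + 1) * d).
  rewrite -lee_fin e'; apply: le_trans (cintegral_close lE l' _) _.
    move=> x; rewrite -mulrBl cabsM mulrC EFinM EFinM -muleA; apply: lee_pmul; rewrite ?lee_fin ?cabs_ge0//.
    exact: convolution_close.
  rewrite (integral_lscZ m _ lk) ?mulr_ge0// muleA -EFinM.
  have -> : 4 * (M * 16) = 64 * M by ring.
  rewrite (EFinM (64 * M)); apply: lee_pmul => //.
  - by rewrite lee_fin mulr_ge0.
  - by apply: integral_ge0 => x _; exact: lk.1.
  rewrite (integral_lscD m lk1 lk2) EFinD !(EFinM _ _); apply: leeD.
    by apply: (le_trans I1); apply: lee_pmul => //; apply: integral_ge0 => x _; [exact: lphi.1|exact: lG.1].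
  by apply: (le_trans I2); apply: lee_pmul => //; apply: integral_ge0 => x _; [exact: lFp.1|exact: lpsi.1].
have hd := L1_lin (-1) lf' hf; have hd' := L1_lin (-1) lg' hg.
have nd : norm1 m (fun x => -1 * f' x + f x) <= d.
  by apply: (norm1_le hd _ Iphi) => x; rewrite mulN1r addrC.
have nd' : norm1 m (fun x => -1 * g' x + g x) <= d.
  by apply: (norm1_le hd' _ Ipsi) => x; rewrite mulN1r addrC.
have nf' : norm1 m f' <= norm1 m f + 1.
  apply: le_trans (_ : norm1 m f + norm1 m (fun x => -1 * f' x + f x) <= _); last first.
    by rewrite lerD2l (le_trans nd).
  have e1 : f' = fun x => f x - (-1 * f' x + f x) by apply/funext => x; ring.
  by rewrite {1}e1; apply: norm1_sub => //; rewrite -e1.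
have Qe : Q f g - Q f' g' = Q (fun x => -1 * f' x + f x) g + Q f' (fun x => -1 * g' x + g x).
  rewrite (Qlinl hg (-1) lf' hf) (Qlinr lf' (-1) lg' hg).
  by rewrite -![_ *: _]/(_ * _); ring.
have BF1 : 0 <= BF + 1 by rewrite addr_ge0.
have split_le : cabs (Q f g - cintegral m (fun x => convolution H m f g x * h x)) <=
    cabs (cintegral m (fun x => convolution H m f g x * h x) - Q f' g') + cabs (Q f g - Q f' g').
  move: (cintegral m _) (Q f g) (Q f' g') => I q q'.
  rewrite -(cabsN (I - q')) opprB; have -> : q - I = (q' - I) + (q - q') by ring.
  exact: cabsD.
apply: (le_trans split_le); rewrite mulrDl; apply: lerD.
  apply: (le_trans close); rewrite -[X in _ <= X]mulrA ler_wpM2l ?mulr_ge0//.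
  by rewrite [X in _ <= X]mulrDl; apply: lerD; [rewrite mulrC|]; apply: ler_wpM2l.
rewrite Qe (le_trans (cabsD _ _))// -[X in _ <= X]mulrA.
apply: (@le_trans _ _ (`|c| * (d * norm1 m g) + `|c| * ((norm1 m f + 1) * d))).
  apply: lerD.
    apply: (le_trans (Qle hd hg)); rewrite -mulrA.
    apply: (@le_trans _ _ (`|c| * (norm1 m (fun x => -1 * f' x + f x) * norm1 m g))).
      by rewrite ler_wpM2r ?ler_norm// mulr_ge0// norm1_ge0.
    by rewrite ler_wpM2l// ler_wpM2r// norm1_ge0.
  apply: (le_trans (Qle lf' hd')); rewrite -mulrA.
  apply: (@le_trans _ _ (`|c| * (norm1 m f' * norm1 m (fun x => -1 * g' x + g x)))).
    by rewrite ler_wpM2r ?ler_norm// mulr_ge0// norm1_ge0.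
  by rewrite ler_wpM2l// ler_pM// norm1_ge0.
rewrite -mulrDr ler_wpM2l// [X in _ <= X]mulrDl; apply: lerD.
  by rewrite mulrC ler_wpM2l// norm1_ge0.
by rewrite ler_wpM2l// addr_ge0// norm1_ge0.
Qed.
End Pairing.
End ConvolutionPairing.

(** * Convolution of C_c(K) and L^1(K) with bounded continuous functions *)

Section BoundedConvolution.
Variables (R : realType) (K : ptopologicalType) (H : hypergroup R K).
Hypothesis hcomm : commutative_hypergroup H.
Local Notation bK := (borel K).
Local Notation P x y f := (\int[conv H x y]_t f t).
Local Notation "x ~" := (hinv H x) (at level 8, format "x ~").
Implicit Types (x y z : K) (f h k v w : K -> R).
Variable m : {measure set bK -> \bar R}.
Hypothesis hm : haar_measure H m.

Let hausK := hyper_hausdorff H.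
Let lcK := hyper_locally_compact H.
Let rm : radon m. Proof. by case: hm. Qed.

Lemma conv_inv_bc k x : bounded_cont k -> bounded_cont (fun y => P y~ x k).
Proof. by move=> bk; exact: (@bounded_cont_inv _ _ H _ (@conv_slice_bc_l _ _ H x _ bk)). Qed.

(** For x in A and y in the support of f, the sets y~ * x stay in one compact set, so k matters only
    there. *)
Lemma convolution_local f k A : Cc f -> bounded_cont k -> compact A ->
  exists2 k', Cc k' & forall x, A x -> forall y, f y * P y~ x k = f y * P y~ x k'.
Proof.
move=> cf bk cA; have [B cB fB] := Cc_supp cf.
have [C cC hC] := conv_supp_compact_union H (@hinv_compact _ _ H _ cB) cA.
have [k' ck' kk'] := bounded_cont_local H bk cC.
exists k' => // x Ax y; have [->|/fB By] := eqVneq (f y) 0; first by rewrite !mul0r.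
congr (_ * _); apply: eq_conv; first exact: Cc_bounded_cont.
by move=> t St; rewrite kk'//; apply: hC St => //; exists y.
Qed.

Lemma Cc_mul_conv_inv f k x : Cc f -> bounded_cont k -> Cc (fun y => f y * P y~ x k).
Proof. by move=> cf bk; apply: (Cc_mulr hausK cf); exact: (conv_inv_bc x bk).1. Qed.

Lemma convolution_bounded_cont f k : Cc f -> bounded_cont k ->
  bounded_cont (fun x => \int[m]_y (f y * P y~ x k)).
Proof.
move=> cf bk; split.
  move=> x0; have [V [oV Vx [C cC VC]]] := relcompact_nbhd lcK x0.
  have [k' ck' kk'] := convolution_local cf bk cC.
  have [/Cc_continuous cF _] := ccf_convolution hm (haar_functional hm) cf ck'.
  have e : \forall x \near x0, \int[m]_y (f y * P y~ x k') = \int[m]_y (f y * P y~ x k).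
    have : nbhs x0 V by apply: open_nbhs_nbhs.
    by apply: filterS => x /VC Cx; congr (Rintegral _ _ _); apply/funext => y; rewrite kk'.
  have h := cF x0; rewrite /continuous_at (nbhs_singleton e) in h.
  by apply: cvg_trans h; apply: near_eq_cvg; exact: e.
have [M hM] := bk.2; exists (\int[m]_y (`|M| * `|f y|)) => x.
apply: (le_trans (haar_norm hm (Cc_mul_conv_inv x cf bk))); apply: (haar_le hm).
- exact/(Cc_norm hausK)/Cc_mul_conv_inv.
- exact/(Cc_scale hausK)/(Cc_norm hausK).
- move=> y; rewrite normrM mulrC ler_wpM2r//; apply: conv_bound => // t.
  exact: le_trans (hM t) (ler_norm _).
Qed.

Lemma conv_convolution_swap f k x z : Cc f -> bounded_cont k ->
  P z x (fun s => \int[m]_y (f y * P y~ s k)) = \int[m]_y (f y * P z x (fun s => P y~ s k)).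
Proof.
move=> cf bk; have [k' ck' kk'] := convolution_local cf bk (@conv_supp_compact _ _ H z x).
have [cF e] := ccf_convolution hm (conv_functional H z x) cf ck'.
transitivity (P z x (fun s => \int[m]_y (f y * P y~ s k'))).
  apply: eq_conv; first exact: Cc_bounded_cont.
  by move=> t St; congr (Rintegral _ _ _); apply/funext => y; rewrite kk'.
rewrite e; congr (Rintegral _ _ _); apply/funext => y.
have [->|f0] := eqVneq (f y) 0; first by rewrite !mul0r.
congr (_ * _); apply: eq_conv; first exact: (conv_slice_bc H).
by move=> t St; have /(mulfI f0) -> := kk' t St y.
Qed.

Lemma haar_mul_functional h : bounded_cont h -> Cc_functional (fun k => \int[m]_y (k y * h y)).
Proof.
move=> [ch [M hM]]; split=> [s f g cf cg|C cC].
  rewrite -(haar_lin hm s (Cc_mulr hausK cf ch) (Cc_mulr hausK cg ch)).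
  by congr (Rintegral _ _ _); apply/funext => y; rewrite mulrDl mulrA.
exists (fine (m C) * `|M|); first by rewrite mulr_ge0// fine_ge0.
move=> v N cv vC vN; rewrite -mulrA (mulrC `|M|).
apply: (Rintegral_abs_le hausK rm (Cc_mulr hausK cv ch) cC).
  by move=> x; rewrite mulf_eq0 negb_or => /andP[/vC].
by move=> x; rewrite normrM ler_pM// (le_trans (hM x))// ler_norm.
Qed.

(** The inverse of y * z is z~ * y~; commutativity puts the factors in the order that associativity
    needs. *)
Lemma conv_inv_assoc x y z k : bounded_cont k ->
  P y z (fun t => P t~ x k) = P z~ x (fun s => P y~ s k).
Proof.
move=> bk; have bk' := @conv_slice_bc_l _ _ H x _ bk.
by rewrite conv_comm// -(conv_inv_eval H z y bk') conv_assoc_bc.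
Qed.

(** (v * w) * k = w * (v * k). With h(y) = T_{y~} k(x), the left side pairs v * w with h; the
    adjoint formula moves the translation from w to h, and the y and z integrals are exchanged. *)
Lemma convolution_assoc_real v w k x : Cc v -> Cc w -> bounded_cont k ->
  \int[m]_y ((\int[m]_t (v t * P t~ y w)) * P y~ x k) =
  \int[m]_z (w z * P z~ x (fun s => \int[m]_y (v y * P y~ s k))).
Proof.
move=> cv cw bk; have bh := conv_inv_bc x bk.
have [_ ->] := ccf_convolution hm (haar_mul_functional bh) cv cw.
have [A cA vA] := Cc_supp cv; have [B cB wB] := Cc_supp cw.
have [||_ _ e] := @ccf_swap R K hausK lcK (fun f => \int[m]_x f x) (fun f => \int[m]_x f x)
  (fun y z => v y * (w z * P y z (fun t => P t~ x k))) A B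
  (haar_functional hm) (haar_functional hm) _ cA cB.
- apply: (@joint_mull _ _ v (fun y z => w z * P y z (fun t => P t~ x k)) (Cc_continuous cv)).
  apply: (@joint_mulr _ _ w (fun y z => P y z (fun t => P t~ x k)) (Cc_continuous cw)).
  exact: (@conv_continuous _ _ H _ bh).
- by move=> y z; rewrite !mulf_eq0 !negb_or => /and3P[/vA ? /wB ? _].
transitivity (\int[m]_y \int[m]_z (v y * (w z * P y z (fun t => P t~ x k)))).
  congr (Rintegral _ _ _); apply/funext => y.
  have cwy : Cc (fun z => w z * P y z (fun t => P t~ x k)).
    by apply: (Cc_mulr hausK cw); exact: (@conv_slice_bc _ _ H y _ bh).1.
  rewrite (@haar_scale _ _ _ _ hm (v y) _ cwy); congr (_ * _).
  have := haar_adjoint_bc hm y~ cw bh; rewrite hinvK => <-.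
  by congr (Rintegral _ _ _); apply/funext => z; rewrite mulrC.
rewrite e; congr (Rintegral _ _ _); apply/funext => z.
have cvz : Cc (fun y => v y * P z~ x (fun s => P y~ s k)).
  have -> : (fun y => v y * P z~ x (fun s => P y~ s k)) = fun y => v y * P y z (fun t => P t~ x k).
    by apply/funext => y; rewrite (conv_inv_assoc x y z bk).
  by apply: (Cc_mulr hausK cv); exact: (@conv_slice_bc_l _ _ H z _ bh).1.
rewrite (conv_convolution_swap _ _ cv bk) -(@haar_scale _ _ H m hm (w z) _ cvz).
by congr (Rintegral _ _ _); apply/funext => y; rewrite (conv_inv_assoc x y z bk) mulrCA.
Qed.

(** v * T_y k = (T_y v) * k: the adjoint formula moves T_y off v as T_{y~}, which associativity and
    commutativity attach to k. *)
Lemma convolution_translate_real v k x y : Cc v -> bounded_cont k ->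
  \int[m]_z (v z * P z~ x (fun t => P y t k)) = \int[m]_z (P y z v * P z~ x k).
Proof.
move=> cv bk; have bh := conv_inv_bc x bk.
under [RHS]eq_Rintegral do rewrite mulrC.
rewrite (haar_adjoint_bc hm y cv bh); congr (Rintegral _ _ _); apply/funext => z.
by rewrite (conv_inv_assoc x y~ z bk) hinvK.
Qed.

Lemma bounded_cont_closed h : (forall e : R, 0 < e -> exists2 k, bounded_cont k & forall x, `|h x - k x| <= e) ->
  bounded_cont h.
Proof.
move=> hk; split.
  move=> x; apply/cvgrPdist_le => e e0; have e3 : 0 < e / 3 by rewrite divr_gt0.
  have [k [ck _] hkx] := hk _ e3; have /cvgrPdist_le /(_ _ e3) := ck x.
  apply: filterS => y ky.
  have -> : h x - h y = (h x - k x) + (k x - k y) - (h y - k y) by ring.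
  apply: (le_trans (ler_normB _ _)); apply: (le_trans (lerD (ler_normD _ _) (hkx y))).
  apply: (le_trans (lerD (lerD (hkx x) ky) (lexx _))); lra.
have [k [_ [M hM]] hkx] := hk _ ltr01; exists (1 + M) => x.
by rewrite -(subrK (k x) (h x)) (le_trans (ler_normD _ _))// lerD.
Qed.
End BoundedConvolution.

Section ComplexConvolution.
Variables (R : realType) (K : ptopologicalType) (H : hypergroup R K).
Hypothesis hcomm : commutative_hypergroup H.
Local Notation bK := (borel K).
Local Notation P x y f := (\int[conv H x y]_t f t).
Local Notation "x ~" := (hinv H x) (at level 8, format "x ~").
Implicit Types (x y z : K) (v w : K -> R) (f g u : K -> R[i]).
Variable m : {measure set bK -> \bar R}.
Hypothesis hm : haar_measure H m.

Let hausK := hyper_hausdorff H.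
Let lcK := hyper_locally_compact H.
Let rm : radon m. Proof. by case: hm. Qed.

Lemma complex_bounded_cont_closed u (C : R) : 0 <= C ->
  (forall e, 0 < e -> exists2 g, complex_bounded_cont g & forall x, cabs (u x - g x) <= C * e) ->
  complex_bounded_cont u.
Proof.
move=> C0 hu; have C1 : 0 < C + 1 by rewrite ltr_wpDl.
have hu' e : 0 < e -> exists2 g, complex_bounded_cont g & forall x, cabs (u x - g x) <= e.
  move=> e0; have [g bg hg] := hu _ (divr_gt0 e0 C1); exists g => // x; apply: (le_trans (hg x)).
  by rewrite mulrCA ler_piMr// ?(ltW e0)// ler_pdivrMr// mul1r lerDl.
split; apply: bounded_cont_closed => e /hu'[g [g1 g2] hg].
  exists (fun x => complex.Re (g x)) => // x; apply: le_trans (hg x).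
  by have := Re_le_cabs (u x - g x); rewrite cReD cReN.
exists (fun x => complex.Im (g x)) => // x; apply: le_trans (hg x).
by have := Im_le_cabs (u x - g x); rewrite cImD cImN.
Qed.

Lemma translate_bounded_cont x u : complex_bounded_cont u -> complex_bounded_cont (translate H x u).
Proof. by move=> [u1 u2]; split; exact: (conv_slice_bc H). Qed.

Lemma translate_bound x y u (M : R) : complex_bounded_cont u -> (forall t, cabs (u t) <= M) ->
  cabs (translate H x u y) <= 2 * M.
Proof.
move=> [u1 u2] hM; apply: (le_trans (cabs_le_sum _)); rewrite mulr_natl mulr2n; apply: lerD.
  by apply: conv_bound => // t; exact: le_trans (Re_le_cabs _) (hM t).
by apply: conv_bound => // t; exact: le_trans (Im_le_cabs _) (hM t).
Qed.

Lemma convolution_le f u (M : R) x : L1 m f -> complex_bounded_cont u -> 0 <= M ->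
  (forall t, cabs (u t) <= M) -> cabs (convolution H m f u x) <= 4 * M * norm1 m f.
Proof.
move=> hf bu M0 hM; have bt := translate_inv_bc H x bu.
apply: (le_trans (cintegral_le (L1_mul hf bt))).
have -> : 4 * M * norm1 m f = 2 * (2 * M * norm1 m f) by ring.
rewrite ler_wpM2l//; apply: norm1_mul => //; first by rewrite mulr_ge0.
by move=> y; exact: translate_bound.
Qed.

Lemma convolution_real_complex v u : convolution H m v^R u =
  fun x => Complex (\int[m]_y (v y * P y~ x (fun t => complex.Re (u t))))
                   (\int[m]_y (v y * P y~ x (fun t => complex.Im (u t)))).
Proof.
apply/funext => x; apply: eq_complexP => /=.
  by congr (Rintegral _ _ _); apply/funext => y; rewrite ?cReM /= mul0r subr0.
by congr (Rintegral _ _ _); apply/funext => y; rewrite ?cImM /= mul0r addr0.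
Qed.

Lemma convolution_Cc_bc v u : Cc v -> complex_bounded_cont u ->
  complex_bounded_cont (convolution H m v^R u).
Proof.
by move=> cv [u1 u2]; rewrite convolution_real_complex; split; exact: (convolution_bounded_cont hm).
Qed.

(** By [convolution_le] the map f |-> f * u is bounded from L^1 into the sup norm, so f * u is a
    uniform limit of the case of C_c(K). *)
Lemma convolution_bc f u : L1 m f -> complex_bounded_cont u -> complex_bounded_cont (convolution H m f u).
Proof.
move=> hf bu; have [M M0 hM] := complex_bounded_contP bu.
apply: (@complex_bounded_cont_closed _ (4 * M)) => [|e e0]; first by rewrite mulr_ge0.
have [v [w [phi [cv cw lphi hphi Iphi]]]] := L1_dense hausK lcK rm hf e0.
have lv := L1_Cc hausK rm cv; have lw := L1_Cc hausK rm cw.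
have lg := L1_lin 'i%C lw lv; have ld := L1_lin (-1) lg hf.
exists (convolution H m (fun x => 'i%C * (w x)%:C%C + (v x)%:C%C) u).
  have := complex_bounded_cont_lin 'i%C (convolution_Cc_bc cw bu) (convolution_Cc_bc cv bu).
  by congr complex_bounded_cont; apply/funext => x; rewrite (convolution_linl H 'i%C x lw lv bu).
move=> x; have := convolution_le x ld bu M0 hM.
rewrite (convolution_linl H (-1) x lg hf bu) mulN1r addrC => h.
apply: (le_trans h); rewrite ler_wpM2l ?mulr_ge0//.
by apply: (norm1_le ld _ Iphi) => t; rewrite mulN1r addrC.
Qed.

(** The order g * (f * u) is that of a right action u . f = f * u. [convolution_pairing] extends the
    identity from C_c(K), since its right-hand side is known to be bilinear and bounded. *)
Lemma convolution_assoc f g u x : L1 m f -> L1 m g -> complex_bounded_cont u ->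
  convolution H m (convolution H m f g) u x = convolution H m g (convolution H m f u) x.
Proof.
move=> hf hg bu; have [M M0 hM] := complex_bounded_contP bu.
have bt := translate_inv_bc H x bu.
pose Q f g := convolution H m g (convolution H m f u) x.
suff E : Q f g = cintegral m (fun y => convolution H m f g y * translate H y~ u x) by exact/esym/E.
apply: (@convolution_pairing _ _ _ _ hm Q (16 * M) _ _ _ _ bt _ f g hf hg).
- move=> h lh a f1 f2 l1 l2; rewrite /Q.
  have -> : convolution H m (fun t => a * f1 t + f2 t) u = fun t => a * convolution H m f1 u t + convolution H m f2 u t.
    by apply/funext => t; exact: (convolution_linl H a t l1 l2 bu).
  exact: (convolution_linr H a x lh (convolution_bc l1 bu) (convolution_bc l2 bu)).
- move=> h lh a g1 g2 l1 l2; exact: (convolution_linl H a x l1 l2 (convolution_bc lh bu)).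
- move=> f1 g1 l1 l2.
  have := @convolution_le g1 (convolution H m f1 u) (4 * M * norm1 m f1) x l2 (convolution_bc l1 bu).
  rewrite !mulr_ge0 ?norm1_ge0// => /(_ isT (fun t => convolution_le t l1 bu M0 hM)).
  by rewrite !mulrA -natrM.
- move=> v w cv cw; have [u1 u2] := bu.
  rewrite /Q (convolution_real_complex w) (convolution_real_complex v u) convolution_real.
  apply: eq_complexP => /=.
    rewrite -(convolution_assoc_real hcomm hm x cv cw u1).
    by congr (Rintegral _ _ _); apply/funext => y; rewrite ?cReM /= mul0r subr0.
  rewrite -(convolution_assoc_real hcomm hm x cv cw u2).
  by congr (Rintegral _ _ _); apply/funext => y; rewrite ?cImM /= mul0r addr0.
Qed.

Lemma convolution_translate_complex v u x y : Cc v -> complex_bounded_cont u ->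
  convolution H m v^R (translate H y u) x = convolution H m (fun z => P y z v)^R u x.
Proof.
move=> cv [u1 u2]; rewrite !convolution_real_complex; apply: eq_complexP => /=.
  exact: (convolution_translate_real hcomm hm).
exact: (convolution_translate_real hcomm hm).
Qed.

Variable a : K -> R.
Hypothesis ha : real_character H a.

Lemma convolution_character f x : L1 m f ->
  convolution H m f a^R x = fourier m f a^R * (a x)%:C%C.
Proof.
have [ba _ aM ainv] := ha; move=> hf.
have lfa := L1_mul hf (character_bounded_cont ha).
rewrite (fourier_real_character m) mulrC -(cintegral_scale _ lfa); congr cintegral; apply/funext => y.
by rewrite /translate cintegral_real aM ainv rmorphM [LHS]mulrA [LHS]mulrC.
Qed.

(** f^(a) is the value of f * a = f^(a) a at e, so multiplicativity is associativity with u = a. *)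
Lemma fourier_convolution f g : L1 m f -> L1 m g ->
  fourier m (convolution H m f g) a^R = fourier m f a^R * fourier m g a^R.
Proof.
have [ba a1 aM ainv] := ha; move=> hf hg; have bca := character_bounded_cont ha.
have := convolution_assoc (hid H) hf hg bca.
have -> : convolution H m f a^R = fun x => fourier m f a^R * (a x)%:C%C + 0.
  by apply/funext => x; rewrite convolution_character// addr0.
rewrite (convolution_linr H _ _ hg bca (complex_bounded_cont0 _ _)) (convolution_character (hid H) hg) a1 mulr1.
have -> : convolution H m g (fun=> 0) (hid H) = 0.
  rewrite /convolution -[RHS](cintegral0 m); congr cintegral; apply/funext => y.
  by rewrite /translate cintegral0 mulr0.
rewrite addr0 => <-; rewrite (fourier_real_character m); congr cintegral; apply/funext => y.
by rewrite /translate cintegral_real aM ainv a1 mulr1.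
Qed.
End ComplexConvolution.

(** * Averaging locally essentially bounded functions *)

Section EssentiallyBounded.
Variables (R : realType) (K : ptopologicalType) (H : hypergroup R K).
Local Notation bK := (borel K).
Local Notation P x y f := (\int[conv H x y]_t f t).
Local Notation "x ~" := (hinv H x) (at level 8, format "x ~").
Implicit Types (x y z : K) (v w k : K -> R).
Variable m : {measure set bK -> \bar R}.
Hypothesis hm : haar_measure H m.

Let hausK := hyper_hausdorff H.
Let lcK := hyper_locally_compact H.
Let rm : radon m. Proof. by case: hm. Qed.

(** The real form of membership in L^oo with essential bound M; the real and imaginary parts are
    treated separately. *)
Definition ess_bounded (r : K -> R) (M : R) := 0 <= M /\ forall C : set K, compact C ->
  measurable_fun (C : set bK) (r : bK -> R) /\ m.-negligible (C `&` [set x | M < `|r x|]).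

Lemma ess_bounds_ReIm (h : K -> R[i]) M : Linfty m h -> ess_bounds m h M ->
  ess_bounded (fun x => complex.Re (h x)) M /\ ess_bounded (fun x => complex.Im (h x)) M.
Proof.
move=> [mh _] [M0 hM]; split; split=> // C cC; have [m1 m2] := mh C cC; split => //.
  apply: negligibleS (hM C cC) => x [Cx /= h1]; split => //=.
  exact: lt_le_trans h1 (Re_le_cabs _).
apply: negligibleS (hM C cC) => x [Cx /= h1]; split => //=.
exact: lt_le_trans h1 (Im_le_cabs _).
Qed.

Variables (r : K -> R) (M : R).
Hypothesis hr : ess_bounded r M.

Lemma ess_bounded_measurable C : compact C ->
  measurable_fun [set: bK] ((fun x => r x * \1_C x) : bK -> R).
Proof.
move=> cC; have [mr _] := hr.2 C cC; have mC := borel_compact hausK cC.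
have /(measurable_restrictT _ mC) := mr; congr (measurable_fun _ _); apply/funext => x.
rewrite patchE indicE; case: (x \in C); by rewrite ?mulr1 ?mulr0.
Qed.

Lemma ess_bounded_integrable C : compact C ->
  m.-integrable setT (EFin \o (fun x => r x * \1_C x) : bK -> \bar R).
Proof.
move=> cC; have [_ nr] := hr.2 C cC; have mC := borel_compact hausK cC.
have mrC := ess_bounded_measurable cC; have M0 := hr.1.
apply/integrableP; split; first exact/measurable_EFinP.
apply: (@le_lt_trans _ _ (\int[m]_x (M * \1_C x)%:E)%E).
  apply: ae_ge0_le_integral => //.
  - by apply/measurableT_comp/measurable_EFinP.
  - by move=> x _; rewrite lee_fin mulr_ge0.
  - apply/measurable_EFinP; apply: measurable_funM => //.
  - apply: negligibleS nr => x /= /not_implyP[_]; rewrite lee_fin normrM.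
    rewrite indicE; have [Cx h|Cx] := boolP (x \in C); last by rewrite normr0 !mulr0 lexx.
    split; first by rewrite inE in Cx.
    by rewrite ltNge; apply/negP => h'; apply: h; rewrite normr1 !mulr1.
under eq_integral do rewrite EFinM.
rewrite ge0_integralZl_EFin//; last by apply/measurable_EFinP.
rewrite integral_indic// setIT; have [hC _ _] := rm.
by rewrite lte_mul_pinfty// ?lee_fin// hC.
Qed.

Lemma ess_bounded_mul_integrable v : Cc v ->
  m.-integrable setT (EFin \o (fun x => r x * v x) : bK -> \bar R).
Proof.
move=> cv; have [A cA vA] := Cc_supp cv.
have := integrable_mul_bounded (ess_bounded_integrable cA) (Cc_bounded_cont cv).
congr (integrable _ _ _); apply/funext => x /=; congr (_%:E).
have [->|/vA Ax] := eqVneq (v x) 0; first by rewrite !mulr0.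
by rewrite indicE mem_set// mulr1.
Qed.

Lemma ess_bounded_integral_le v : Cc v -> `|\int[m]_x (r x * v x)| <= M * \int[m]_x `|v x|.
Proof.
move=> cv; have [A cA vA] := Cc_supp cv; have ih := ess_bounded_mul_integrable cv.
have [_ nr] := hr.2 A cA; have M0 := hr.1.
apply: (le_trans (le_normr_Rintegral _ ih)) => //.
rewrite -(@haar_scale _ _ H m hm M _ (Cc_norm hausK cv)) -lee_fin.
rewrite -(Rintegral_EFin hausK rm (Cc_scale hausK M (Cc_norm hausK cv))).
have ih' : m.-integrable setT (EFin \o (fun x => `|r x * v x|) : bK -> \bar R) by exact: integrable_norm ih.
rewrite /Rintegral fineK; last exact: (integrable_fin_num measurableT ih').
apply: ae_ge0_le_integral => //.
- exact: measurable_int ih'.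
- by move=> x _; rewrite lee_fin mulr_ge0.
- exact: measurable_int (Cc_integrable hausK rm (Cc_scale hausK M (Cc_norm hausK cv))).
apply: negligibleS nr => x /= /not_implyP[_]; rewrite lee_fin normrM.
have [->|/vA Ax] := eqVneq (v x) 0; first by rewrite normr0 !mulr0 lexx.
by move=> h; split => //; rewrite ltNge; apply/negP => h'; apply: h; rewrite ler_wpM2r.
Qed.

(** This places r dm among the functionals for which translation and convolution can be moved
    outside. *)
Lemma ess_bounded_functional : Cc_functional (fun v => \int[m]_x (r x * v x)).
Proof.
split=> [s f g cf cg|C cC].
  have := Rintegral_lin s 1 (ess_bounded_mul_integrable cf) (ess_bounded_mul_integrable cg).
  rewrite mul1r => <-; congr (Rintegral _ _ _); apply/funext => x; ring.
exists (M * fine (m C)); first by rewrite mulr_ge0 ?fine_ge0// hr.1.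
move=> v N cv vC vN; apply: (le_trans (ess_bounded_integral_le cv)).
rewrite -mulrA ler_wpM2l ?hr.1//; apply: le_trans (ler_norm _) _.
apply: (Rintegral_abs_le hausK rm (Cc_norm hausK cv) cC).
  by move=> x h; apply: vC; rewrite -normr_eq0.
by move=> x; rewrite normr_id.
Qed.

(* r need not be integrable for [conv H y z], but its distance to a function of
   C_c(K) has a majorant whose translates have a small integral. *)
Lemma ess_bounded_adjoint k y : Cc k ->
  \int[m]_z (P y z r * k z) = \int[m]_z (r z * P y~ z k).
Proof.
move=> ck; have [A cA kA] := Cc_supp ck.
have ck2 := conv_slice_Cc H y~ ck; have [B cB k2B] := Cc_supp ck2.
have [N N0 hN] := Cc_bounded ck; have [N2 N20 hN2] := Cc_bounded ck2.
(* [C1] holds every y * z with z in the support of k, and B the support of T_{y~} k. The two sides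
   use r only on their union, where it agrees with an integrable function. *)
have [C1 cC1 hC1] := conv_supp_compact_union H (@compact_set1 K y) cA.
have cC : compact (C1 `|` B) by exact: compactU.
(* The left side costs a factor 2 for the integral against y * z and another for the one against m;
   the right side only the latter. *)
apply: (@eq_of_small _ _ _ (4 * N + 2 * N2)) => e e0.
have [w [phi [cw lphi hw Iphi]]] := approx_integrable hausK lcK rm (ess_bounded_integrable cC) e0.
have hw' t : (C1 `|` B) t -> ((`|r t - w t|)%:E <= phi t)%E.
  by move=> Ct; have := hw t; rewrite indicE mem_set// mulr1.
have [lT IT] := ltranslate_lsc_le hm y lphi.
have lT' : lsc_ge0 (ltranslate H y phi) by split => // z; exact: ltranslate_ge0.
have IT0 := le_trans IT Iphi.
have l1 := lsc_scale (mulr_ge0 (ler0n R 2) N0) lT'.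
have l2 := lsc_scale N20 lphi.
have i1 := Cc_integrable hausK rm (Cc_mulr hausK (conv_slice_Cc H y cw) (Cc_continuous ck)).
have i2 := Cc_integrable hausK rm (Cc_mulr hausK cw (Cc_continuous ck2)).
have e1 : `|\int[m]_z (P y z r * k z) - \int[m]_z (P y z w * k z)| <= 4 * N * e.
  rewrite -lee_fin; apply: (le_trans (integral_close (lsc_ge0_measurable l1) l1.1 i1 _)).
    move=> z; rewrite -mulrBl normrM.
    have [->|kz] := eqVneq (k z) 0.
      by rewrite normr0 mulr0 mule_ge0// ?lee_fin ?mulr_ge0//; exact: lT'.1.
    rewrite EFinM muleC; have -> : 2 * N = N * 2 by ring.
    rewrite (EFinM N) -muleA; apply: lee_pmul; rewrite ?lee_fin//.
    rewrite mule_natl mule2n; apply: (integral_close_msupp hausK (conv_radon H y z)).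
    - exact: lsc_ge0_measurable.
    - exact: lphi.1.
    - by apply: bounded_cont_integrable; exact: Cc_bounded_cont.
    - by move=> t St; apply: hw'; left; apply: hC1 St => //; exact: kA.
  rewrite -mule2n -mule_natl (integral_lscZ m _ lT') ?mulr_ge0//.
  by rewrite muleA -EFinM mulrA -natrM (EFinM _ e) lee_wpmul2l// lee_fin mulr_ge0.
have e2 : `|\int[m]_z (r z * P y~ z k) - \int[m]_z (w z * P y~ z k)| <= 2 * N2 * e.
  rewrite -lee_fin; apply: (le_trans (integral_close (lsc_ge0_measurable l2) l2.1 i2 _)).
    move=> z; rewrite -mulrBl normrM.
    have [->|/k2B Bz] := eqVneq (P y~ z k) 0.
      by rewrite normr0 mulr0 mule_ge0// ?lee_fin//; exact: lphi.1.
    rewrite EFinM muleC; apply: lee_pmul; rewrite ?lee_fin//.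
    by apply: hw'; right.
  rewrite -mule2n -mule_natl (integral_lscZ m N20 lphi).
  by rewrite muleA -EFinM (EFinM _ e) lee_wpmul2l// lee_fin mulr_ge0.
have e3 : \int[m]_z (P y z w * k z) = \int[m]_z (w z * P y~ z k).
  rewrite -(haar_adjoint hm y cw ck); congr (Rintegral _ _ _); apply/funext => z; exact: mulrC.
rewrite e3 in e1; rewrite mulrDl.
by apply: (@abs_tri _ (\int[m]_z (w z * P y~ z k))); rewrite distrC.
Qed.
End EssentiallyBounded.

Section Average.
Variables (R : realType) (K : ptopologicalType) (H : hypergroup R K).
Local Notation bK := (borel K).
Local Notation P x y f := (\int[conv H x y]_t f t).
Local Notation "x ~" := (hinv H x) (at level 8, format "x ~").
Implicit Types (x y z : K) (v : K -> R) (h g : K -> R[i]).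
Variable m : {measure set bK -> \bar R}.
Hypothesis hm : haar_measure H m.
Variable k : K -> R.
Hypothesis ck : Cc k.

(** The convolution of h with z |-> k(z~), in a form where all smoothness is carried by k: it sends
    L^oo to bounded continuous functions. *)
Definition average h x := cintegral m (fun z => h z * (P x~ z k)%:C%C).

Let averageE h x : average h x = Complex (\int[m]_z (complex.Re (h z) * P x~ z k))
  (\int[m]_z (complex.Im (h z) * P x~ z k)).
Proof.
apply: eq_complexP => /=; congr (Rintegral _ _ _); apply/funext => z.
  by rewrite cReM /= mulr0 subr0.
by rewrite cImM /= mulr0 add0r.
Qed.

Let Linfty_ReIm h : Linfty m h -> exists M, ess_bounded m (fun x => complex.Re (h x)) M /\
  ess_bounded m (fun x => complex.Im (h x)) M.
Proof. by move=> hh; have [M hM] := hh.2; exists M; exact: ess_bounds_ReIm. Qed.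

Lemma Linfty_mul_L1 h v : Linfty m h -> Cc v -> L1 m (fun z => h z * (v z)%:C%C).
Proof.
move=> /Linfty_ReIm[M [h1 h2]] cv; split.
  have := ess_bounded_mul_integrable hm h1 cv; congr (integrable _ _ _); apply/funext => z /=.
  by rewrite cReM /= mulr0 subr0.
have := ess_bounded_mul_integrable hm h2 cv; congr (integrable _ _ _); apply/funext => z /=.
by rewrite cImM /= mulr0 add0r.
Qed.

Lemma average_lin (s : R[i]) h g x : Linfty m h -> Linfty m g ->
  average (fun t => s * h t + g t) x = s * average h x + average g x.
Proof.
move=> hh hg; have cx := conv_slice_Cc H x~ ck.
rewrite -(cintegral_lin s (Linfty_mul_L1 hh cx) (Linfty_mul_L1 hg cx)).
by congr cintegral; apply/funext => z; rewrite mulrDl mulrA.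
Qed.

Let slice_norm x : \int[m]_z `|P x z k| <= \int[m]_z `|k z|.
Proof.
apply: le_trans (norm1_translate hm x ck); rewrite /norm1.
have -> // : (fun z => cabs (P x z k)%:C%C) = fun z => `|P x z k|.
by apply/funext => z; rewrite cabs_real.
Qed.

Let average_ReIm_le r M x : ess_bounded m r M ->
  `|\int[m]_z (r z * P x~ z k)| <= M * \int[m]_z `|k z|.
Proof.
move=> hr; apply: (le_trans (ess_bounded_integral_le hm hr (conv_slice_Cc H x~ ck))).
by rewrite ler_wpM2l// hr.1.
Qed.

Lemma average_bc h : Linfty m h -> complex_bounded_cont (average h).
Proof.
move=> /Linfty_ReIm[M [h1 h2]].
have aux r : ess_bounded m r M -> bounded_cont (fun x => \int[m]_z (r z * P x~ z k)).
  move=> hr; split; last by exists (M * \int[m]_z `|k z|) => x; exact: average_ReIm_le.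
  move=> x; apply: (@continuous_comp _ _ _ (hinv H) (fun x => \int[m]_z (r z * P x z k))).
    exact: hinv_cont.
  exact: (ccf_translate_continuous (ess_bounded_functional hm hr) ck).
split; under eq_fun do rewrite averageE; [exact: aux h1|exact: aux h2].
Qed.

Lemma average_le h x : Linfty m h -> cabs (average h x) <= 2 * norm_infty m h * \int[m]_z `|k z|.
Proof.
move=> hh; set I := \int[m]_z `|k z|.
have hM M : ess_bounds m h M -> cabs (average h x) <= M * (2 * I).
  move=> eM; have [h1 h2] := ess_bounds_ReIm hh eM.
  rewrite averageE; apply: (le_trans (cabs_le_sum _)) => /=.
  have -> : M * (2 * I) = M * I + M * I by ring.
  by apply: lerD; [exact: (average_ReIm_le x h1)|exact: (average_ReIm_le x h2)].
have I0 : 0 <= I by apply: Rintegral_ge0.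
have -> : 2 * norm_infty m h * I = norm_infty m h * (2 * I) by ring.
(* [norm_infty] is an infimum of essential bounds, so the estimate for each bound is divided by 2 I
   before passing to it. *)
have [I00|In0] := eqVneq I 0.
  by have [M /hM] := hh.2; rewrite I00 !mulr0.
have Ip : 0 < 2 * I by rewrite mulr_gt0// lt_neqAle eq_sym In0.
rewrite -ler_pdivrMr//; apply: lb_le_inf; first exact: hh.2.
by move=> M /hM; rewrite ler_pdivrMr.
Qed.

(** The adjoint formula moves T_y from h to k as T_{y~}; [ccf_translate] reads this as a translate
    of x |-> \int h T_x k, and the involution restores x~. *)
Lemma average_translate h y x : Linfty m h ->
  average (translate H y h) x = translate H y (average h) x.
Proof.
move=> /Linfty_ReIm[M [h1 h2]].
have Re_average t : complex.Re (average h t) = \int[m]_z (complex.Re (h z) * P t~ z k) by rewrite averageE.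
have Im_average t : complex.Im (average h t) = \int[m]_z (complex.Im (h z) * P t~ z k) by rewrite averageE.
have aux r : ess_bounded m r M ->
    \int[m]_z (P y z r * P x~ z k) = P y x (fun t => \int[m]_z (r z * P t~ z k)).
  move=> hr; have hL := ess_bounded_functional hm hr.
  have cx := conv_slice_Cc H x~ ck.
  rewrite (ess_bounded_adjoint hm hr y cx).
  rewrite -(@ccf_translate _ _ H _ hL k y~ x~ ck).
  rewrite (@conv_inv_eval _ _ H y x (fun t => \int[m]_z (r z * P t z k)))//.
  split; first exact: (ccf_translate_continuous hL ck).
  by exists (M * \int[m]_z `|k z|) => t; rewrite -[t](hinvK H); exact: (average_ReIm_le _ hr).
rewrite averageE /translate; apply: eq_complexP.
  by rewrite [LHS](aux _ h1); congr (Rintegral _ _ _); apply/funext => t; rewrite Re_average.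
by rewrite [LHS](aux _ h2); congr (Rintegral _ _ _); apply/funext => t; rewrite Im_average.
Qed.

Lemma average_character a : real_character H a -> \int[m]_z (k z * a z) = 1 -> average a^R = a^R.
Proof.
move=> ha k1; have [_ _ _ ainv] := ha; apply/funext => x; rewrite averageE.
apply: eq_complexP => /=.
  under eq_Rintegral do rewrite mulrC.
  by rewrite (integral_translate_character hm ha x~ ck) k1 mulr1 ainv.
by under eq_Rintegral do rewrite mul0r; rewrite /Rintegral integral0.
Qed.
End Average.

(** * From left amenability to amenability *)

Section VanishingFunctions.
Variables (R : realType) (K : ptopologicalType) (e : K).
Implicit Types (f g : K -> R[i]).

Definition bc0_pred : {pred (K -> R[i])} := [pred f | `[< complex_bounded_cont f /\ f e = 0 >]].

Lemma bc0_predP f : reflect (complex_bounded_cont f /\ f e = 0) (f \in bc0_pred).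
Proof. exact: asboolP. Qed.

Fact bc0_submod_closed : submod_closed bc0_pred.
Proof.
split; first by apply/bc0_predP; split => //; exact: complex_bounded_cont0.
move=> a f g /bc0_predP[bf f0] /bc0_predP[bg g0]; apply/bc0_predP; split.
  exact: (complex_bounded_cont_lin a bf bg).
by rewrite -[LHS]/(a * f e + g e) f0 g0 mulr0 addr0.
Qed.

HB.instance Definition _ := GRing.isSubmodClosed.Build _ _ bc0_pred bc0_submod_closed.

Record bc0 := Bc0 { bc0_fun :> K -> R[i]; bc0P : bc0_fun \in bc0_pred }.
HB.instance Definition _ := [isSub for bc0_fun].
HB.instance Definition _ := [Choice of bc0 by <:].
HB.instance Definition _ := [SubChoice_isSubLmodule of bc0 by <:].
End VanishingFunctions.

Section SupNorm.
Variables (R : realType) (K : ptopologicalType) (e : K).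
Local Notation X := (bc0 R e).
Implicit Types (f g : X).

Lemma bc0_bc f : complex_bounded_cont f. Proof. by case: (bc0_predP _ _ (bc0P f)). Qed.
Lemma bc0_vanish f : f e = 0. Proof. by case: (bc0_predP _ _ (bc0P f)). Qed.

Definition supnorm f : R := sup [set cabs (f x) | x in [set: K]].

Lemma cabs_le_supnorm f x : cabs (f x) <= supnorm f.
Proof.
have [M _ hM] := complex_bounded_contP (bc0_bc f).
by apply: ub_le_sup; [exists M => _ [y _ <-]|exists x].
Qed.

Lemma supnorm_le f (M : R) : (forall x, cabs (f x) <= M) -> supnorm f <= M.
Proof.
move=> hM; apply: ge_sup; first by exists (cabs (f e)), e.
by move=> _ [y _ <-].
Qed.

Lemma supnorm_ge0 f : 0 <= supnorm f.
Proof. exact: le_trans (cabs_ge0 (f e)) (cabs_le_supnorm f e). Qed.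

Lemma supnormD f g : supnorm (f + g) <= supnorm f + supnorm g.
Proof.
apply: supnorm_le => x; rewrite -[(f + g) x]/(f x + g x).
by rewrite (le_trans (cabsD _ _))// lerD// cabs_le_supnorm.
Qed.

Lemma supnormZ (a : R[i]) f : supnorm (a *: f) = cabs a * supnorm f.
Proof.
have h b g : supnorm (b *: g) <= cabs b * supnorm g.
  apply: supnorm_le => x; rewrite -[(b *: g) x]/(b * g x) cabsM.
  by rewrite ler_wpM2l ?cabs_ge0// cabs_le_supnorm.
apply/eqP; rewrite eq_le h andTb; have [->|a0] := eqVneq a 0.
  by rewrite normr0 mul0r supnorm_ge0.
have an0 : 0 < cabs a.
  by rewrite lt_neqAle cabs_ge0 andbT eq_sym; apply: contra_neq a0 => /cabs0_eq0.
(* The reverse inequality is [h] for the inverse scalar. *)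
rewrite mulrC -ler_pdivlMr//; have := h a^-1 (a *: f).
rewrite scalerA mulVf// scale1r => /le_trans; apply.
rewrite mulrC ler_wpM2l ?supnorm_ge0//.
by rewrite -(mulfK (lt0r_neq0 an0) (cabs a^-1)) -cabsM mulVf// normr1 mul1r.
Qed.

Lemma supnorm0_eq0 f : supnorm f = 0 -> f = 0.
Proof.
move=> f0; apply/val_inj/funext => x; apply/cabs0_eq0/le_anti.
by rewrite cabs_ge0 -f0 cabs_le_supnorm.
Qed.

Fact bc0_normD f g : (supnorm (f + g))%:C%C <= (supnorm f)%:C%C + (supnorm g)%:C%C.
Proof. by rewrite -rmorphD lecR supnormD. Qed.
Fact bc0_normZ (a : R[i]) f : (supnorm (a *: f))%:C%C = `|a| * (supnorm f)%:C%C.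
Proof. by rewrite supnormZ -(normReK a) -rmorphM. Qed.
Fact bc0_norm0 f : (supnorm f)%:C%C = 0 -> f = 0.
Proof. by move=> /complexI/supnorm0_eq0. Qed.

HB.instance Definition _ := Lmodule_isNormed.Build R[i] X bc0_normD bc0_normZ bc0_norm0.

End SupNorm.

Section Completeness.
Variables (R : realType) (K : ptopologicalType) (e : K).
Local Notation X := (bc0 R e).

(** Pointwise limits of p along F, with the Cauchy estimate kept uniform in x; p is then taken to be
    the real and the imaginary part. *)
Let complete_part (F : set_system X) (p : R[i] -> R) : ProperFilter F -> cauchy F ->
  (forall z w, `|p z - p w| <= cabs (z - w)) ->
  exists l : K -> R, forall (f0 : X) (d : R), F [set f : X | cabs (f0 - f) <= d] ->
    forall x, `|p (f0 x) - l x| <= d.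
Proof.
move=> PF /cauchyP Fc hp.
have hx x : cvg ((fun f : X => p (f x)) @ F).
  apply: cauchy_cvg; apply/cauchyP => d d0.
  have d0' : 0 < (d%:C%C : R[i]) by rewrite ltcR.
  have [f0 hf0] := Fc _ d0'; exists (p (f0 x)).
  change (F [set f : X | ball (p (f0 x)) d (p (f x))]).
  apply: filterS hf0 => f; rewrite /= -!ball_normE => h.
  have {}h : cabs (f0 - f) < d by rewrite -ltcR normReK.
  apply: le_lt_trans (hp _ _) _; apply: le_lt_trans _ h.
  exact: (cabs_le_supnorm (f0 - f) x).
exists (fun x => lim ((fun f : X => p (f x)) @ F)) => f0 d hF x.
apply/ler_addgt0Pr => r r0; have /cvgrPdist_le/(_ _ r0) hr := hx x.
have [f [h1 h2]] := filter_ex (filterI hF hr).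
rewrite -(subrKA (p (f x))) (le_trans (ler_normD _ _))//; apply: lerD; last by rewrite distrC.
by apply: le_trans (hp _ _) _; apply: le_trans h1; exact: (cabs_le_supnorm (f0 - f) x).
Qed.

Fact bc0_complete (F : set_system X) : ProperFilter F -> cauchy F -> cvg F.
Proof.
move=> PF Fc.
have hRe (z w : R[i]) : `|complex.Re z - complex.Re w| <= cabs (z - w).
  by have := Re_le_cabs (z - w); rewrite cReD cReN.
have hIm (z w : R[i]) : `|complex.Im z - complex.Im w| <= cabs (z - w).
  by have := Im_le_cabs (z - w); rewrite cImD cImN.
have [l hl] := complete_part PF Fc hRe; have [l' hl'] := complete_part PF Fc hIm.
move/cauchyP in Fc.
pose L x : R[i] := Complex (l x) (l' x).
have hL (f0 : X) (d : R) : F [set f : X | cabs (f0 - f) <= d] -> forall x, cabs (f0 x - L x) <= 2 * d.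
  move=> hF x; apply: (le_trans (cabs_le_sum _)); rewrite mulr_natl mulr2n.
  rewrite cReD cImD cReN cImN; apply: lerD; [exact: hl|exact: hl'].
have hd (d : R) : 0 < d -> exists f0 : X, F [set f : X | cabs (f0 - f) <= d].
  move=> d0; have d0' : 0 < (d%:C%C : R[i]) by rewrite ltcR.
  have [f0 hf0] := Fc _ d0'; exists f0; apply: filterS hf0 => f; rewrite -ball_normE => h.
  by apply: ltW; rewrite -ltcR normReK.
have LP : L \in bc0_pred e.
  apply/bc0_predP; split.
    apply: (@complex_bounded_cont_closed _ _ _ 2) => // d /hd[f0 /hL h].
    exists f0 => [|x]; first exact: bc0_bc.
    by rewrite -cabsN opprB.
  apply: (@cabs_small_eq _ _ _ 2) => d /hd[f0 /hL /(_ e)].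
  by rewrite bc0_vanish sub0r subr0 cabsN.
apply/cvg_ex; exists (Bc0 LP); apply/cvgrPdist_le => eps eps0.
have [r r0 ->] : exists2 r, 0 < r & eps = r%:C%C.
  exists (complex.Re eps); first by move: eps0; rewrite ltcE => /andP[].
  by apply: eq_complexP => //=; apply/complexI; apply: RIm_real; exact: gtr0_real.
(* Two thirds go to the distance from [f0] to the limit, estimated part by part, and one third to
   that from [f0] to f. *)
have r4 : 0 < r / 3 by rewrite divr_gt0.
have [f0 hf0] := hd _ r4; have hL0 := hL f0 _ hf0; apply: filterS hf0 => f hf.
rewrite -normReK lecR; have -> : Bc0 LP - f = - (f0 - Bc0 LP) + (f0 - f).
  by rewrite opprB addrA subrK.
apply: (le_trans (cabsD _ _)); rewrite cabsN.
apply: (@le_trans _ _ (2 * (r / 3) + r / 3)); last by lra.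
apply: lerD => //; apply: supnorm_le => x; exact: (hL0 x).
Qed.

HB.instance Definition _ := Uniform_isComplete.Build X bc0_complete.

End Completeness.

(** * The bimodule of vanishing functions and its evaluation derivation *)

Section Backward.
Variables (R : realType) (K : ptopologicalType) (H : hypergroup R K).
Hypothesis hcomm : commutative_hypergroup H.
Local Notation bK := (borel K).
Implicit Types (x y z : K) (f g h : K -> R[i]).
Variable m : {measure set bK -> \bar R}.
Hypothesis hm : haar_measure H m.
Variable a : K -> R.
Hypothesis ha : real_character H a.

Local Notation e := (hid H).
Local Notation X := (bc0 R e).
Local Notation cv := (convolution H m).
Local Notation ft f := (fourier m f a^R).
Implicit Type u : X.

Local Notation ba := (character_bounded_cont ha).
Let ae1 : a e = 1. Proof. by case: ha. Qed.

(* 0 when h is not in the space. *)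
Definition bc0_lift h : X := if pselect (h \in bc0_pred e) is left p then Bc0 p else 0.

Lemma bc0_liftE h : h \in bc0_pred e -> bc0_lift h = h :> (K -> R[i]).
Proof. by rewrite /bc0_lift; case: pselect. Qed.

Definition deviation h : K -> R[i] := fun x => - h e * (a x)%:C%C + h x.

Lemma deviation_bc0 h : complex_bounded_cont h -> deviation h \in bc0_pred e.
Proof.
move=> bh; apply/bc0_predP; split; first exact: (complex_bounded_cont_lin _ ba bh).
by rewrite /deviation ae1 mulr1 addNr.
Qed.

(** The projection of the bounded continuous functions onto X along the line of a. *)
Definition vanishing_part h : X := bc0_lift (deviation h).

Lemma vanishing_partE h x : complex_bounded_cont h -> vanishing_part h x = - h e * (a x)%:C%C + h x.
Proof. by move=> bh; rewrite /vanishing_part bc0_liftE//; exact: deviation_bc0. Qed.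

Lemma vanishing_part_lin (s : R[i]) f g : complex_bounded_cont f -> complex_bounded_cont g ->
  vanishing_part (fun x => s * f x + g x) = s *: vanishing_part f + vanishing_part g.
Proof.
move=> bf bg; apply/val_inj/funext => x /=.
rewrite -[RHS]/(s * vanishing_part f x + vanishing_part g x) !vanishing_partE//; last exact: complex_bounded_cont_lin.
by ring.
Qed.

Let ract0 u f : X := vanishing_part (cv f u).
Let lact0 f u : X := ft f *: u.

Let cv_bc f u : L1 m f -> complex_bounded_cont (cv f u).
Proof. by move=> hf; exact: (convolution_bc hm hf (bc0_bc u)). Qed.

Let ract0E u f x : L1 m f -> ract0 u f x = - cv f u e * (a x)%:C%C + cv f u x.
Proof. by move=> hf; rewrite /ract0 vanishing_partE//; exact: cv_bc. Qed.

Lemma fourier_lin (s : R[i]) f g : L1 m f -> L1 m g ->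
  ft (fun x => s * f x + g x) = s * ft f + ft g.
Proof.
move=> hf hg; rewrite !(fourier_real_character m) -(cintegral_lin s (L1_mul hf ba) (L1_mul hg ba)).
by congr cintegral; apply/funext => x; rewrite mulrDl mulrA.
Qed.

Let A := sval (cid2 (complex_bounded_contP ba)).
Let A0 : 0 <= A. Proof. by rewrite /A; case: cid2. Qed.
Let aA x : cabs (a x)%:C%C <= A. Proof. by rewrite /A; case: cid2 => /= M _; apply. Qed.

Let vanishing_part_le h (M : R) : complex_bounded_cont h -> (forall x, cabs (h x) <= M) ->
  cabs (vanishing_part h) <= (A + 1) * M.
Proof.
move=> bh hM; apply: supnorm_le => x; rewrite vanishing_partE// (le_trans (cabsD _ _))//.
rewrite mulrDl mul1r; apply: lerD => //; rewrite cabsM cabsN mulrC.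
by apply: ler_pM => //; exact: cabs_ge0.
Qed.

Lemma vanishing_part_bounded : exists2 c, 0 <= c & forall h (M : R), complex_bounded_cont h ->
  (forall x, cabs (h x) <= M) -> cabs (vanishing_part h) <= c * M.
Proof. by exists (A + 1); [rewrite addr_ge0|exact: vanishing_part_le]. Qed.

Fact bc0_lact_linearl u : linear_on (L1 m) (fun f => lact0 f u).
Proof. by move=> s f g hf hg; rewrite /lact0 fourier_lin// scalerDl scalerA. Qed.

Fact bc0_ract_linearr u : linear_on (L1 m) (fun f => ract0 u f).
Proof.
move=> s f g hf hg; rewrite /ract0 -vanishing_part_lin; last 2 first.
- by exact: cv_bc.
- by exact: cv_bc.
congr vanishing_part; apply/funext => x; apply: convolution_linl => //; exact: bc0_bc.
Qed.

Fact bc0_lact_linearr f : L1 m f -> linear (lact0 f).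
Proof. by move=> _ s u v; rewrite /lact0 scalerDr !scalerA mulrC. Qed.

Fact bc0_ract_linearl f : L1 m f -> linear (fun u => ract0 u f).
Proof.
move=> hf s u v; rewrite /ract0 -vanishing_part_lin; last 2 first.
- by exact: cv_bc.
- by exact: cv_bc.
congr vanishing_part; apply/funext => x.
exact: (convolution_linr H s x hf (bc0_bc u) (bc0_bc v)).
Qed.

Fact bc0_lact_bounded : exists c : R, forall f u, L1 m f -> cabs (lact0 f u) <= c * norm1 m f * cabs u.
Proof.
exists (2 * A) => f u hf; rewrite cabsZ ler_wpM2r ?cabs_ge0//.
rewrite (fourier_real_character m); apply: (le_trans (cintegral_le (L1_mul hf ba))).
by rewrite -mulrA ler_wpM2l//; exact: (norm1_mul hf ba).
Qed.

Let cv_le f u x : L1 m f -> cabs (cv f u x) <= 4 * norm1 m f * cabs u.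
Proof.
move=> hf; rewrite mulrAC; apply: (convolution_le H x hf (bc0_bc u)); first exact: cabs_ge0.
exact: cabs_le_supnorm.
Qed.

Fact bc0_ract_bounded : exists c : R, forall f u, L1 m f -> cabs (ract0 u f) <= c * norm1 m f * cabs u.
Proof.
exists ((A + 1) * 4) => f u hf; rewrite -!mulrA; apply: vanishing_part_le.
  by exact: cv_bc.
by move=> x; rewrite mulrA; exact: cv_le.
Qed.

Fact bc0_lactA f g u : L1 m f -> L1 m g -> lact0 (cv f g) u = lact0 f (lact0 g u).
Proof. by move=> hf hg; rewrite /lact0 (fourier_convolution hcomm hm ha)// scalerA. Qed.

Let cv_cv f g u x : L1 m f -> L1 m g -> cv (cv f g) u x = cv g (cv f u) x.
Proof. by move=> hf hg; apply: convolution_assoc => //; exact: bc0_bc. Qed.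

(** Convolving with g keeps the subtracted multiple of a on the line of a, since g * a = g^(a) a. *)
Let cv_ract0 f g u x : L1 m f -> L1 m g ->
  cv g (ract0 u f) x = - cv f u e * (ft g * (a x)%:C%C) + cv g (cv f u) x.
Proof.
move=> hf hg; rewrite -(convolution_character ha x hg).
have -> : bc0_fun (ract0 u f) = fun t => - cv f u e * (a t)%:C%C + cv f u t.
  by apply/funext => t; exact: ract0E.
exact: (convolution_linr H (- cv f u e) x hg ba (cv_bc u hf)).
Qed.

Fact bc0_ractA f g u : L1 m f -> L1 m g -> ract0 u (cv f g) = ract0 (ract0 u f) g.
Proof.
move=> hf hg; have E : cv (cv f g) u = cv g (cv f u) by apply/funext => t; exact: cv_cv.
apply/val_inj/funext => x.
have e1 : ract0 u (cv f g) x = - cv g (cv f u) e * (a x)%:C%C + cv g (cv f u) x.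
  exact: (etrans (congr1 (fun h => vanishing_part h x) E) (vanishing_partE x (convolution_bc hm hg (cv_bc u hf)))).
suff e2 : ract0 (ract0 u f) g x = - cv g (cv f u) e * (a x)%:C%C + cv g (cv f u) x by exact: (etrans e1 (esym e2)).
(* The multiple of a left over from the first projection is annihilated by the second. *)
rewrite (ract0E (ract0 u f) x hg) (cv_ract0 u e hf hg) (cv_ract0 u x hf hg) ae1 mulr1.
by move: (cv g _ e) (cv g _ x) (cv f u e) => p q s; ring.
Qed.

Fact bc0_lact_ract f g u : L1 m f -> L1 m g -> ract0 (lact0 f u) g = lact0 f (ract0 u g).
Proof.
move=> hf hg; have h := bc0_ract_linearl hg (ft f) u 0.
have z : ract0 0 g = 0.
  by have := bc0_ract_linearl hg 1 0 0; rewrite scaler0 addr0 scale1r => /(congr1 (fun t => t - ract0 0 g)); rewrite addrK subrr.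
by rewrite /lact0; move: h; rewrite addr0 z addr0.
Qed.

Definition bc0_bimodule : banach_bimodule H m X := BanachBimodule bc0_lact_linearl
  bc0_ract_linearr bc0_lact_linearr bc0_ract_linearl bc0_lact_bounded bc0_ract_bounded
  bc0_lactA bc0_ractA bc0_lact_ract.

Let Dfun f : X -> R[i]^o := fun u => cv f u e.

Let Dfun_linear f : L1 m f -> linear (Dfun f).
Proof. by move=> hf s u v; exact: (convolution_linr H s e hf (bc0_bc u) (bc0_bc v)). Qed.

(** The derivation identity evaluates D at f * g, which is not shown to satisfy [L1]; linearity in u
    comes here from associativity instead. *)
Let Dfun_linear2 f g : L1 m f -> L1 m g -> linear (Dfun (cv f g)).
Proof.
move=> hf hg s u v; rewrite /Dfun !cv_cv//.
have -> : cv f (s *: u + v) = fun t => s * cv f u t + cv f v t.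
  by apply/funext => t; exact: (convolution_linr H s t hf (bc0_bc u) (bc0_bc v)).
exact: (convolution_linr H s e hg (cv_bc u hf) (cv_bc v hf)).
Qed.

(** D must return a linear map for every function f; the value is 0 where u |-> (f * u)(e) fails to
    be linear. *)
Definition evaluation_derivation f : {linear X -> R[i]^o} :=
  if pselect (linear (Dfun f)) is left p
  then HB.pack (Dfun f) (GRing.isLinear.Build _ _ _ _ (Dfun f) p) else \0.

(** D(g)(u . f) is (g * (f * u))(e) - g^(a) (f * u)(e), the second term arising from the projection;
    D(f)(g . u) = g^(a) (f * u)(e) cancels it and leaves D(f * g)(u). *)
Lemma exists_evaluation_derivation : exists2 D, derivation bc0_bimodule D &
  forall f u, L1 m f -> D f u = cv f u e.
Proof.
have [D DE0] : exists D : (K -> R[i]) -> {linear X -> R[i]^o},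
    forall f u, linear (Dfun f) -> D f u = cv f u e.
  by exists evaluation_derivation => f u; rewrite /evaluation_derivation; case: pselect.
have DE f u : L1 m f -> D f u = cv f u e.
  by move=> hf; apply: DE0; exact: Dfun_linear.
exists D; last exact: DE.
split.
- move=> f hf; apply/continuous_linear_cabs; exists (4 * norm1 m f) => u.
  by rewrite DE//; exact: cv_le.
- move=> u s f g hf hg; rewrite (DE _ u (L1_lin s hf hg)) (DE f u hf) (DE g u hg).
  exact: (convolution_linl H s e hf hg (bc0_bc u)).
- by exists 4 => f u hf; rewrite DE//; exact: cv_le.
- move=> f g u hf hg; rewrite (DE0 _ u (Dfun_linear2 hf hg)).
  rewrite /dual_ract /dual_lact (DE f _ hf) (DE g _ hg) (cv_cv u e hf hg).
  rewrite -[ract bc0_bimodule u f]/(ract0 u f) (cv_ract0 u e hf hg) ae1 mulr1.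
  have -> : cv f (lact0 g u) e = ft g * cv f u e.
    have := Dfun_linear hf (ft g) u 0; rewrite addr0 /Dfun => ->.
    have -> : cv f (0 : X) e = 0 by have := DE f 0 hf; rewrite linear0.
    by rewrite addr0.
  by move: (ft g) (cv f u e) (cv g _ e) => p q s; ring.
Qed.

Lemma left_amenable_functional : alpha_left_amenable H m a^R ->
  exists2 phi : {linear X -> R[i]^o}, continuous phi & forall f u, L1 m f ->
    cv f u e = (phi (vanishing_part (cv f u)) : R[i]) - ft f * (phi u : R[i]).
Proof.
move=> amen; have [D hD DE] := exists_evaluation_derivation.
have [phi cphi hphi] := amen X bc0_bimodule (fun f u _ => erefl) D hD.
exists phi => // f u hf; rewrite -(DE f u hf) (hphi f u hf) /dual_lact /dual_ract.
by rewrite -[lact bc0_bimodule f u]/(ft f *: u) linearZ.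
Qed.
End Backward.

(** * From the implementing functional to the mean *)

Section InvariantMean.
Variables (R : realType) (K : ptopologicalType) (H : hypergroup R K).
Hypothesis hcomm : commutative_hypergroup H.
Local Notation bK := (borel K).
Local Notation P x y f := (\int[conv H x y]_t f t).
Implicit Types (x y z : K) (f g h : K -> R[i]).
Variable m : {measure set bK -> \bar R}.
Hypothesis hm : haar_measure H m.
Variable a : K -> R.
Hypothesis ha : real_character H a.

Let hausK := hyper_hausdorff H.
Let rm : radon m. Proof. by case: hm. Qed.

Local Notation e := (hid H).
Local Notation cv := (convolution H m).
Local Notation ft f := (fourier m f a^R).
Local Notation ba := (character_bounded_cont ha).
Local Notation dev := (@vanishing_part R K H a).

Variable phi : {linear (bc0 R e) -> R[i]^o}.
Hypothesis cphi : continuous phi.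
Hypothesis hphi : forall f (u : bc0 R e), L1 m f ->
  cv f u e = (phi (dev (cv f u)) : R[i]) - ft f * (phi u : R[i]).

Let ae1 : a e = 1. Proof. by case: ha. Qed.

Let M h : R[i] := h e - (phi (dev h) : R[i]).

Let M_lin (s : R[i]) f g : complex_bounded_cont f -> complex_bounded_cont g ->
  M (fun x => s * f x + g x) = s * M f + M g.
Proof.
move=> bf bg; rewrite /M (vanishing_part_lin ha s bf bg) linearP.
by move: (phi (dev f) : R[i]) (phi (dev g) : R[i]) => p q; rewrite -[_ *: _]/(_ * _); ring.
Qed.

Let dev_a : dev a^R = 0.
Proof.
apply/val_inj/funext => x; have h := vanishing_partE ha x ba; rewrite ae1 mulN1r addNr in h; exact: h.
Qed.

Let M_a : M a^R = 1.
Proof. by rewrite /M dev_a linear0 subr0 ae1. Qed.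

(** Write h = h(e) a + u with u in X. On a the claim is f * a = f^(a) a with M(a) = 1; on u it is
    the identity [hphi], because M(u) = - phi(u). *)
Let M_convolution f h : L1 m f -> complex_bounded_cont h -> M (cv f h) = ft f * M h.
Proof.
move=> hf bh; set u := dev h.
have bu : complex_bounded_cont u := bc0_bc u.
have bcu := convolution_bc hm hf bu.
have hE : h = fun x => h e * (a x)%:C%C + u x.
  by apply/funext => x; rewrite /u (vanishing_partE ha x bh) mulNr addNKr.
have cE : cv f h = fun x => (h e * ft f) * (a x)%:C%C + cv f u x.
  apply/funext => x; rewrite {1}hE (convolution_linr H (h e) x hf ba bu).
  by rewrite (convolution_character ha x hf) mulrA.
rewrite cE (M_lin _ ba bcu) M_a mulr1 {1}/M (hphi u hf) /M -/u.
by move: (phi (dev _) : R[i]) (phi u : R[i]) => p q; ring.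
Qed.

Let M_le : exists2 c : R, 0 <= c & forall h (N : R), complex_bounded_cont h -> 0 <= N ->
  (forall x, cabs (h x) <= N) -> cabs (M h) <= c * N.
Proof.
have [c hc] := (continuous_linear_cabs phi).1 cphi.
have [A A0 hA] := vanishing_part_bounded ha.
exists (1 + `|c| * A) => [|h N bh N0 hN]; first by rewrite addr_ge0// mulr_ge0.
rewrite /M (le_trans (cabsD _ _))// cabsN mulrDl mul1r; apply: lerD => //.
apply: (le_trans (hc _)); apply: (@le_trans _ _ (`|c| * cabs (dev h))).
  by rewrite ler_wpM2r ?cabs_ge0// ler_norm.
by rewrite -mulrA ler_wpM2l//; exact: hA.
Qed.

Variable k : K -> R.
Hypothesis ck : Cc k.
Hypothesis k1 : \int[m]_x (k x * a x) = 1.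

(** Since k^(a) = 1, convolving with k does not change the value of M; the translation then passes
    to k, where it only alters the Fourier factor to a(y). *)
Let M_translate h y : complex_bounded_cont h -> M (translate H y h) = (a y)%:C%C * M h.
Proof.
move=> bh; have lk := L1_Cc hausK rm ck.
have lky := L1_Cc hausK rm (conv_slice_Cc H y ck).
have bt := translate_bounded_cont H y bh.
have fk : ft k^R = 1 by rewrite fourier_real k1.
have fky : ft (fun z => P y z k)^R = (a y)%:C%C.
  by rewrite fourier_real (integral_translate_character hm ha y ck) k1 mulr1.
have E : cv k^R (translate H y h) = cv (fun z => P y z k)^R h.
  by apply/funext => x; exact: (convolution_translate_complex hcomm hm x y ck bh).
rewrite -[LHS]mul1r -fk -(M_convolution lk bt) -fky -(M_convolution lky bh).
exact: (congr1 M E).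
Qed.

Lemma functional_amenable : alpha_amenable H m a^R.
Proof.
exists (fun h => M (average H m k h)); split.
- move=> s f g hf hg; rewrite -[RHS]/(s * M (average H m k f) + M (average H m k g)).
  rewrite -(M_lin s (average_bc hm ck hf) (average_bc hm ck hg)).
  by congr M; apply/funext => x; exact: (average_lin hm ck).
- have [c c0 hc] := M_le; exists (c * (2 * \int[m]_z `|k z|)) => f hf.
  have I0 : 0 <= \int[m]_z `|k z| by apply: Rintegral_ge0.
  rewrite -mulrA; apply: hc; first exact: (average_bc hm ck hf).
    by rewrite !mulr_ge0// norm_infty_ge0.
  by move=> x; rewrite mulrAC; exact: (average_le hm ck).
- by rewrite (average_character hm ck ha k1) M_a.
- move=> f x hf; rewrite -M_translate; last exact: (average_bc hm ck hf).
  by congr M; apply/funext => y; exact: (average_translate hm ck x y hf).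
Qed.
End InvariantMean.

Lemma left_amenable_amenable (R : realType) (K : ptopologicalType) (H : hypergroup R K)
    (m : {measure set (borel K) -> \bar R}) (a : K -> R) :
  commutative_hypergroup H -> haar_measure H m -> real_character H a ->
  alpha_left_amenable H m a^R -> alpha_amenable H m a^R.
Proof.
move=> hcomm hm ha amen.
have [phi cphi hphi] := left_amenable_functional hcomm hm ha amen.
have [k ck k1] := exists_normalized hm ha.
exact: (functional_amenable hcomm hm ha cphi hphi ck k1).
Qed.

Unset Implicit Arguments.

Theorem theorem1p1 (R : realType) (K : ptopologicalType) (H : hypergroup R K)
    (hcomm : commutative_hypergroup H)
    (m : {measure set (borel K) -> \bar R}) (hm : haar_measure H m)
    (alpha : K -> R[i]) (halpha : hermitian_character H alpha)
    (hreal : forall x : K, alpha x \is Num.real) :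
  alpha_amenable H m alpha <-> alpha_left_amenable H m alpha.
Proof.
have [a ha ->] := real_characterP halpha hreal.
split; first exact: amenable_left_amenable.
exact: left_amenable_amenable.
Qed.
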